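(* Let $\tau$ be the normalised trace on $M_n(\mathbb{C})$ and let $N\subseteq (M_n(\mathbb{C}),\tau)$ be a unital inclusion of a $*$-subalgebra such that $\tau|_{N'}$ is the Markov trace for $\mathbb{C}\subseteq N'$, where $N'$ is the commutant of $N$ in $M_n(\mathbb{C})$. Put $A_0:=N'\otimes 1\otimes 1$, $A_1:=1\otimes N'\otimes 1$ and $B:=1\otimes1\otimes N'$. If $(\omega,\{F_i\}_{i=1}^d,\{T_i\}_{i=1}^d)$ is a tight, minimal, faithful teleportation scheme for $A_0$ with respect to $$M_n(\mathbb{C})\otimes M_n(\mathbb{C})\otimes 1,\quad 1\otimes1\otimes N'\ \subseteq\ M_n(\mathbb{C})\otimes M_n(\mathbb{C})\otimes N',$$ then there exist (1) an orthonormal basis $\{u_i\}_{i=1}^d$ of $M_n(\mathbb{C})$ over $N$ in $\mathcal{N}_{M_n(\mathbb{C})}(N)$, (2) a unitary $u\in\mathcal{N}_{M_n(\mathbb{C})}(N)$, and (3) a positive invertible operator $z\in\mathcal{Z}(N)$ (the centre of $N$) such that \begin{itemize} \item $\omega=[M_n(\mathbb{C}):N]\,(1\otimes z^{1/2}u)\,e_N\,(1\otimes u^*z^{1/2})$, an operator in the second and third tensor factors; \item $F_i=(u_i^*u\otimes1)\,e_N\,(u^*u_i\otimes1)$, $i=1,\dots,d$, operators in the first and second tensor factors; \item $T_i(x)=u_ixu_i^*$ for $x\in N'$ and $i=1,\dots,d$, where $N'$ is identified with $B=1\otimes1\otimes N'$. \end{itemize}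
   Context: Inclusions are unital. For a tracial von Neumann algebra $(M,\tau)$ with subalgebra $N$: $\Lambda_\tau:M\to L^2(M,\tau)$ is the GNS map, $e_N$ is the orthogonal projection of $L^2(M,\tau)$ onto $\overline{\Lambda_\tau(N)}$ and $E_N:M\to N$ is the $\tau$-preserving conditional expectation. A (left Pimsner--Popa) basis for $M$ over $N$ is a finite subset $\{\lambda_i\}\subseteq M$ with $\sum_i\lambda_i^*e_N\lambda_i=1$; it is orthonormal if $E_N(\lambda_i\lambda_j^* )=\delta_{i,j}1$. The normaliser is $\mathcal{N}_M(N)=\{u\in M\text{ unitary}: u^*Nu=N\}$. Let $M_1=\langle M,e_N\rangle\subseteq\mathcal{B}(L^2(M,\tau))$, with canonical trace $\mathrm{tr}_1$ determined by $\mathrm{tr}_1(xe_Ny)=\tau(xy)$, $x,y\in M$. The trace $\tau$ is Markov for $N\subseteq M$ if $\mathrm{tr}_1$ is finite and $\tau_1:=\mathrm{tr}_1(1)^{-1}\mathrm{tr}_1$ restricts to $\tau$ on $M$. For $\mathbb{C}\subseteq\bigoplus_jM_{m_j}(\mathbb{C})$ the unique Markov trace is $\frac{1}{\sum_jm_j^2}\sum_jm_j\mathrm{tr}_{m_j}$, with $\mathrm{tr}_{m_j}$ the unnormalised trace. If $\tau$ is Markov and a finite basis $\{\lambda_i\}$ exists (automatic for $N\subseteq M_n(\mathbb{C})$), the index $[M:N]$ is the scalar with $\sum_i\lambda_i^*\lambda_i=[M:N]1$. Identification. Fix an orthonormal basis of $\mathbb{C}^n$ block-diagonalising $N'$, i.e.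 in which $N=\bigoplus_jM_{n_j}(\mathbb{C})\otimes1_{m_j}$ and $N'=\bigoplus_j1_{n_j}\otimes M_{m_j}(\mathbb{C})$; transposition $t$ is taken in this basis. $L^2(M_n(\mathbb{C}),\tau)$ is identified with $\mathbb{C}^n\otimes\mathbb{C}^n$ via $\Lambda_\tau(x)=(x\otimes1)\psi_n$, $\psi_n=n^{-1/2}\sum_k|kk\rangle$, so left multiplication by $x$ is $x\otimes1$, right multiplication by $x$ is $1\otimes x^t$, and $e_N\in N'\otimes N'\subseteq M_n(\mathbb{C})\otimes M_n(\mathbb{C})$. $A\vee B$ denotes the von Neumann algebra generated by $A\cup B$. For commuting von Neumann subalgebras $A,B$ of $R$, a one-way right LOCC map relative to $A,B\subseteq R$ is a normal unital completely positive (UCP) map on $R$ of the form $\sum_iS_i\circ T_i$ (point-weak* convergent), with $S_i:R\to R$ normal CP $B$-bimodule maps with $S_i(A)\subseteq A$, and $T_i:R\to R$ normal UCP $A$-bimodule maps with $T_i(B)\subseteq B$. Teleportation scheme. Let $A,B$ be commuting von Neumann subalgebras of a tracial von Neumann algebra $(R,\tau_R)$, and let $A_0,A_1\subseteq A$ be von Neumann subalgebras with anti-isomorphisms $\gamma_0:A_0\to A_1$, $\gamma_1:A_1\to B$; put $\Gamma=\gamma_1\circ\gamma_0$. A $\tau_R$-density is a positive element of trace $1$. A teleportation scheme for $A_0$ relative to $A,B\subseteq A\vee B$ consists of: a $\tau_R$-density $\omega\in A_0'\cap R$; a collection $\{T_i\}_{i\in I}$ of normal UCP $A$-bimodule maps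 on $A\vee B$ with $T_i(B)\subseteq B$; and a POVM $\{F_i\}_{i\in I}$ in $A$ (positive operators summing to $1$) such that $\sum_i\mathrm{Ad}(F_i)\circ T_i$, where $\mathrm{Ad}(F_i)(x)=F_ixF_i$, is a one-way right LOCC map relative to $A,B\subseteq A\vee B$ and $$\sum_{i\in I}E_{A_0}(F_iT_i(\Gamma(a))\omega)=a,\qquad a\in A_0$$ (weak* convergence), where $E_{A_0}$ is the $\tau_R$-preserving conditional expectation $R\to A_0$. The scheme is faithful if $\tau_R(F_i\rho\omega)>0$ for all $i$ and all $\tau_R$-densities $\rho\in A_0$; minimal if $\omega\in A_1\vee B$ and $F_i\in A_0\vee A_1$ for all $i$; and, when $|I|<\infty$, tight if $\dim(A_0)=|I|$. Here $R=M_n(\mathbb{C})\otimes M_n(\mathbb{C})\otimes N'$ with $\tau_R=\tau\otimes\tau\otimes\tau|_{N'}$, $A=M_n(\mathbb{C})\otimes M_n(\mathbb{C})\otimes1$, $\gamma_0(x\otimes1\otimes1)=1\otimes x^t\otimes1$ and $\gamma_1(1\otimes x\otimes1)=1\otimes1\otimes x^t$, so $\Gamma(x\otimes1\otimes1)=1\otimes1\otimes x$ for $x\in N'$. *)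

(* Defs.v *)
From mathcomp Require Export all_boot all_order all_algebra.
From mathcomp Require Export finmap classical_sets reals.
From mathcomp.real_closed Require Export mxtens complex.

Set Implicit Arguments.
Unset Strict Implicit.
Unset Printing Implicit Defensive.

Import Order.TTheory GRing.Theory Num.Theory.
Local Open Scope classical_set_scope.
Local Open Scope ring_scope.
Local Open Scope sesquilinear_scope.

(* Everything is finite dimensional: a von Neumann algebra is a unital
   *-subalgebra of some 'M[C]_m, represented by its set of elements; all linear
   maps are normal, and weak* convergence is entrywise convergence.  A map on
   an algebra R is a function on the ambient matrices of which only the
   restriction to R is ever constrained. *)

(* The complex numbers, for R the real numbers. *)
Definition cplx (R : realType) : numClosedFieldType := R[i].

Section Operators.
Variable C : numClosedFieldType.

(* Normalised trace.  On 'M_n (x) 'M_n (x) 'M_n it is the product of the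
   normalised traces of the factors. *)
Definition ntr m (X : 'M[C]_m) : C := \tr X / m%:R.

Definition psd m (X : 'M[C]_m) : Prop :=
  forall v : 'cV[C]_m, 0 <= (v^t* *m X *m v) 0 0.

Definition star_alg m (A : set 'M[C]_m) : Prop :=
  [/\ A 0,
      forall x y, A x -> A y -> A (x + y),
      forall (a : C) x, A x -> A (a *: x),
      forall x y, A x -> A y -> A (x *m y) &
      forall x, A x -> A (x^t*)].

Definition unital_star_alg m (A : set 'M[C]_m) : Prop :=
  star_alg A /\ A 1%:M.

Definition commutant m (A : set 'M[C]_m) : set 'M[C]_m :=
  [set y | forall x, A x -> x *m y = y *m x].

Definition star_alg_gen m (S : set 'M[C]_m) : set 'M[C]_m :=
  smallest (@star_alg m) S.

Definition vee m (A B : set 'M[C]_m) : set 'M[C]_m := star_alg_gen (A `|` B).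

Definition has_dim m (A : set 'M[C]_m) (d : nat) : Prop :=
  exists2 V : {vspace 'M[C]_m}, (forall x, (x \in V) <-> A x) & \dim V = d.

Definition density m (A : set 'M[C]_m) (rho : 'M[C]_m) : Prop :=
  [/\ A rho, psd rho & ntr rho = 1].

Definition linear_on m (R : set 'M[C]_m) (Phi : 'M[C]_m -> 'M[C]_m) : Prop :=
  forall (a : C) x y, R x -> R y -> Phi (a *: x + y) = a *: Phi x + Phi y.

Definition bimodule_map m (R A : set 'M[C]_m) (Phi : 'M[C]_m -> 'M[C]_m) : Prop :=
  forall a x b, A a -> R x -> A b -> Phi (a *m x *m b) = a *m Phi x *m b.

Definition cp m (R : set 'M[C]_m) (Phi : 'M[C]_m -> 'M[C]_m) : Prop :=
  [/\ forall x, R x -> R (Phi x),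
      linear_on R Phi &
      forall (k : nat) (X : 'I_k -> 'I_k -> 'M[C]_m),
        (forall i j, R (X i j)) ->
        psd (\mxblock_(i < k, j < k) X i j) ->
        psd (\mxblock_(i < k, j < k) Phi (X i j))].

Definition ucp m (R : set 'M[C]_m) (Phi : 'M[C]_m -> 'M[C]_m) : Prop :=
  cp R Phi /\ Phi 1%:M = 1%:M.

Definition cond_exp m (R A : set 'M[C]_m) (E : 'M[C]_m -> 'M[C]_m) : Prop :=
  [/\ [/\ linear_on R E,
          forall x, R x -> A (E x) &
          forall a, A a -> E a = a],
      bimodule_map R A E,
      forall x, R x -> psd x -> psd (E x) &
      forall x, R x -> ntr (E x) = ntr x].

Definition ortho_proj m (S : set 'cV[C]_m) (P : 'M[C]_m) : Prop :=
  [/\ P^t* = P, P *m P = P & [set P *m v | v in setT] = S].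

(* Unconditional point-weak* convergence of sum_(i : I) Psi i to Phi on R: the
   net of partial sums over the finite subsets of I converges entrywise. *)
Definition point_weak_sum m (R : set 'M[C]_m) (I : choiceType)
    (Psi : I -> 'M[C]_m -> 'M[C]_m) (Phi : 'M[C]_m -> 'M[C]_m) : Prop :=
  forall x, R x -> forall (p q : 'I_m) (eps : C), 0 < eps ->
    exists J0 : {fset I}, forall J : {fset I}, (J0 `<=` J)%fset ->
      `|(\sum_(i <- J) Psi i x) p q - Phi x p q| < eps.

Definition one_way_right_LOCC m (R A B : set 'M[C]_m)
    (Phi : 'M[C]_m -> 'M[C]_m) : Prop :=
  ucp R Phi /\
  exists (I : choiceType) (S T : I -> 'M[C]_m -> 'M[C]_m),
    [/\ forall i, [/\ cp R (S i), bimodule_map R B (S i) &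
                      forall a, A a -> A (S i a)],
        forall i, [/\ ucp R (T i), bimodule_map R A (T i) &
                      forall b, B b -> B (T i b)] &
        point_weak_sum R (fun i => S i \o T i) Phi].

(* Schemes with index set 'I_d.  E stands for the trace-preserving conditional
   expectation of R onto A0, and Gamma : A0 -> B for the isomorphism obtained
   by composing the anti-isomorphisms A0 -> A1 and A1 -> B. *)
Record teleportation_scheme m d (R A B A0 : set 'M[C]_m)
    (Gamma E : 'M[C]_m -> 'M[C]_m) (omega : 'M[C]_m)
    (F : 'I_d -> 'M[C]_m) (T : 'I_d -> 'M[C]_m -> 'M[C]_m) : Prop := {
  ts_density : density (commutant A0 `&` R) omega;
  ts_ucp : forall i, ucp (vee A B) (T i);
  ts_bimodule : forall i, bimodule_map (vee A B) A (T i);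
  ts_preserve : forall i b, B b -> B (T i b);
  ts_povm_in : forall i, A (F i);
  ts_povm_psd : forall i, psd (F i);
  ts_povm_sum : \sum_i F i = 1%:M;
  ts_LOCC : one_way_right_LOCC (vee A B) A B
              (fun x => \sum_i F i *m T i x *m F i);
  ts_teleport : forall a, A0 a ->
    \sum_i E (F i *m T i (Gamma a) *m omega) = a }.

Definition faithful_scheme m d (A0 : set 'M[C]_m) (omega : 'M[C]_m)
    (F : 'I_d -> 'M[C]_m) : Prop :=
  forall i rho, density A0 rho -> 0 < ntr (F i *m rho *m omega).

Definition minimal_scheme m d (B A0 A1 : set 'M[C]_m) (omega : 'M[C]_m)
    (F : 'I_d -> 'M[C]_m) : Prop :=
  vee A1 B omega /\ forall i, vee A0 A1 (F i).

Definition tight_scheme m (A0 : set 'M[C]_m) (d : nat) : Prop := has_dim A0 d.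

End Operators.

Section BlockBasis.
Variables (C : numClosedFieldType) (n : nat).

(* The columns of V form an orthonormal basis of C^n (in particular n is the
   sum of the nn j * mm j) in which the algebra N and its commutant N' are
   (+)_j M_(nn j) (x) 1_(mm j) and (+)_j 1_(nn j) (x) M_(mm j). *)
Definition block_basis (k : nat) (nn mm : 'I_k -> nat)
    (V : 'M[C]_(n, \sum_(j < k) nn j * mm j)) (N : set 'M[C]_n) : Prop :=
  [/\ V *m V^t* = 1%:M,
      V^t* *m V = 1%:M,
      forall j, (0 < nn j)%N && (0 < mm j)%N,
      N = [set V *m (\mxdiag_(j < k) (X j *t (1%:M : 'M[C]_(mm j)))) *m V^t*
          | X in [set: forall j, 'M[C]_(nn j)]] &
      commutant N =
          [set V *m (\mxdiag_(j < k) ((1%:M : 'M[C]_(nn j)) *t X j)) *m V^t*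
          | X in [set: forall j, 'M[C]_(mm j)]]].

Variables (p : nat) (V : 'M[C]_(n, p)).

(* Transposition of operators in the basis formed by the columns of V. *)
Definition trV (x : 'M[C]_n) : 'M[C]_n := V *m (V^t* *m x *m V)^T *m V^t*.

Definition psi : 'cV[C]_(n * n) :=
  (sqrtC n%:R)^-1 *: \sum_(k < p) (col k V *t col k V : 'cV[C]_(n * n)).

Definition Lam (x : 'M[C]_n) : 'cV[C]_(n * n) := (x *t 1%:M) *m psi.

Definition jones_proj (N : set 'M[C]_n) (e : 'M[C]_(n * n)) : Prop :=
  ortho_proj (Lam @` N) e.

(* L^2(Q) is the subspace Lam @` Q of C^n (x) C^n; operators on it are the
   matrices in the corner of its projection eQ, which is the unit of the basic
   construction <Q, e_P>. *)
Definition markov_trace (P Q : set 'M[C]_n) : Prop :=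
  exists (eP eQ : 'M[C]_(n * n)) (tr1 : 'M[C]_(n * n) -> C),
    let Q1 := star_alg_gen ([set (x *t 1%:M) *m eQ | x in Q] `|` [set eP]) in
    [/\ jones_proj P eP,
        jones_proj Q eQ,
        [/\ forall (a : C) X Y, Q1 X -> Q1 Y ->
              tr1 (a *: X + Y) = a * tr1 X + tr1 Y,
            forall X Y, Q1 X -> Q1 Y -> tr1 (X *m Y) = tr1 (Y *m X) &
            forall X, Q1 X -> 0 <= tr1 (X^t* *m X)],
        forall x y, Q x -> Q y ->
          tr1 ((x *t 1%:M) *m eP *m (y *t 1%:M)) = ntr (x *m y) &
        forall x, Q x -> (tr1 eQ)^-1 * tr1 ((x *t 1%:M) *m eQ) = ntr x].

End BlockBasis.

Section Basis.
Variables (C : numClosedFieldType) (n : nat).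

Definition normaliser (N : set 'M[C]_n) : set 'M[C]_n :=
  [set u | u \is unitarymx /\ [set u^t* *m x *m u | x in N] = N].

(* Left Pimsner-Popa bases of M_n(C) over the subalgebra with Jones projection
   eN; x in M_n(C) acts on L^2(M_n(C)) = C^n (x) C^n as x (x) 1. *)
Definition pp_basis (eN : 'M[C]_(n * n)) (d : nat) (l : 'I_d -> 'M[C]_n) : Prop :=
  \sum_i ((l i)^t* *t 1%:M) *m eN *m (l i *t 1%:M) = 1%:M.

Definition orthonormal_basis (eN : 'M[C]_(n * n)) (EN : 'M[C]_n -> 'M[C]_n)
    (d : nat) (l : 'I_d -> 'M[C]_n) : Prop :=
  pp_basis eN l /\ forall i j, EN (l i *m (l j)^t*) = (i == j)%:R%:M.

Definition is_index (eN : 'M[C]_(n * n)) (c : C) : Prop :=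
  (exists (d : nat) (l : 'I_d -> 'M[C]_n), pp_basis eN l) /\
  forall (d : nat) (l : 'I_d -> 'M[C]_n), pp_basis eN l ->
    \sum_i (l i)^t* *m l i = c%:M.

End Basis.

Section Legs.
Variables (C : numClosedFieldType) (n : nat).

(* Embeddings into M_n(C) (x) M_n(C) (x) M_n(C), in the factors indicated. *)
Definition in1 (x : 'M[C]_n) : 'M[C]_(n * n * n) := x *t 1%:M *t 1%:M.
Definition in2 (x : 'M[C]_n) : 'M[C]_(n * n * n) := 1%:M *t x *t 1%:M.
Definition in3 (x : 'M[C]_n) : 'M[C]_(n * n * n) := 1%:M *t 1%:M *t x.
Definition in12 (X : 'M[C]_(n * n)) : 'M[C]_(n * n * n) := X *t 1%:M.
Definition in23 (X : 'M[C]_(n * n)) : 'M[C]_(n * n * n) :=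
  castmx (mulnA n n n, mulnA n n n) (1%:M *t X).

Lemma in23_tens (x y : 'M[C]_n) : in23 (x *t y) = 1%:M *t x *t y.
Proof.
apply/matrixP=> i j; rewrite castmxE {1}/tensmx !mxE mulrA -!val_eqE /=.
rewrite ?divnMA; congr (_ * x _ _ * y _ _); apply: val_inj => /=;
  by rewrite ?modn_divl ?modn_dvdm ?dvdn_mull.
Qed.

Definition tens3 (P Q S : set 'M[C]_n) : set 'M[C]_(n * n * n) :=
  star_alg_gen [set w | exists x y z, [/\ P x, Q y, S z & w = x *t y *t z]].

End Legs.

(* Main.v *)
Require Import Defs.
From mathcomp Require Import ring boolp.

Set Implicit Arguments.
Unset Strict Implicit.
Unset Printing Implicit Defensive.

Import Order.TTheory GRing.Theory Num.Theory.
Local Open Scope classical_set_scope.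
Local Open Scope ring_scope.
Local Open Scope sesquilinear_scope.

(** Write [Q] for the commutant of [N], [D] for its dimension, [tau] for the
    normalised trace and [x^t] for the transpose of [x].

    Pairing with elementary tensors turns a positive operator of two legs into a
    completely positive map: the measurement operators give maps [G_i] by
    [tau (F_i (b (x) z^t)) = tau (G_i z b)], and the density gives a map [W] by
    [tau (omega (z (x) y)) = tau (z (W y)^t)] ([psd_kraus]).  Minimality makes
    these maps preserve [Q].  With [t_i] the restriction of the channel [T_i] to
    [Q], the teleportation identity reads [sum_i G_i (W (t_i x)) = x], and the
    equation [sum_i F_i = 1] reads [sum_i G_i z = tau z] ([scheme_maps]).

    A family of completely positive maps that adds up to the identity is
    rigid.  The defect of the Kadison--Schwarz inequality is a sum of squares,
    so equality forces every Kraus operator to intertwine the identity with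
    [t_i] ([kraus_intertwine]).  Hence [G_i (W (t_i x)) = c_i x] for a central
    [c_i], which faithfulness makes invertible; so [t_i] is injective, and, the
    algebra being finite dimensional, it is a *-automorphism
    ([intertwine_star_auto]).  The Markov trace is the normalised trace of the
    regular representation, so that automorphisms preserve it, and then they are
    implemented by unitaries [u_i] of the ambient matrix algebra
    ([star_auto_ntr], [star_auto_spatial]).  The same argument, applied to [W]
    normalised by the square root [r] of [W 1], gives
    [W y = r v y v^* r] with [v] a normalising unitary ([resource_unitary]).

    It remains to see that [r] is central, and here the number of outcomes
    counts.  Put [s_i = v u_i] and [q = E (r^-2)], where [E] averages over an
    orthonormal basis of [Q].  Positivity of [tau (F_i F_j)] and
    [sum_i F_i = 1] say that the [D] central elements [D s_i c_i s_i^* q], which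
    have total trace [D], have total variance at most [0], so all are [1]
    ([weight_value]).  As [sum_i c_i = 1] and [tau (r^2) = 1], the element
    [r - q^-1 r^-1] has variance [0] too, and [r^2 = q^-1] is central
    ([resource1_value]).  What is left is [G_i z = D^-1 s_i^* z s_i], while
    [tau (F_i F_j) = 0] becomes orthogonality of the unitaries [u_i].

    Finally the Markov condition gives [eN = D^-1 sum_l g_l (x) (g_l^* )^t] for
    an orthonormal basis [g] of [Q] ([jones_commutant]), so [eN] is the operator
    that pairs with elementary tensors as [D^-1] times the identity map does.
    Operators in the span of [Q (x) Q] are determined by such pairings
    ([tens_span_eq]), which yields the stated formulas. *)

(** * Adjoints, tensor products and normalised traces *)

Section Adjoint.
Variable C : numClosedFieldType.

Lemma adjM m n p (A : 'M[C]_(m, n)) (B : 'M[C]_(n, p)) :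
  (A *m B)^t* = B^t* *m A^t*.
Proof. by rewrite trmx_mul map_mxM. Qed.

Lemma adjD m n (A B : 'M[C]_(m, n)) : (A + B)^t* = A^t* + B^t*.
Proof. by rewrite linearD map_mxD. Qed.

Lemma adjN m n (A : 'M[C]_(m, n)) : (- A)^t* = - A^t*.
Proof. by rewrite linearN map_mxN. Qed.

Lemma adjB m n (A B : 'M[C]_(m, n)) : (A - B)^t* = A^t* - B^t*.
Proof. by rewrite adjD adjN. Qed.

Lemma adjZ m n c (A : 'M[C]_(m, n)) : (c *: A)^t* = c^* *: A^t*.
Proof. by rewrite linearZ map_mxZ. Qed.

Lemma adj1 n : (1%:M : 'M[C]_n)^t* = 1%:M.
Proof. by rewrite trmx1 map_mx1. Qed.

Lemma adj_sum m n (I : Type) (r : seq I) (P : pred I) (F : I -> 'M[C]_(m, n)) :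
  (\sum_(i <- r | P i) F i)^t* = \sum_(i <- r | P i) (F i)^t*.
Proof. by rewrite linear_sum map_mx_sum. Qed.

Lemma adj_tens m n p q (A : 'M[C]_(m, n)) (B : 'M[C]_(p, q)) :
  (A *t B)^t* = A^t* *t B^t*.
Proof. by rewrite trmx_tens map_mxT. Qed.

Lemma tensDl m n p q (A A' : 'M[C]_(m, n)) (B : 'M[C]_(p, q)) :
  (A + A') *t B = A *t B + A' *t B.
Proof. by apply/matrixP=> i j; rewrite !mxE mulrDl. Qed.

Lemma tensDr m n p q (A : 'M[C]_(m, n)) (B B' : 'M[C]_(p, q)) :
  A *t (B + B') = A *t B + A *t B'.
Proof. by apply/matrixP=> i j; rewrite !mxE mulrDr. Qed.

Lemma tensZl m n p q c (A : 'M[C]_(m, n)) (B : 'M[C]_(p, q)) :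
  (c *: A) *t B = c *: (A *t B).
Proof. by apply/matrixP=> i j; rewrite !mxE mulrA. Qed.

Lemma tensZr m n p q c (A : 'M[C]_(m, n)) (B : 'M[C]_(p, q)) :
  A *t (c *: B) = c *: (A *t B).
Proof. by apply/matrixP=> i j; rewrite !mxE mulrCA. Qed.

Lemma tens_suml m n p q (I : Type) (r : seq I) (P : pred I)
    (F : I -> 'M[C]_(m, n)) (B : 'M[C]_(p, q)) :
  (\sum_(i <- r | P i) F i) *t B = \sum_(i <- r | P i) (F i *t B).
Proof.
elim/big_rec2: _ => [|i y z _ <-]; first by rewrite tens0mx.
by rewrite tensDl.
Qed.

Lemma tens_sumr m n p q (I : Type) (r : seq I) (P : pred I)
    (A : 'M[C]_(m, n)) (F : I -> 'M[C]_(p, q)) :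
  A *t (\sum_(i <- r | P i) F i) = \sum_(i <- r | P i) (A *t F i).
Proof.
elim/big_rec2: _ => [|i y z _ <-]; first by rewrite tensmx0.
by rewrite tensDr.
Qed.

Lemma tens11 m n : (1%:M : 'M[C]_m) *t (1%:M : 'M[C]_n) = 1%:M.
Proof.
apply/matrixP=> i j.
case: (mxtens_indexP i) => a b; case: (mxtens_indexP j) => c d.
rewrite tensmxE !mxE -natrM mulnb; congr (_%:R).
by rewrite (can_eq (@mxtens_indexK _ _)) xpair_eqE.
Qed.

Lemma sum_tens_index (U : nmodType) m n (F : 'I_(m * n) -> U) :
  \sum_i F i = \sum_(a < m) \sum_(b < n) F (mxtens_index (a, b)).
Proof.
rewrite pair_big /= (reindex (@mxtens_index m n)) /=; last first.
  by apply: onW_bij; exists (@mxtens_unindex m n);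
     [exact: mxtens_indexK | exact: mxtens_unindexK].
by apply: eq_bigr => -[a b] _.
Qed.

Lemma mxtrace_tens m n (A : 'M[C]_m) (B : 'M[C]_n) : \tr (A *t B) = \tr A * \tr B.
Proof.
rewrite /mxtrace sum_tens_index big_distrl /=; apply: eq_bigr => a _.
by rewrite big_distrr /=; apply: eq_bigr => b _; rewrite tensmxE.
Qed.

End Adjoint.

Section NormalisedTrace.
Variable C : numClosedFieldType.

Lemma ntrD m (X Y : 'M[C]_m) : ntr (X + Y) = ntr X + ntr Y.
Proof. by rewrite /ntr mxtraceD mulrDl. Qed.

Lemma ntrZ m c (X : 'M[C]_m) : ntr (c *: X) = c * ntr X.
Proof. by rewrite /ntr mxtraceZ mulrA. Qed.

Lemma ntrN m (X : 'M[C]_m) : ntr (- X) = - ntr X.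
Proof. by rewrite -scaleN1r ntrZ mulN1r. Qed.

Lemma ntrB m (X Y : 'M[C]_m) : ntr (X - Y) = ntr X - ntr Y.
Proof. by rewrite ntrD ntrN. Qed.

Lemma ntr0 m : ntr (0 : 'M[C]_m) = 0.
Proof. by rewrite /ntr mxtrace0 mul0r. Qed.

Lemma ntr_sum m (I : Type) (r : seq I) (P : pred I) (F : I -> 'M[C]_m) :
  ntr (\sum_(i <- r | P i) F i) = \sum_(i <- r | P i) ntr (F i).
Proof. by elim/big_rec2: _ => [|i y z _ <-]; rewrite ?ntr0 ?ntrD. Qed.

Lemma ntrC m (X Y : 'M[C]_m) : ntr (X *m Y) = ntr (Y *m X).
Proof. by rewrite /ntr mxtrace_mulC. Qed.

Lemma ntr1 m : (0 < m)%N -> ntr (1%:M : 'M[C]_m) = 1.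
Proof. by move=> m0; rewrite /ntr mxtrace1 divff // pnatr_eq0 -lt0n. Qed.

Lemma ntr_adj m (X : 'M[C]_m) : ntr (X^t*) = (ntr X)^*.
Proof.
rewrite /ntr fmorph_div rmorph_nat; congr (_ / _).
by rewrite /mxtrace rmorph_sum; apply: eq_bigr => i _; rewrite !mxE.
Qed.

Lemma ntr_tens m n (A : 'M[C]_m) (B : 'M[C]_n) : ntr (A *t B) = ntr A * ntr B.
Proof. by rewrite /ntr mxtrace_tens natrM invfM mulrACA. Qed.

End NormalisedTrace.

(** * Positive matrices *)

Section Positive.
Variable C : numClosedFieldType.

Lemma form_expand m (X : 'M[C]_m) (v w : 'cV[C]_m) :
  (v^t* *m X *m w) 0 0 = \sum_i \sum_j (v i 0)^* * X i j * w j 0.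
Proof.
rewrite mxE exchange_big /=; apply: eq_bigr => j _.
by rewrite mxE mulr_suml; apply: eq_bigr => i _; rewrite !mxE.
Qed.

Lemma adj_self_ge0 m n (A : 'M[C]_(m, n)) (v : 'cV[C]_n) :
  0 <= (v^t* *m (A^t* *m A) *m v) 0 0.
Proof.
rewrite mulmxA -adjM -mulmxA mxE; apply: sumr_ge0 => i _.
by rewrite !mxE mulrC mul_conjC_ge0.
Qed.

Lemma psd_adjM m n (A : 'M[C]_(m, n)) : psd (A^t* *m A).
Proof. by move=> v; exact: adj_self_ge0. Qed.

Lemma psd1 m : psd (1%:M : 'M[C]_m).
Proof. by rewrite -(mulmx1 1%:M) -{1}(adj1 C m); exact: psd_adjM. Qed.

Lemma psd_conj m n (A : 'M[C]_(m, n)) X : psd X -> psd (A^t* *m X *m A).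
Proof.
move=> hX v; have := hX (A *m v).
by rewrite adjM !mulmxA.
Qed.

Lemma psdD m (X Y : 'M[C]_m) : psd X -> psd Y -> psd (X + Y).
Proof.
by move=> hX hY v; rewrite mulmxDr mulmxDl mxE addr_ge0 // ?hX ?hY.
Qed.

Lemma psd_sum m (I : Type) (r : seq I) (P : pred I) (F : I -> 'M[C]_m) :
  (forall i, P i -> psd (F i)) -> psd (\sum_(i <- r | P i) F i).
Proof.
move=> h; elim/big_rec: _ => [v|i X Pi hX].
  by rewrite mulmx0 mul0mx mxE.
by apply: psdD => //; exact: h.
Qed.

Lemma form_delta m (X : 'M[C]_m) (i j : 'I_m) :
  ((delta_mx i 0 : 'cV_m)^t* *m X *m (delta_mx j 0 : 'cV_m)) 0 0 = X i j.
Proof.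
rewrite form_expand (bigD1 i) //= (bigD1 j) //= !mxE !eqxx /=.
rewrite rmorph1 mul1r mulr1 !big1 ?addr0 // => k hk.
  by rewrite big1 // => l _; rewrite !mxE (negPf hk) /= rmorph0 !mul0r.
by rewrite !mxE (negPf hk) /= mulr0.
Qed.

(** Polarisation: the form takes real values at [v + w] and at [v + 'i w], which
    determines its off-diagonal part up to conjugation. *)
Lemma psd_herm m (X : 'M[C]_m) : psd X -> X^t* = X.
Proof.
move=> hX; pose q (v w : 'cV[C]_m) := (v^t* *m X *m w) 0 0.
have qr v : (q v v)^* = q v v by apply/conj_Creal/ger0_real/hX.
have qD v w : q (v + w) (v + w) = q v v + q v w + (q w v + q w w).
  by rewrite /q adjD !(mulmxDl, mulmxDr) !mxE; ring.
have qZ v c w : q v (c *: w) = c * q v w by rewrite /q -scalemxAr mxE.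
have qZl v c w : q (c *: v) w = c^* * q v w by rewrite /q adjZ -!scalemxAl mxE.
have e1 v w : (q v w + q w v)^* = q v w + q w v.
  have /eqP := qr (v + w); rewrite qD !rmorphD /= !qr -!addrA => /eqP /addrI.
  by rewrite !addrA => /addIr; rewrite -rmorphD.
have e2 v w : (q v w)^* = q w v.
  have := e1 v w; have := e1 v ('i *: w); rewrite qZ qZl !rmorphD !rmorphM /=.
  rewrite !conjCi rmorphN /= conjCi opprK !mulNr => h1 h2.
  have h3 : 'i * ((q v w)^* - (q w v)^*) = 'i * (q w v - q v w).
    by apply: oppr_inj; rewrite !mulrBr !opprB addrC h1.
  have {}h3 := mulfI (neq0Ci C) h3.
  have h5 : (q v w)^* *+ 2 = q w v *+ 2.
    have -> : (q v w)^* *+ 2 = ((q v w)^* + (q w v)^*) + ((q v w)^* - (q w v)^*).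
      by rewrite mulr2n; ring.
    by rewrite h2 h3 mulr2n; ring.
  by apply/eqP; rewrite -(eqr_pMn2r (ltn0Sn 1)) h5.
apply/matrixP=> i j; rewrite !mxE -(form_delta X j i) -/(q _ _) e2 /q.
by rewrite form_delta.
Qed.

End Positive.

Section Spectral.
Variable C : numClosedFieldType.

Lemma ntr_adjM_ge0 m (X : 'M[C]_m) : 0 <= ntr (X^t* *m X).
Proof.
rewrite /ntr divr_ge0 ?ler0n // /mxtrace sumr_ge0 // => i _.
by rewrite mxE sumr_ge0 // => j _; rewrite !mxE mulrC mul_conjC_ge0.
Qed.

Lemma ntr_adjM_eq0 m (X : 'M[C]_m) : ntr (X^t* *m X) = 0 -> X = 0.
Proof.
case: m X => [|m] X; first by move=> _; apply/matrixP=> -[].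
move/eqP; rewrite /ntr mulf_eq0 invr_eq0 pnatr_eq0 orbF => /eqP h.
apply/matrixP=> i j; rewrite [RHS]mxE; move/eqP: h.
have nn (k l : 'I_m.+1) : 0 <= (X^t*) k l * X l k.
  by rewrite !mxE mulrC mul_conjC_ge0.
rewrite /mxtrace psumr_eq0 => [/allP/(_ j)|k _]; last first.
  by rewrite mxE; apply: sumr_ge0.
rewrite mem_index_enum => /(_ isT)/=; rewrite mxE psumr_eq0 => [/allP/(_ i)|k _ //].
by rewrite mem_index_enum => /(_ isT); rewrite !mxE mulf_eq0 conjC_eq0 orbb => /eqP.
Qed.

Lemma ntr_nondeg m (X : 'M[C]_m) : (forall b, ntr (X *m b) = 0) -> X = 0.
Proof. by move=> h; apply: ntr_adjM_eq0; rewrite ntrC h. Qed.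

Lemma herm_spectral m (X : 'M[C]_m) : X^t* = X ->
  exists (U : 'M[C]_m) (d : 'rV[C]_m),
    [/\ U \is unitarymx & X = U^t* *m diag_mx d *m U].
Proof.
move=> hX; have nX : X \is normalmx by apply/normalmxP; rewrite hX.
exists (spectralmx X), (spectral_diag X); split; first exact: spectral_unitarymx.
rewrite -invmx_unitary ?spectral_unitarymx //.
exact/orthomx_spectralP.
Qed.

Lemma unitary_adjl m (U : 'M[C]_m) : U \is unitarymx -> U^t* *m U = 1%:M.
Proof. by rewrite -trmxC_unitary => /unitarymxP; rewrite trmxCK. Qed.

Lemma unitary_adjr m (U : 'M[C]_m) : U \is unitarymx -> U *m U^t* = 1%:M.
Proof. by move/unitarymxP. Qed.

Lemma unitaryP m (U : 'M[C]_m) : U^t* *m U = 1%:M -> U \is unitarymx.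
Proof. by move=> h; rewrite -trmxC_unitary; apply/unitarymxP; rewrite trmxCK. Qed.

(** Commuting with a diagonal matrix only forces the entries between distinct
    eigenvalues to vanish, so a function of the eigenvalues has at least the same
    commutant. *)
Lemma diag_conj_comm m (U : 'M[C]_m) (d e : 'rV[C]_m) (Y : 'M[C]_m) :
  U \is unitarymx -> (forall i j, d 0 i = d 0 j -> e 0 i = e 0 j) ->
  (U^t* *m diag_mx d *m U) *m Y = Y *m (U^t* *m diag_mx d *m U) ->
  (U^t* *m diag_mx e *m U) *m Y = Y *m (U^t* *m diag_mx e *m U).
Proof.
move=> hU hde; pose Z := U *m Y *m U^t*.
have UU := unitary_adjl hU; have UU' := unitary_adjr hU.
have key f : ((U^t* *m diag_mx f *m U) *m Y = Y *m (U^t* *m diag_mx f *m U)) <->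
    diag_mx f *m Z = Z *m diag_mx f.
  split=> h.
    have := congr1 (fun M => U *m M *m U^t*) h.
    by rewrite /Z !mulmxA UU' mul1mx -!mulmxA UU' mulmx1.
  have := congr1 (fun M => U^t* *m M *m U) h.
  by rewrite /Z !mulmxA UU mul1mx -!mulmxA UU mulmx1.
move/key => h; apply/key; apply/matrixP=> i j.
have := congr1 (fun M : 'M[C]_m => M i j) h.
rewrite !mul_diag_mx !mul_mx_diag !mxE mulrC => /eqP.
rewrite -subr_eq0 -mulrBr mulf_eq0 => /orP[/eqP -> |]; first by rewrite mulr0 mul0r.
by rewrite subr_eq0 => /eqP/hde ->; rewrite mulrC.
Qed.

Lemma psd_diag_ge0 m (U : 'M[C]_m) (d : 'rV[C]_m) i :
  U \is unitarymx -> psd (U^t* *m diag_mx d *m U) -> 0 <= d 0 i.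
Proof.
move=> hU /psd_conj-/(_ _ (U^t*)); rewrite trmxCK !mulmxA unitary_adjr // mul1mx.
rewrite -mulmxA unitary_adjr // mulmx1 => /(_ (delta_mx i 0)).
by rewrite form_delta mxE eqxx mulr1n.
Qed.

(** The last clause is what keeps square roots inside a given commutant. *)
Lemma psd_sqrt m (X : 'M[C]_m) : psd X ->
  exists S, [/\ psd S, S *m S = X &
    forall Y, X *m Y = Y *m X -> S *m Y = Y *m S].
Proof.
move=> hX; have [U [d [hU eX]]] := herm_spectral (psd_herm hX).
have d0 i : 0 <= d 0 i by apply: (@psd_diag_ge0 _ U) => //; rewrite -eX.
pose e := map_mx sqrtC d; pose f := map_mx sqrtC e.
have me (a : 'rV[C]_m) : (forall i, 0 <= a 0 i) ->
    (diag_mx (map_mx sqrtC a))^t* *m diag_mx (map_mx sqrtC a) = diag_mx a.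
  move=> ha; apply/matrixP=> i j; rewrite mul_mx_diag !mxE.
  rewrite eq_sym; case: eqP => [->|_]; last by rewrite !mulr0n rmorph0 mul0r.
  by rewrite !mulr1n conj_Creal ?ger0_real ?sqrtC_ge0 // -expr2 sqrtCK.
have e0 i : 0 <= e 0 i by rewrite mxE sqrtC_ge0.
have he : (diag_mx e)^t* = diag_mx e.
  apply/matrixP=> i j; rewrite !mxE rmorphMn /= eq_sym.
  case: eqP => [->|]; last by rewrite !mulr0n.
  by rewrite conj_Creal // ger0_real // sqrtC_ge0.
exists (U^t* *m diag_mx e *m U); split.
- have -> : U^t* *m diag_mx e *m U = (diag_mx f *m U)^t* *m (diag_mx f *m U).
    by rewrite adjM -[RHS]mulmxA (mulmxA _ (diag_mx f)) (me e e0) mulmxA.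
  exact: psd_adjM.
- rewrite eX !mulmxA -(mulmxA _ U) unitary_adjr // mulmx1 -(mulmxA (U^t*)).
  by rewrite -{1}he (me d d0).
- move=> Y; rewrite eX; apply: diag_conj_comm => // i j dij.
  by rewrite !mxE dij.
Qed.

Lemma psd_ntr_ge0 m (X : 'M[C]_m) : psd X -> 0 <= ntr X.
Proof.
move=> hX; rewrite /ntr divr_ge0 ?ler0n // sumr_ge0 // => i _.
by rewrite -form_delta.
Qed.

Lemma psd_sum_rank1 m (X : 'M[C]_m) : psd X ->
  exists x : 'I_m -> 'cV[C]_m, X = \sum_r x r *m (x r)^t*.
Proof.
move=> /psd_sqrt[S [hS <- _]]; exists (fun r => col r S).
apply/matrixP=> i j; rewrite summxE mxE; apply: eq_bigr => k _.
have -> : S k j = (S j k)^* by rewrite -[in LHS](psd_herm hS) !mxE.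
by rewrite mxE big_ord1 !mxE.
Qed.

(** Inequalities between positive matrices are turned into equalities by this. *)
Lemma psd_antisym m (X : 'M[C]_m) : psd X -> psd (- X) -> X = 0.
Proof.
move=> h h'; have [S [hS eS _]] := psd_sqrt h.
rewrite -eS -{1}(psd_herm hS); suff -> : S = 0 by rewrite mulmx0.
apply: ntr_adjM_eq0; rewrite (psd_herm hS) eS; apply/eqP.
by rewrite eq_le psd_ntr_ge0 // -oppr_ge0 -ntrN psd_ntr_ge0.
Qed.

End Spectral.

(** * Star-algebras, commutants and Kraus maps *)

Section StarAlg.
Variables (C : numClosedFieldType) (n : nat) (Q : set 'M[C]_n).

Section Closure.
Hypothesis hQ : unital_star_alg Q.

Lemma usa0 : Q 0. Proof. by case: hQ => -[]. Qed.
Lemma usa1 : Q 1%:M. Proof. by case: hQ. Qed.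
Lemma usaD x y : Q x -> Q y -> Q (x + y). Proof. by case: hQ => -[_ h]; auto. Qed.
Lemma usaZ c x : Q x -> Q (c *: x). Proof. by case: hQ => -[_ _ h]; auto. Qed.
Lemma usaM x y : Q x -> Q y -> Q (x *m y).
Proof. by case: hQ => -[_ _ _ h]; auto. Qed.
Lemma usa_adj x : Q x -> Q (x^t*). Proof. by case: hQ => -[_ _ _ _ h]; auto. Qed.
Lemma usaN x : Q x -> Q (- x). Proof. by rewrite -scaleN1r; exact: usaZ. Qed.
Lemma usaB x y : Q x -> Q y -> Q (x - y).
Proof. by move=> hx /usaN; exact: usaD. Qed.
Lemma usa_sum (I : Type) (r : seq I) (P : pred I) (F : I -> 'M[C]_n) :
  (forall i, P i -> Q (F i)) -> Q (\sum_(i <- r | P i) F i).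
Proof. by move=> h; elim/big_rec: _ => [|i x Pi]; [exact: usa0 | apply/usaD/h]. Qed.

Lemma linear_on0 t : linear_on Q t -> t 0 = 0.
Proof. by move/(_ (-1) 0 0 usa0 usa0); rewrite scaler0 addr0 scaleN1r addNr. Qed.

Lemma linear_on_sum t (I : finType) (a : I -> C) (x : I -> 'M[C]_n) :
  linear_on Q t -> (forall i, Q (x i)) ->
  t (\sum_i a i *: x i) = \sum_i a i *: t (x i).
Proof.
move=> ht hx.
suff [_ ->] : Q (\sum_i a i *: x i) /\ t (\sum_i a i *: x i) = \sum_i a i *: t (x i) by [].
apply: (big_rec2 (fun y z => Q y /\ t y = z)) => [|l z y _ [hy <-]].
  by split; [exact: usa0 | exact: linear_on0].
by split; [apply: usaD => //; exact: usaZ | rewrite ht].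
Qed.
End Closure.

Lemma commutantM (A : set 'M[C]_n) x y : commutant A x -> commutant A y -> commutant A (x *m y).
Proof. by move=> hx hy a ha; rewrite mulmxA hx // -mulmxA hy // mulmxA. Qed.

Lemma commutant_usa (A : set 'M[C]_n) : (forall x, A x -> A (x^t*)) ->
  unital_star_alg (commutant A).
Proof.
move=> hA; split; last by move=> x _; rewrite mulmx1 mul1mx.
split=> [x _|x y hx hy a ha|c x hx a ha|x y|x hx a ha].
- by rewrite mulmx0 mul0mx.
- by rewrite mulmxDr mulmxDl hx // hy.
- by rewrite -scalemxAr -scalemxAl hx.
- exact: commutantM.
- by apply: (can_inj (@trmxCK _ _ _)); rewrite !adjM trmxCK hx //; apply: hA.
Qed.

Lemma invmx_comm (x y : 'M[C]_n) : x \in unitmx -> x *m y = y *m x ->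
  invmx x *m y = y *m invmx x.
Proof.
move=> ux h; rewrite -[LHS]mulmx1 -(mulmxV ux) !mulmxA -(mulmxA _ y) -h.
by rewrite (mulmxA _ x) mulVmx // mul1mx.
Qed.

Lemma commutant_invmx (A : set 'M[C]_n) x : x \in unitmx -> commutant A x -> commutant A (invmx x).
Proof. by move=> ux hx a ha; rewrite invmx_comm // hx. Qed.

Lemma unitmx_inj (x : 'M[C]_n) :
  (forall y : 'M[C]_n, x *m y = 0 -> y = 0) -> x \in unitmx.
Proof.
move=> h; rewrite -unitmx_tr -row_free_unit; apply/inj_row_free => v hv.
have hx : x *m v^T = 0 by apply: trmx_inj; rewrite trmx_mul trmxK hv trmx0.
apply/rowP => i; rewrite mxE.
have hy : x *m \matrix_(k, l) v 0 k = 0 :> 'M_n.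
  apply/matrixP=> k l; transitivity ((x *m v^T) k 0); last by rewrite hx !mxE.
  by rewrite !mxE; apply: eq_bigr => m _; rewrite !mxE.
by move/matrixP: (h _ hy) => /(_ i i); rewrite !mxE.
Qed.

Lemma adj_invmx (x : 'M[C]_n) : (invmx x)^t* = invmx (x^t*).
Proof. by rewrite trmx_inv map_invmx. Qed.

(** Kraus form of a completely positive map. *)
Definition kraus (J : finType) (K : J -> 'M[C]_n) (x : 'M[C]_n) : 'M[C]_n :=
  \sum_r (K r)^t* *m x *m K r.

Lemma kraus_linear (J : finType) (K : J -> 'M[C]_n) a x y :
  kraus K (a *: x + y) = a *: kraus K x + kraus K y.
Proof.
rewrite /kraus scaler_sumr -big_split /=; apply: eq_bigr => r _.
by rewrite mulmxDr mulmxDl -scalemxAr -scalemxAl.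
Qed.

Lemma kraus_sum (J : finType) (K : J -> 'M[C]_n) (I : finType) (a : I -> C) x :
  kraus K (\sum_i a i *: x i) = \sum_i a i *: kraus K (x i).
Proof.
apply: (big_rec2 (fun y z => kraus K y = z)) => [|i z y _ <-].
  by rewrite /kraus big1 // => r _; rewrite mulmx0 mul0mx.
by rewrite kraus_linear.
Qed.

Lemma krausB (J : finType) (K : J -> 'M[C]_n) x y :
  kraus K (x - y) = kraus K x - kraus K y.
Proof. by rewrite addrC -scaleN1r kraus_linear scaleN1r addrC. Qed.

Lemma kraus_adj (J : finType) (K : J -> 'M[C]_n) x :
  kraus K (x^t*) = (kraus K x)^t*.
Proof.
by rewrite /kraus adj_sum; apply: eq_bigr => r _; rewrite !adjM trmxCK mulmxA.
Qed.

Lemma kraus1 (J : finType) (K : J -> 'M[C]_n) :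
  kraus K 1%:M = \sum_r (K r)^t* *m K r.
Proof. by apply: eq_bigr => r _; rewrite mulmx1. Qed.

Lemma kraus_psd (J : finType) (K : J -> 'M[C]_n) x : psd x -> psd (kraus K x).
Proof. by move=> hx; apply: psd_sum => r _; exact: psd_conj. Qed.

Lemma sum_adjM_eq0 (J : finType) (K : J -> 'M[C]_n) r :
  \sum_r (K r)^t* *m K r = 0 -> K r = 0.
Proof.
move=> h; apply: ntr_adjM_eq0; apply/eqP.
have /eqP : ntr (\sum_r (K r)^t* *m K r) = 0 by rewrite h ntr0.
rewrite ntr_sum psumr_eq0 => [/allP/(_ r)|i _]; last exact: ntr_adjM_ge0.
by rewrite mem_index_enum; exact.
Qed.

Lemma sum_adjM_le0 (J : finType) (K : J -> 'M[C]_n) r :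
  psd (- \sum_r (K r)^t* *m K r) -> K r = 0.
Proof.
move=> h; apply: sum_adjM_eq0; apply: psd_antisym => //.
by apply: psd_sum => i _; exact: psd_adjM.
Qed.

(** Of the complete positivity of a channel only the Kadison--Schwarz inequality
    is retained. *)
Definition ks_map (t : 'M[C]_n -> 'M[C]_n) : Prop :=
  [/\ linear_on Q t, forall x, Q x -> Q (t x), t 1%:M = 1%:M,
      forall x, Q x -> t (x^t*) = (t x)^t* &
      forall x, Q x -> psd (t (x^t* *m x) - (t x)^t* *m t x)].

Definition star_auto (t : 'M[C]_n -> 'M[C]_n) : Prop :=
  [/\ linear_on Q t, forall x, Q x -> Q (t x),
      forall x y, Q x -> Q y -> t (x *m y) = t x *m t y,
      forall x, Q x -> t (x^t*) = (t x)^t* &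
      forall x, Q x -> t x = 0 -> x = 0].

(** The defect of the Kadison--Schwarz inequality is a sum of squares. *)
Lemma kraus_ks (J : finType) (K : J -> 'M[C]_n) x : kraus K 1%:M = 1%:M ->
  psd (kraus K (x^t* *m x) - (kraus K x)^t* *m kraus K x).
Proof.
move=> h1; set y := kraus K x.
have -> : kraus K (x^t* *m x) - y^t* *m y =
    \sum_r (x *m K r - K r *m y)^t* *m (x *m K r - K r *m y).
  under eq_bigr do rewrite adjB !adjM mulmxBl !mulmxBr opprB !mulmxA.
  rewrite !big_split /= !sumrN.
  have -> : \sum_r (K r)^t* *m x^t* *m x *m K r = kraus K (x^t* *m x).
    by apply: eq_bigr => r _; rewrite !mulmxA.
  have -> : \sum_r (K r)^t* *m x^t* *m K r *m y = y^t* *m y.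
    by rewrite -mulmx_suml -/(kraus K (x^t*)) kraus_adj.
  have -> : \sum_r y^t* *m (K r)^t* *m K r *m y = y^t* *m y.
    rewrite -mulmx_suml; under eq_bigr do rewrite -mulmxA.
    by rewrite -mulmx_sumr -kraus1 h1 mulmx1.
  have -> : \sum_r y^t* *m (K r)^t* *m x *m K r = y^t* *m y.
    under eq_bigr do rewrite -!mulmxA.
    rewrite -mulmx_sumr; congr (_ *m _).
    by apply: eq_bigr => r _; rewrite mulmxA.
  by rewrite subrr addr0.
by apply: psd_sum => r _; exact: psd_adjM.
Qed.

(** The squares of all the defects [t_i x K - K x] add up, by the assumption on
    the total map, to a difference that the Kadison--Schwarz inequality for the
    [t_i] makes nonpositive.  A central factor [c] in place of the identity lets
    the lemma be applied to one member of a family as well. *)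
Lemma kraus_intertwine (I J : finType) (t : I -> 'M[C]_n -> 'M[C]_n)
    (K : I -> J -> 'M[C]_n) (c : 'M[C]_n) :
  unital_star_alg Q -> (forall i, ks_map (t i)) -> commutant Q c ->
  (forall x, Q x -> \sum_i kraus (K i) (t i x) = c *m x) ->
  forall i r x, Q x -> t i x *m K i r = K i r *m x.
Proof.
move=> hQ ht hc hK i r x hx; apply/eqP; rewrite -subr_eq0; apply/eqP.
pose L (ir : I * J) := t ir.1 x *m K ir.1 ir.2 - K ir.1 ir.2 *m x.
apply: (@sum_adjM_le0 _ L (i, r)) => {i r}.
have tx i : t i (x^t*) = (t i x)^t* by case: (ht i) => _ _ _ /(_ x hx).
have h1 : \sum_i kraus (K i) 1%:M = c.
  have := hK _ (usa1 hQ); rewrite mulmx1 => <-; apply: eq_bigr => i _.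
  by case: (ht i) => _ _ -> _ _.
have -> : \sum_ir (L ir)^t* *m L ir =
    \sum_i kraus (K i) ((t i x)^t* *m t i x) - c *m (x^t* *m x).
  rewrite -(pair_bigA _ (fun i r => (L (i, r))^t* *m L (i, r))) /=.
  transitivity (\sum_i (kraus (K i) ((t i x)^t* *m t i x)
      - kraus (K i) (t i (x^t*)) *m x - x^t* *m kraus (K i) (t i x)
      + x^t* *m kraus (K i) 1%:M *m x)).
    apply: eq_bigr => i _; rewrite /L /= tx.
    under eq_bigr do rewrite adjB !adjM mulmxBl !mulmxBr opprB !mulmxA.
    rewrite !big_split /= !sumrN /kraus mulmx_suml mulmx_sumr !mulmx_sumr !mulmx_suml.
    rewrite -!addrA; congr (_ + _).
      by apply: eq_bigr => r _; rewrite !mulmxA.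
    congr (_ + _); rewrite addrC; congr (- _ + _).
      by apply: eq_bigr => r _; rewrite !mulmxA.
    by apply: eq_bigr => r _; rewrite mulmx1 !mulmxA.
  rewrite !big_split /= !sumrN -!mulmx_suml -!mulmx_sumr (hK _ (usa_adj hQ hx)) (hK _ hx).
  by rewrite h1 -!mulmxA subrK.
have -> : - (\sum_i kraus (K i) ((t i x)^t* *m t i x) - c *m (x^t* *m x)) =
   \sum_i kraus (K i) (t i (x^t* *m x) - (t i x)^t* *m t i x).
  rewrite opprB -hK; last by apply: usaM => //; exact: usa_adj.
  by rewrite -sumrB; apply: eq_bigr => i _; rewrite krausB.
apply: psd_sum => i _; apply: kraus_psd.
by case: (ht i) => _ _ _ _; apply.
Qed.

End StarAlg.

(** * Algebras carrying the Markov trace *)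

Section MarkovBasis.
Variables (C : numClosedFieldType) (n D : nat).
Variables (Q : set 'M[C]_n) (g : 'I_D -> 'M[C]_n).

(** Orthonormality refers to the normalised trace of the ambient matrices; the
    last field makes that trace the Markov trace of the scalars in [Q], whose
    index is the dimension [D] of [Q]. *)
Record markov_basis : Prop := {
  mb_alg : unital_star_alg Q;
  mb_in : forall l, Q (g l);
  mb_orth : forall l m, ntr ((g l)^t* *m g m) = (l == m)%:R;
  mb_span : forall x, Q x -> x = \sum_l ntr ((g l)^t* *m x) *: g l;
  mb_markov : \sum_l (g l)^t* *m g l = D%:R%:M }.

Hypothesis n0 : (0 < n)%N.
Hypothesis hg : markov_basis.

Let hQ := mb_alg hg.

Lemma mb_size_gt0 : (0 < D)%N.
Proof.
case: (posnP D) => // D0; have := mb_span hg (usa1 hQ).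
rewrite big1 => [/(congr1 (@ntr _ _))|l _]; last first.
  by exfalso; have := ltn_ord l; move: (nat_of_ord l) => i; rewrite D0.
by rewrite ntr1 // ntr0 => /eqP; rewrite oner_eq0.
Qed.

Lemma mb_size_neq0 : D%:R != 0 :> C.
Proof. by rewrite pnatr_eq0 -lt0n mb_size_gt0. Qed.

Lemma mb_span_adj x : Q x -> x = \sum_l ntr (g l *m x) *: (g l)^t*.
Proof.
move=> hx; rewrite -[LHS]trmxCK {1}(mb_span hg (usa_adj hQ hx)) adj_sum.
by apply: eq_bigr => l _; rewrite adjZ -adjM ntr_adj conjCK ntrC.
Qed.

Lemma mb_markov_adj : \sum_l g l *m (g l)^t* = D%:R%:M.
Proof.
rewrite -(mb_markov hg).
transitivity (\sum_l \sum_m ntr (g m *m g l) *: ((g m)^t* *m (g l)^t*)).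
  apply: eq_bigr => l _; rewrite {1}(mb_span_adj (mb_in hg l)) mulmx_suml.
  by apply: eq_bigr => m _; rewrite -scalemxAl.
rewrite exchange_big /=; apply: eq_bigr => m _.
rewrite [X in _ = _ *m X](mb_span_adj (mb_in hg m)) mulmx_sumr; apply: eq_bigr => l _.
by rewrite -scalemxAr ntrC.
Qed.

(** Averaging over the basis is the trace-preserving conditional expectation
    onto the commutant of the algebra. *)
Definition avg (x : 'M[C]_n) : 'M[C]_n :=
  D%:R^-1 *: \sum_l g l *m x *m (g l)^t*.

(** The coefficients of [y g_l] on the basis [g] are those of [g_m^* y] on the
    adjoint basis, so [y] passes through the sum. *)
Lemma avg_comm x : commutant Q (avg x).
Proof.
move=> y hy; rewrite /avg -scalemxAr -scalemxAl; congr (_ *: _).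
rewrite mulmx_sumr mulmx_suml.
transitivity (\sum_l \sum_m ntr ((g m)^t* *m (y *m g l)) *: (g m *m x *m (g l)^t*)).
  apply: eq_bigr => l _.
  have hyl : Q (y *m g l) by apply/(usaM hQ)/(mb_in hg).
  rewrite !mulmxA {1}(mb_span hg hyl) !mulmx_suml.
  by apply: eq_bigr => m _; rewrite -!scalemxAl.
rewrite exchange_big /=; apply: eq_bigr => m _.
have hym : Q ((g m)^t* *m y) by apply/(usaM hQ) => //; apply/(usa_adj hQ)/(mb_in hg).
rewrite -[RHS]mulmxA (mb_span_adj hym) mulmx_sumr; apply: eq_bigr => l _.
by rewrite -scalemxAr [in RHS]ntrC !mulmxA.
Qed.

Lemma avg_sym x : avg x = D%:R^-1 *: \sum_l (g l)^t* *m x *m g l.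
Proof.
congr (_ *: _).
transitivity (\sum_l \sum_m ntr (g m *m g l) *: ((g m)^t* *m x *m (g l)^t*)).
  apply: eq_bigr => l _; rewrite {1}(mb_span_adj (mb_in hg l)) !mulmx_suml.
  by apply: eq_bigr => m _; rewrite -!scalemxAl.
rewrite exchange_big /=; apply: eq_bigr => m _.
rewrite [X in _ = _ *m X](mb_span_adj (mb_in hg m)) mulmx_sumr; apply: eq_bigr => l _.
by rewrite -scalemxAr ntrC.
Qed.

Lemma avg_commutant y : commutant Q y -> avg y = y.
Proof.
move=> hy; rewrite /avg; under eq_bigr => l _ do rewrite (hy _ (mb_in hg l)) -mulmxA.
rewrite -mulmx_sumr mb_markov_adj mul_mx_scalar scalerA mulVf ?scale1r //.
exact: mb_size_neq0.
Qed.

Lemma ntr_avg x y : commutant Q y -> ntr (avg x *m y) = ntr (x *m y).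
Proof.
move=> hy; rewrite -{2}(avg_commutant hy) avg_sym /avg.
rewrite -scalemxAl -scalemxAr !ntrZ; congr (_ * _).
rewrite mulmx_suml mulmx_sumr !ntr_sum; apply: eq_bigr => l _.
by rewrite -!mulmxA ntrC !mulmxA.
Qed.

Lemma avg_adj x : avg (x^t*) = (avg x)^t*.
Proof.
rewrite /avg adjZ adj_sum fmorphV rmorph_nat; congr (_ *: _).
by apply: eq_bigr => l _; rewrite !adjM trmxCK mulmxA.
Qed.

Lemma avg_in x : Q x -> Q (avg x).
Proof.
move=> hx; apply/(usaZ hQ)/(usa_sum hQ) => l _; have hl := mb_in hg l.
by apply: (usaM hQ); [exact: (usaM hQ) | exact: (usa_adj hQ)].
Qed.

Lemma ntr_avg_eq0 x : ntr (avg x *m (avg x)^t*) = 0 ->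
  forall y, commutant Q y -> ntr (x *m y) = 0.
Proof.
rewrite ntrC => /ntr_adjM_eq0 h y hy.
by rewrite -ntr_avg // h mul0mx ntr0.
Qed.

Section Coordinates.

Definition coord_mx (x : 'M[C]_n) : 'rV[C]_D := \row_l ntr ((g l)^t* *m x).
Definition of_coord (a : 'rV[C]_D) : 'M[C]_n := \sum_l a 0 l *: g l.

Lemma of_coordK a : coord_mx (of_coord a) = a.
Proof.
apply/rowP => l; rewrite mxE /of_coord mulmx_sumr ntr_sum (bigD1 l) //= big1.
  by rewrite -scalemxAr ntrZ (mb_orth hg) eqxx mulr1 addr0.
by move=> m ml; rewrite -scalemxAr ntrZ (mb_orth hg) eq_sym (negPf ml) mulr0.
Qed.

Lemma coord_mxK x : Q x -> of_coord (coord_mx x) = x.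
Proof.
by move=> hx; rewrite [RHS](mb_span hg hx); apply: eq_bigr => l _; rewrite mxE.
Qed.

Lemma of_coord_in a : Q (of_coord a).
Proof. by apply: (usa_sum hQ) => l _; apply/(usaZ hQ)/(mb_in hg). Qed.

Definition endo_mx (t : 'M[C]_n -> 'M[C]_n) : 'M[C]_D :=
  \matrix_(l, k) ntr ((g k)^t* *m t (g l)).

Lemma endo_mxE t a : linear_on Q t -> coord_mx (t (of_coord a)) = a *m endo_mx t.
Proof.
move=> ht; apply/rowP => k; rewrite !mxE (linear_on_sum hQ _ ht (mb_in hg)) mulmx_sumr ntr_sum.
by apply: eq_bigr => l _; rewrite -scalemxAr ntrZ !mxE.
Qed.

Lemma endo_mx_unit t : linear_on Q t -> (forall x, Q x -> Q (t x)) ->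
  (forall x, Q x -> t x = 0 -> x = 0) -> endo_mx t \in unitmx.
Proof.
move=> tl tQ ti; rewrite -row_free_unit; apply/inj_row_free => a.
rewrite -endo_mxE // => h; rewrite -[a]of_coordK.
rewrite (ti _ (of_coord_in a)); last first.
  by rewrite -[LHS]coord_mxK ?h; [rewrite /of_coord big1 // => l _; rewrite mxE scale0r | apply/tQ/of_coord_in].
by apply/rowP => l; rewrite !mxE mulmx0 ntr0.
Qed.

Lemma endo_surj t : linear_on Q t -> (forall x, Q x -> Q (t x)) ->
  (forall x, Q x -> t x = 0 -> x = 0) ->
  forall y, Q y -> exists2 x, Q x & t x = y.
Proof.
move=> tl tQ ti y hy; have U := endo_mx_unit tl tQ ti.
exists (of_coord (coord_mx y *m invmx (endo_mx t))); first exact: of_coord_in.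
rewrite -[LHS]coord_mxK; last exact/tQ/of_coord_in.
by rewrite endo_mxE // mulmxKV // coord_mxK.
Qed.

(** The Markov trace is the normalised trace of the left regular
    representation, so every automorphism preserves it. *)
Lemma star_auto_ntr t x : star_auto Q t -> Q x -> ntr (t x) = ntr x.
Proof.
move=> [tl tQ tM _ ti] hx.
have trL y : \tr (endo_mx (mulmx y)) = D%:R * ntr y.
  rewrite /mxtrace; under eq_bigr => l _ do rewrite mxE ntrC -mulmxA.
  by rewrite -ntr_sum -mulmx_sumr mb_markov_adj mul_mx_scalar ntrZ.
have Ll y : linear_on Q (mulmx y) by move=> a u v _ _; rewrite mulmxDr -scalemxAr.
have e : endo_mx (mulmx x) *m endo_mx t = endo_mx t *m endo_mx (mulmx (t x)).
  apply/row_matrixP => l; rewrite !rowE !mulmxA -!endo_mxE //.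
  rewrite !coord_mxK ?tM //; try by apply/tQ/of_coord_in.
  - exact: of_coord_in.
  - by apply: (usaM hQ) => //; exact: of_coord_in.
have U := endo_mx_unit tl tQ ti.
apply: (mulfI mb_size_neq0); rewrite -!trL -[endo_mx (mulmx (t x))](mulKmx U) -e.
by rewrite mxtrace_mulC mulmxK.
Qed.

End Coordinates.

(** If the intertwiners have full joint support then [t] is injective, hence onto
    the finite-dimensional [Q].  The defect of multiplicativity is then [t z] for
    some [z]; it kills every intertwiner on the left, so [z] is annihilated by
    all of them and vanishes. *)
Lemma intertwine_star_auto (J : finType) t (K : J -> 'M[C]_n) : ks_map Q t ->
  (forall r x, Q x -> t x *m K r = K r *m x) ->
  kraus K 1%:M \in unitmx -> star_auto Q t.
Proof.
move=> [tl tQ _ ta _] hK U.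
have ti x : Q x -> t x = 0 -> x = 0.
  move=> hx h; rewrite -[x](mulKmx U) (_ : _ *m x = 0) ?mulmx0 //.
  rewrite kraus1 mulmx_suml big1 // => r _.
  by rewrite -mulmxA -hK // h mul0mx mulmx0.
split=> // x y hx hy; apply/eqP; rewrite -subr_eq0; apply/eqP.
have hz : Q (t (x *m y) - t x *m t y).
  by apply: (usaB hQ); [exact/tQ/(usaM hQ) | apply: (usaM hQ); exact: tQ].
have [z Qz ez] := endo_surj tl tQ ti hz.
suff z0 : z = 0 by rewrite -ez z0 (linear_on0 hQ tl).
rewrite -[z](mulKmx U) (_ : _ *m z = 0) ?mulmx0 //.
rewrite kraus1 mulmx_suml big1 // => r _.
rewrite -mulmxA -hK // ez mulmxBl -mulmxA !hK ?mulmxA ?hK //; last exact: (usaM hQ).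
by rewrite -!mulmxA subrr mulmx0.
Qed.

End MarkovBasis.

(** * Intertwiners and normalising unitaries *)

Section Intertwiners.
Variables (C : numClosedFieldType) (n : nat) (Q : set 'M[C]_n).
Hypothesis hQ : unital_star_alg Q.

Lemma kraus_comp (I J : finType) (A : I -> 'M[C]_n) (B : J -> 'M[C]_n) x :
  kraus A (kraus B x) = kraus (fun rs : I * J => B rs.2 *m A rs.1) x.
Proof.
rewrite /kraus -(pair_bigA _ (fun r s => (B s *m A r)^t* *m x *m (B s *m A r))) /=.
apply: eq_bigr => r _; rewrite mulmx_sumr mulmx_suml.
by apply: eq_bigr => s _; rewrite adjM !mulmxA.
Qed.

Lemma intertwine_kraus (J : finType) t (K : J -> 'M[C]_n) x : Q x ->
  (forall r x, Q x -> t x *m K r = K r *m x) ->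
  kraus K (t x) = kraus K 1%:M *m x.
Proof.
move=> hx hK; rewrite kraus1 /kraus mulmx_suml; apply: eq_bigr => r _.
by rewrite -mulmxA hK // mulmxA.
Qed.

(** [K^* K] commutes with the algebra whenever [K] and, by taking adjoints,
    [K^*] intertwine. *)
Lemma intertwine_commutant (J : finType) t (K : J -> 'M[C]_n) :
  (forall x, Q x -> t (x^t*) = (t x)^t*) ->
  (forall r x, Q x -> t x *m K r = K r *m x) ->
  commutant Q (kraus K 1%:M).
Proof.
move=> ta hK x hx; rewrite -(intertwine_kraus hx hK) kraus1 mulmx_sumr.
apply: eq_bigr => r _; rewrite mulmxA; congr (_ *m _).
by rewrite -[LHS]trmxCK adjM trmxCK -hK ?adjM -?ta ?trmxCK //; exact: (usa_adj hQ).
Qed.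

Definition normalises (u : 'M[C]_n) : Prop :=
  [/\ u \is unitarymx, forall x, Q x -> Q (u *m x *m u^t*) &
      forall x, Q x -> Q (u^t* *m x *m u)].

Lemma normalises_adj u : normalises u -> normalises (u^t*).
Proof. by move=> [h1 h2 h3]; split; rewrite ?trmxC_unitary ?trmxCK. Qed.

Lemma normalises_mul u v : normalises u -> normalises v -> normalises (u *m v).
Proof.
move=> [h1 h2 h3] [k1 k2 k3]; split.
- by rewrite mul_unitarymx.
- move=> x hx; have -> : u *m v *m x *m (u *m v)^t* = u *m (v *m x *m v^t*) *m u^t*.
    by rewrite adjM !mulmxA.
  by auto.
- move=> x hx; have -> : (u *m v)^t* *m x *m (u *m v) = v^t* *m (u^t* *m x *m u) *m v.
    by rewrite adjM !mulmxA.
  by auto.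
Qed.

Lemma unitary_conjK (u x : 'M[C]_n) : u \is unitarymx -> u^t* *m (u *m x *m u^t*) *m u = x.
Proof.
by move=> hu; rewrite !mulmxA unitary_adjl // mul1mx -mulmxA unitary_adjl // mulmx1.
Qed.

Lemma unitary_conjVK (u x : 'M[C]_n) : u \is unitarymx -> u *m (u^t* *m x *m u) *m u^t* = x.
Proof.
by move=> hu; rewrite !mulmxA unitary_adjr // mul1mx -mulmxA unitary_adjr // mulmx1.
Qed.

Lemma commutant_conj u y : normalises u -> commutant Q y ->
  commutant Q (u *m y *m u^t*).
Proof.
move=> [hu h1 h2] hy x hx.
rewrite -[x](unitary_conjVK _ hu); set z := u^t* *m x *m u.
have hz : Q z by exact: h2.
have e a b : (u *m a *m u^t*) *m (u *m b *m u^t*) = u *m (a *m b) *m u^t*.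
  by rewrite !mulmxA -(mulmxA _ (u^t*) u) unitary_adjl // mulmx1.
by rewrite !e hy.
Qed.

Lemma ntr_conj (u y : 'M[C]_n) : u \is unitarymx -> ntr (u *m y *m u^t*) = ntr y.
Proof. by move=> hu; rewrite ntrC mulmxA unitary_adjl // mul1mx. Qed.

Lemma ntr_conjV (u y : 'M[C]_n) : u \is unitarymx -> ntr (u^t* *m y *m u) = ntr y.
Proof. by move=> hu; rewrite ntrC mulmxA unitary_adjr // mul1mx. Qed.

(** A positive element that has positive expectation in every state of the
    algebra is invertible: otherwise its kernel projection, suitably
    normalised, would be a state of expectation zero. *)
Lemma faithful_unit (N : set 'M[C]_n) c : (0 < n)%N -> psd c ->
  commutant N c -> (forall rho, density (commutant N) rho -> 0 < ntr (c *m rho)) ->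
  c \in unitmx.
Proof.
move=> n0 hc cN hpos; have [U [d [hU ec]]] := herm_spectral (psd_herm hc).
have UU := unitary_adjl hU; have UU' := unitary_adjr hU.
pose e : 'rV[C]_n := \row_i (d 0 i == 0)%:R.
pose p := U^t* *m diag_mx e *m U.
have pN : commutant N p.
  move=> y hy; symmetry; apply: (diag_conj_comm hU (d := d)).
    by move=> i j dij; rewrite !mxE dij.
  by rewrite -ec cN.
have ee : (diag_mx e)^t* *m diag_mx e = diag_mx e.
  apply/matrixP=> i j; rewrite mul_mx_diag !mxE.
  have [->|_] := eqVneq i j; first by rewrite !mulr1n rmorph_nat -natrM mulnb andbb.
  by rewrite !mulr0n rmorph0 mul0r.
have hp : psd p.
  have -> : p = (diag_mx e *m U)^t* *m (diag_mx e *m U).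
    by rewrite adjM !mulmxA -(mulmxA (U^t*)) ee.
  exact: psd_adjM.
have cp0 : c *m p = 0.
  rewrite ec /p !mulmxA -(mulmxA _ U) UU' mulmx1 -(mulmxA (U^t*)).
  rewrite (_ : _ *m diag_mx e = 0) ?mulmx0 ?mul0mx //.
  apply/matrixP=> i j; rewrite mul_mx_diag !mxE.
  have [->|_] := eqVneq i j; last by rewrite mulr0n mul0r.
  by rewrite mulr1n; case: eqP => [->|_]; rewrite ?mul0r ?mulr0.
have p0 : ntr p = 0.
  apply/eqP/negP => /negP np.
  have : density (commutant N) ((ntr p)^-1 *: p).
    split.
    - by move=> y hy; rewrite -scalemxAr -scalemxAl pN.
    - move=> v; rewrite -scalemxAr -scalemxAl mxE mulr_ge0 // ?invr_ge0.
      exact: psd_ntr_ge0.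
    - by rewrite ntrZ mulVf.
  by move/hpos; rewrite -scalemxAr cp0 scaler0 ntr0 ltxx.
have p00 : p = 0.
  have pp : p^t* *m p = p.
    rewrite (psd_herm hp) /p !mulmxA -(mulmxA _ U) UU' mulmx1 -(mulmxA (U^t*)).
    rewrite -{1}ee -(mulmxA _ _ (diag_mx e)) (_ : diag_mx e *m diag_mx e = diag_mx e) ?ee //.
    by rewrite mulmx_diag; congr diag_mx; apply/rowP => i; rewrite !mxE -natrM mulnb andbb.
  by apply: ntr_adjM_eq0; rewrite pp.
have dn0 i : d 0 i != 0.
  apply/eqP => di; have : U *m p *m U^t* = 0 by rewrite p00 mulmx0 mul0mx.
  rewrite /p !mulmxA UU' mul1mx -mulmxA UU' mulmx1 => /matrixP/(_ i i).
  by rewrite !mxE di !eqxx => /eqP; rewrite oner_eq0.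
apply: unitmx_inj => y; rewrite ec => h.
have h1 : diag_mx d *m (U *m y) = 0.
  by rewrite -[LHS]mul1mx -UU' -!mulmxA (mulmxA (U^t*)) (mulmxA _ U) h mulmx0.
have h2 : U *m y = 0.
  apply/matrixP=> i j; move/matrixP: h1 => /(_ i j).
  rewrite mul_diag_mx !mxE => /eqP; rewrite mulf_eq0 (negPf (dn0 i)) => /eqP.
  by rewrite ?mxE.
by rewrite -[y]mul1mx -UU -mulmxA h2 mulmx0.
Qed.

End Intertwiners.

(** * Rigidity of the maps of a scheme *)

Section Rigidity.
Variables (C : numClosedFieldType) (n D : nat) (n0 : (0 < n)%N).
Variables (N : set 'M[C]_n) (g : 'I_D -> 'M[C]_n).
Local Notation Q := (commutant N).
Hypothesis hg : markov_basis Q g.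
Hypothesis spatial : forall t, star_auto Q t ->
  exists2 u, u \is unitarymx & forall x, Q x -> t x = u *m x *m u^t*.

Variables (J J' : finType) (t : 'I_D -> 'M[C]_n -> 'M[C]_n).
Variables (A : 'I_D -> J -> 'M[C]_n) (B : J' -> 'M[C]_n).
Local Notation G i := (kraus (A i)).
Local Notation W := (kraus B).

Hypothesis ht : forall i, ks_map Q (t i).
Hypothesis hA : forall i z, Q z -> Q (G i z).
Hypothesis hB : forall z, Q z -> Q (W z).
Hypothesis teleport : forall x, Q x -> \sum_i G i (W (t i x)) = x.
Hypothesis povm : forall z, Q z -> \sum_i G i z = (ntr z)%:M.
Hypothesis W1_ntr : ntr (W 1%:M) = 1.
Hypothesis faithful : forall i rho, density Q rho -> 0 < ntr (G i (W 1%:M) *m rho).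

Let hQ := mb_alg hg.
Let K i (rs : J * J') := B rs.2 *m A i rs.1.

Local Notation c i := (G i (W 1%:M)).

Lemma star_auto_normalises s : star_auto Q s ->
  exists2 u, normalises Q u & forall x, Q x -> s x = u *m x *m u^t*.
Proof.
move=> hs; have [u hu su] := spatial hs; exists u => //.
case: hs => sl sQ sM sa si; split=> // x hx; first by rewrite -su //; exact: sQ.
have [y hy <-] := endo_surj hg sl sQ si hx.
by rewrite su // unitary_conjK.
Qed.

(** The composites of the measurement and the resource have total map the
    identity, the extreme case of the Kadison--Schwarz inequality. *)
Lemma tele_intertwine i rs x : Q x -> t i x *m K i rs = K i rs *m x.
Proof.
apply: (kraus_intertwine (c := 1%:M) (K := K)) => //.
  by move=> y _; rewrite mulmx1 mul1mx.
move=> y hy; rewrite mul1mx -[RHS]teleport //.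
by apply: eq_bigr => k _; rewrite kraus_comp.
Qed.

Lemma weight_kraus i : c i = kraus (K i) 1%:M.
Proof. exact: kraus_comp. Qed.

Lemma tele_weight i x : Q x -> G i (W (t i x)) = c i *m x.
Proof.
move=> hx; rewrite !kraus_comp; apply: (intertwine_kraus hx) => rs y hy.
exact: tele_intertwine.
Qed.

Lemma weight_commutant i : commutant Q (c i).
Proof.
rewrite weight_kraus; apply: (intertwine_commutant hQ (t := t i)).
  by case: (ht i).
by move=> rs y hy; exact: tele_intertwine.
Qed.

Lemma weight_unit i : c i \in unitmx.
Proof.
apply: (faithful_unit (N := N)) => //; last exact: faithful.
  by apply: kraus_psd; apply: kraus_psd; exact: psd1.
by apply: hA; apply: hB; exact: (usa1 hQ).
Qed.

Lemma channel_auto i : star_auto Q (t i).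
Proof.
apply: (intertwine_star_auto hg (K := K i)) => //.
  by move=> r x hx; exact: tele_intertwine.
by rewrite -weight_kraus weight_unit.
Qed.

Lemma channel_surj i y : Q y -> exists2 x, Q x & t i x = y.
Proof. by case: (channel_auto i) => tl tQ _ _ ti hy; exact: (endo_surj hg tl tQ ti hy). Qed.

Let i0 : 'I_D := Ordinal (mb_size_gt0 n0 hg).

Lemma resource_inj y : Q y -> W y = 0 -> y = 0.
Proof.
move=> hy; have [x hx <-] := channel_surj i0 hy => h.
suff -> : x = 0.
  by case: (channel_auto i0) => tl _ _ _ _; rewrite (linear_on0 hQ tl).
rewrite -[x](mulKmx (weight_unit i0)) -(tele_weight i0 hx) h.
rewrite (_ : G i0 0 = 0) ?mulmx0 //.
by rewrite /kraus big1 // => r _; rewrite mulmx0 mul0mx.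
Qed.

(** The resource map is onto, so nothing is annihilated by its value at 1. *)
Lemma resource1_unit : W 1%:M \in unitmx.
Proof.
have Wl : linear_on Q W by move=> a x y _ _; exact: kraus_linear.
have [y hy ey] := endo_surj hg Wl hB resource_inj (usa1 hQ).
apply: unitmx_inj => x hx.
have Bx s : B s *m x = 0.
  apply: (sum_adjM_eq0 (K := fun s => B s *m x)).
  have <- : x^t* *m (W 1%:M *m x) = \sum_s (B s *m x)^t* *m (B s *m x).
    rewrite kraus1 mulmx_suml mulmx_sumr; apply: eq_bigr => k _.
    by rewrite adjM !mulmxA.
  by rewrite hx mulmx0.
rewrite -[x]mul1mx -ey /kraus mulmx_suml big1 // => s _.
by rewrite -mulmxA Bx mulmx0.
Qed.

Section Normalised.
Variable r : 'M[C]_n.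
Hypotheses (r_psd : psd r) (r_sqr : r *m r = W 1%:M) (rQ : Q r).

Lemma root_unit : r \in unitmx.
Proof. by have := resource1_unit; rewrite -r_sqr unitmx_mul andbb. Qed.

Local Notation ri := (invmx r).

Lemma root_adj : r^t* = r. Proof. exact: psd_herm. Qed.
Lemma rootV_adj : ri^t* = ri. Proof. by rewrite adj_invmx root_adj. Qed.
Lemma rootV_in : Q ri. Proof. by apply: commutant_invmx => //; exact: root_unit. Qed.

Let Bn s := B s *m ri.

Lemma kraus_normalised y : kraus Bn y = ri *m W y *m ri.
Proof.
rewrite /kraus mulmx_sumr mulmx_suml; apply: eq_bigr => s _.
by rewrite adjM rootV_adj !mulmxA.
Qed.

Lemma kraus_unnormalised y : r *m kraus Bn y *m r = W y.
Proof.
rewrite kraus_normalised !mulmxA mulmxV ?root_unit // mul1mx.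
by rewrite mulmxKV // root_unit.
Qed.

Lemma kraus_normalised1 : kraus Bn 1%:M = 1%:M.
Proof. by rewrite kraus_normalised -r_sqr mulmxA mulVmx ?root_unit // mul1mx mulmxV ?root_unit. Qed.

Lemma kraus_normalised_in y : Q y -> Q (kraus Bn y).
Proof.
move=> hy; rewrite kraus_normalised; have h := rootV_in.
by apply: (usaM hQ) => //; apply: (usaM hQ) => //; exact: hB.
Qed.

(** Up to the weight [c i], the maps [G i] are left inverse to the resource after
    the channel, so the resource itself is subject to the equality case of the
    Kadison--Schwarz inequality once it is made unital by [r]. *)
Lemma normalised_auto i : star_auto Q (fun x => kraus Bn (t i x)).
Proof.
have [tl tQ tM ta ti] := channel_auto i.
have [_ _ t1 _ _] := ht i.
have kr z : kraus (fun k => r *m A i k) z = G i (r *m z *m r).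
  by apply: eq_bigr => l _; rewrite adjM root_adj !mulmxA.
have hks : ks_map Q (fun x => kraus Bn (t i x)).
  split=> [a x y hx hy|x hx||x hx|x hx].
  - by rewrite tl // kraus_linear.
  - by apply: kraus_normalised_in; exact: tQ.
  - by rewrite t1 kraus_normalised1.
  - by rewrite ta // kraus_adj.
  - by rewrite tM ?ta //; [exact/kraus_ks/kraus_normalised1 | exact: (usa_adj hQ)].
apply: (intertwine_star_auto hg (K := fun k => r *m A i k)) => //.
- move=> k x hx; apply: (kraus_intertwine (I := 'I_1) (Q := Q)
    (t := fun _ x => kraus Bn (t i x))
    (K := fun _ k => r *m A i k) (c := c i) _ _ _ _ ord0) => //.
    exact: weight_commutant.
  by move=> y hy; rewrite big_ord1 kr kraus_unnormalised tele_weight.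
- by rewrite kr mulmx1 r_sqr weight_unit.
Qed.

(** [v] is the quotient of the unitaries of one composite automorphism and of its
    channel; the choice of the outcome [i0] is immaterial. *)
Lemma resource_unitary : exists v u_,
  [/\ normalises Q v, forall i, normalises Q (u_ i),
      forall i x, Q x -> t i x = u_ i *m x *m (u_ i)^t* &
      forall y, Q y -> W y = r *m (v *m y *m v^t*) *m r].
Proof.
have H i : exists u, normalises Q u /\ forall x, Q x -> t i x = u *m x *m u^t*.
  by have [u hu eu] := star_auto_normalises (channel_auto i); exists u.
have [u_ hu] := boolp.choice H.
have [s hs es] := star_auto_normalises (normalised_auto i0).
exists (s *m (u_ i0)^t*), u_; split=> //.
- by apply: normalises_mul => //; apply: normalises_adj; case: (hu i0).
- by move=> i; case: (hu i).
- by move=> i x; case: (hu i) => _; apply.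
- move=> y hy; rewrite -(kraus_unnormalised y); congr (_ *m _ *m _).
  have [[uu uQ uQ'] eu] := hu i0.
  have hx := uQ' _ hy; have := es _ hx; rewrite eu // unitary_conjVK // => ->.
  by rewrite adjM trmxCK !mulmxA.
Qed.

End Normalised.

(** The left side is the trace of the product of the operators with maps [K1] and
    [K2]; averaging makes a square of each contribution of a pair of Kraus
    operators, which shows the sign and, in the equality case, orthogonality. *)
Lemma gram_pair (I I' : finType) (K1 : I -> 'M[C]_n) (K2 : I' -> 'M[C]_n) :
  \sum_l ntr (kraus K1 (g l) *m kraus K2 ((g l)^t*)) =
  D%:R * \sum_a \sum_b ntr (avg g (K1 a *m (K2 b)^t*) *m (avg g (K1 a *m (K2 b)^t*))^t*).
Proof.
have e X : ntr (avg g X *m (avg g X)^t*) = D%:R^-1 * \sum_l ntr (g l *m X *m (g l)^t* *m X^t*).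
  rewrite -avg_adj (ntr_avg n0 hg); last exact: (avg_comm hg).
  rewrite ntrC (avg_sym hg) -scalemxAl ntrZ mulmx_suml ntr_sum; congr (_ * _).
  by apply: eq_bigr => l _; rewrite -mulmxA ntrC !mulmxA.
under [in RHS]eq_bigr => a _ do under eq_bigr => b _ do rewrite e.
under [in RHS]eq_bigr => a _ do rewrite -mulr_sumr.
rewrite -mulr_sumr mulrA divff ?(mb_size_neq0 n0 hg) // mul1r.
transitivity (\sum_l \sum_a \sum_b
    ntr (g l *m (K1 a *m (K2 b)^t*) *m (g l)^t* *m (K1 a *m (K2 b)^t*)^t*)).
  apply: eq_bigr => l _; rewrite /kraus mulmx_suml ntr_sum; apply: eq_bigr => a _.
  rewrite mulmx_sumr ntr_sum; apply: eq_bigr => b _.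
  by rewrite adjM trmxCK -!mulmxA ntrC !mulmxA.
by rewrite exchange_big; apply: eq_bigr => a _; rewrite exchange_big.
Qed.

Lemma gram_ge0 i j : 0 <= \sum_l ntr (G i (g l) *m G j ((g l)^t*)).
Proof.
rewrite gram_pair mulr_ge0 ?ler0n // sumr_ge0 // => a _; rewrite sumr_ge0 // => b _.
by rewrite ntrC; exact: ntr_adjM_ge0.
Qed.

Lemma gram_sum i : \sum_j \sum_l ntr (G i (g l) *m G j ((g l)^t*)) = ntr (G i 1%:M).
Proof.
rewrite exchange_big /= [in RHS](mb_span_adj hg (usa1 hQ)) .
rewrite (_ : \sum_l _ = \sum_l (ntr (g l))^* *: g l); last first.
  rewrite -[LHS](mb_span_adj hg (usa1 hQ)) {1}(mb_span hg (usa1 hQ)).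
  by apply: eq_bigr => l _; rewrite mulmx1 ntr_adj.
rewrite kraus_sum ntr_sum; apply: eq_bigr => l _.
rewrite -ntr_sum -mulmx_sumr povm; last by apply/(usa_adj hQ)/(mb_in hg).
by rewrite mul_mx_scalar ntr_adj.
Qed.

Section Form.
Variables (r v : 'M[C]_n) (u_ : 'I_D -> 'M[C]_n).
Hypotheses (r_psd : psd r) (r_sqr : r *m r = W 1%:M) (rQ : Q r).
Hypothesis r_comm : forall y, W 1%:M *m y = y *m W 1%:M -> r *m y = y *m r.
Hypotheses (nv : normalises Q v) (nu : forall i, normalises Q (u_ i)).
Hypothesis t_unitary : forall i x, Q x -> t i x = u_ i *m x *m (u_ i)^t*.
Hypothesis W_unitary : forall y, Q y -> W y = r *m (v *m y *m v^t*) *m r.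

Local Notation ri := (invmx r).
Local Notation hi := (ri *m ri).
Variables s cs : 'I_D -> 'M[C]_n.
Hypothesis s_def : forall i, s i = v *m u_ i.
Hypothesis cs_def : forall i, cs i = s i *m c i *m (s i)^t*.
Local Notation q := (avg g hi).

Let r_unit : r \in unitmx := root_unit r_sqr.
Let riQ : Q ri := rootV_in r_sqr rQ.
Let riA : ri^t* = ri := rootV_adj r_psd.
Let rA : r^t* = r := root_adj r_psd.

Lemma s_norm i : normalises Q (s i).
Proof. by rewrite s_def; apply: normalises_mul => //; exact: nu. Qed.

Let s_un i : s i \is unitarymx. Proof. by case: (s_norm i). Qed.
Let cs_comm i : commutant Q (cs i).
Proof.
by rewrite cs_def; apply: commutant_conj; [exact: s_norm | exact: weight_commutant].
Qed.

Lemma povm_weight i z : Q z ->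
  G i z = c i *m ((s i)^t* *m (ri *m z *m ri) *m s i).
Proof.
move=> hz; have [_ _ h] := s_norm i.
have hy : Q ((s i)^t* *m (ri *m z *m ri) *m s i).
  by apply: h; apply: (usaM hQ) => //; apply: (usaM hQ).
rewrite -tele_weight // t_unitary // W_unitary; last first.
  by case: (nu i) => _ h1 _; exact: h1.
set y := _ *m s i; have -> : v *m (u_ i *m y *m (u_ i)^t*) *m v^t* = s i *m y *m (s i)^t*.
  by rewrite s_def adjM !mulmxA.
rewrite unitary_conjVK // !mulmxA mulmxV // mul1mx.
by rewrite mulmxKV.
Qed.

Lemma povm_weight' i z : Q z ->
  G i z = (s i)^t* *m (cs i *m (ri *m z *m ri)) *m s i.
Proof.
by move=> hz; rewrite povm_weight // cs_def !mulmxA unitary_adjl // mul1mx.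
Qed.

Lemma cs_adj i : (cs i)^t* = cs i.
Proof. by rewrite cs_def !adjM trmxCK -kraus_adj -kraus_adj adj1 !mulmxA. Qed.

Lemma cs_hi_ntr i y : commutant Q y -> ntr (y *m cs i *m hi) = ntr (y *m cs i *m q).
Proof.
move=> hy; rewrite [LHS]ntrC [RHS]ntrC (ntr_avg n0 hg) //.
by apply: commutantM => //; exact: cs_comm.
Qed.

Lemma povm_ntr i : ntr (G i 1%:M) = ntr (cs i *m q).
Proof.
rewrite povm_weight'; last exact: (usa1 hQ).
rewrite mulmx1 ntr_conjV //.
have := cs_hi_ntr i (y := 1%:M); rewrite !mul1mx => -> // x _.
by rewrite mulmx1 mul1mx.
Qed.

Lemma gram_diag i : \sum_l ntr (G i (g l) *m G i ((g l)^t*)) =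
  D%:R * ntr (cs i *m q *m (cs i *m q)).
Proof.
have qc : commutant Q q by exact: (avg_comm hg).
have cc := cs_comm i.
have c2 : commutant Q (cs i *m cs i) by apply: commutantM.
have e l : ntr (G i (g l) *m G i ((g l)^t*)) =
    ntr (cs i *m cs i *m ri *m (g l *m hi *m (g l)^t*) *m ri).
  have gQ := mb_in hg l; have gQ' := usa_adj hQ gQ.
  have hX : Q (ri *m g l *m ri) by apply: (usaM hQ) => //; exact: (usaM hQ).
  rewrite !povm_weight' //; set X := ri *m g l *m ri; set Y := ri *m _ *m ri.
  have -> : (s i)^t* *m (cs i *m X) *m s i *m ((s i)^t* *m (cs i *m Y) *m s i) =
            (s i)^t* *m (X *m (cs i *m cs i) *m Y) *m s i.
    rewrite -(cc _ hX) !mulmxA -(mulmxA _ (s i)) unitary_adjr // mulmx1.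
    by rewrite -!mulmxA.
  by rewrite ntr_conjV // (c2 _ hX) /X /Y !mulmxA.
under eq_bigr do rewrite e.
rewrite -ntr_sum -mulmx_suml -mulmx_sumr.
have -> : \sum_l g l *m hi *m (g l)^t* = D%:R *: q.
  by rewrite /avg scalerA divff ?scale1r // (mb_size_neq0 n0 hg).
rewrite -scalemxAr -scalemxAl ntrZ; congr (_ * _).
have qQ : Q q by apply: (avg_in hg); exact: (usaM hQ).
transitivity (ntr (cs i *m cs i *m q *m hi)).
  by rewrite -[cs i *m cs i *m ri *m q]mulmxA (qc _ riQ) !mulmxA.
rewrite -(c2 _ qQ).
rewrite mulmxA cs_hi_ntr; last exact: commutantM.
by rewrite (cc _ qQ) !mulmxA.
Qed.

(** The elements [w k = D cs_k q] have total trace [D], since the [F_k] add up to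
    1, and the trace of [w k ^ 2] is at most that of [w k], since the products
    [F_k F_j] have nonnegative trace.  So their total variance about 1 is at most
    0, and this uses that there are exactly [D] of them. *)
Lemma weight_value i : D%:R *: (cs i *m q) = 1%:M.
Proof.
pose w k := D%:R *: (cs k *m q).
pose p k := ntr (G k 1%:M); pose P k j := \sum_l ntr (G k (g l) *m G j ((g l)^t*)).
have D0 : D%:R != 0 :> C := mb_size_neq0 n0 hg.
have wA k : (w k)^t* = w k.
  have qa : q^t* = q by rewrite -avg_adj adjM riA.
  have qQ : Q q by apply: (avg_in hg); exact: (usaM hQ).
  by rewrite adjZ rmorph_nat adjM qa cs_adj (cs_comm k qQ).
have pw k : p k = D%:R^-1 * ntr (w k).
  by rewrite /p povm_ntr ntrZ mulKf.
have Pw k : P k k = D%:R^-1 * ntr (w k *m w k).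
  rewrite /P gram_diag /w; set a := cs k *m q.
  by rewrite -scalemxAl -scalemxAr !ntrZ mulKf.
have Pp k : P k k <= p k.
  rewrite /p -gram_sum (bigD1 k) //= -/(P k k) ler_wpDr // sumr_ge0 // => j _.
  exact: gram_ge0.
have sp : \sum_k p k = 1.
  rewrite -ntr_sum (povm (usa1 hQ)). by rewrite !ntr1.
have var k : ntr ((w k - 1%:M)^t* *m (w k - 1%:M)) = D%:R * P k k - 2%:R * D%:R * p k + 1.
  rewrite Pw pw adjB wA adj1 mulmxBl !mulmxBr mul1mx !mulmx1 !ntrB ntr1 //.
  by field.
have v0 k : 0 <= D%:R * P k k - 2%:R * D%:R * p k + 1 by rewrite -var ntr_adjM_ge0.
have s0 : \sum_k (D%:R * P k k - 2%:R * D%:R * p k + 1) <= 0.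
  apply: (@le_trans _ _ (\sum_k (1 - D%:R * p k))).
    apply: ler_sum => k _.
    rewrite -subr_ge0 (_ : _ - _ = D%:R * (p k - P k k)); last by ring.
    by rewrite mulr_ge0 ?ler0n // subr_ge0.
  rewrite big_split /= sumrN -mulr_sumr sp mulr1 sumr_const card_ord.
  by rewrite subrr.
have : \sum_k (D%:R * P k k - 2%:R * D%:R * p k + 1) == 0 by rewrite eq_le s0 sumr_ge0.
rewrite psumr_eq0 // => /allP/(_ i).
rewrite mem_index_enum -var => /(_ isT)/eqP/ntr_adjM_eq0/eqP.
by rewrite subr_eq0 => /eqP.
Qed.

Lemma gram_offdiag i j : i != j -> \sum_l ntr (G i (g l) *m G j ((g l)^t*)) = 0.
Proof.
move=> ij; have D0 : D%:R != 0 :> C := mb_size_neq0 n0 hg.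
have cq : cs i *m q = D%:R^-1%:M.
  by rewrite -scalemx1 -(weight_value i) scalerA mulVf // scale1r.
have := gram_sum i; rewrite povm_ntr (bigD1 i) //= gram_diag cq.
rewrite mul_mx_scalar -scalemx1 scalerA !ntrZ ntr1 // !mulr1 mulVKf // => /eqP.
rewrite -[X in _ == X]addr0 (inj_eq (addrI _)) psumr_eq0 => [/allP/(_ j)|k _].
  by rewrite mem_index_enum eq_sym ij => /(_ isT)/eqP.
exact: gram_ge0.
Qed.

(** With [p = D cs_i] the inverse of [q], the weights give [p] trace 1 and the
    normalisation of the density gives [r ^ 2] trace 1.  Then the square of
    [r - p r^-1] has trace [1 - 2 + 1 = 0]: this is the equality case of the
    Cauchy--Schwarz inequality between [r] and its inverse. *)
Lemma resource1_value i : W 1%:M = D%:R *: cs i.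
Proof.
have D0 : D%:R != 0 :> C := mb_size_neq0 n0 hg.
pose p := D%:R *: cs i; rewrite -/p.
have pC : commutant Q p by move=> x hx; rewrite -scalemxAr -scalemxAl cs_comm.
have pA : p^t* = p by rewrite adjZ rmorph_nat cs_adj.
have qQ : Q q by apply: (avg_in hg); exact: (usaM hQ).
have pq : p *m q = 1%:M by rewrite -scalemxAl weight_value.
have qp : q *m p = 1%:M by rewrite pC.
have pE j : D%:R *: cs j = p.
  by rewrite -[LHS]mulmx1 -qp mulmxA -scalemxAl weight_value mul1mx.
have np : ntr p = 1.
  have e j : ntr (c j) = D%:R^-1 * ntr p.
    by rewrite -(pE j) ntrZ mulKf // cs_def ntr_conj.
  rewrite -(ntr1 C n0) -[in RHS](teleport (usa1 hQ)) ntr_sum.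
  under eq_bigr => j _ do (case: (ht j) => _ _ -> _ _; rewrite e).
  by rewrite sumr_const card_ord -[RHS]mulr_natl mulVKf.
suff /eqP : r - p *m ri = 0.
  by rewrite subr_eq0 => /eqP e; rewrite -r_sqr {1}e mulmxKV.
have e2 : r *m (p *m ri) = p by rewrite mulmxA (pC _ rQ) mulmxK.
have e3 : ri *m p *m r = p by rewrite (pC _ riQ) mulmxKV.
have e4 : ntr (ri *m p *m (p *m ri)) = ntr p.
  rewrite ntrC mulmxA -(mulmxA p) ntrC mulmxA ntrC -(ntr_avg n0 hg); last exact: commutantM.
  by rewrite mulmxA qp mul1mx.
apply: ntr_adjM_eq0; rewrite adjB adjM riA rA pA mulmxBl !mulmxBr !ntrB.
by rewrite r_sqr W1_ntr e2 e3 e4 np !subrr.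
Qed.

Lemma root_commutant : commutant Q r.
Proof.
move=> x hx; symmetry; apply: r_comm.
by rewrite (resource1_value i0) -scalemxAl -scalemxAr cs_comm.
Qed.

Lemma povm_value i z : Q z -> G i z = D%:R^-1 *: ((s i)^t* *m z *m s i).
Proof.
move=> hz; have D0 : D%:R != 0 :> C := mb_size_neq0 n0 hg.
have cv : cs i = D%:R^-1 *: (r *m r).
  by rewrite r_sqr (resource1_value i) scalerA mulVf // scale1r.
have riC : commutant Q ri by apply: commutant_invmx => //; exact: root_commutant.
rewrite povm_weight' // cv -scalemxAl -scalemxAr -scalemxAl.
have -> : ri *m z *m ri = ri *m ri *m z by rewrite -mulmxA riC // mulmxA.
have -> : r *m r *m (ri *m ri *m z) = z by rewrite !mulmxA mulmxK // mulmxV // mul1mx.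
by [].
Qed.

Lemma unitaries_orthogonal i j y : i != j -> commutant Q y ->
  ntr (u_ i *m (u_ j)^t* *m y) = 0.
Proof.
move=> ij hy; have D0 : D%:R != 0 :> C := mb_size_neq0 n0 hg.
have Gk k z : Q z -> kraus (fun _ : 'I_1 => s k) z = D%:R *: G k z.
  by move=> hz; rewrite povm_value // /kraus big_ord1 scalerA divff // scale1r.
have h : \sum_l ntr (kraus (fun _ : 'I_1 => s i) (g l) *m kraus (fun _ : 'I_1 => s j) ((g l)^t*)) = 0.
  transitivity (D%:R * (D%:R * \sum_l ntr (G i (g l) *m G j ((g l)^t*)))).
    rewrite !mulr_sumr; apply: eq_bigr => l _.
    have gQ := mb_in hg l; rewrite !Gk //; last exact: (usa_adj hQ).
    by rewrite -scalemxAl -scalemxAr !ntrZ.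
  by rewrite gram_offdiag // !mulr0.
move: h; rewrite gram_pair !big_ord1 => /eqP; rewrite mulf_eq0 (negPf D0) /= => /eqP h.
have [vu _ _] := nv.
rewrite -(ntr_conj _ vu) -(ntr_avg_eq0 n0 hg h (commutant_conj nv hy)) !s_def adjM.
by rewrite !mulmxA -(mulmxA _ (v^t*) v) unitary_adjl // mulmx1.
Qed.

End Form.

(** Everything a scheme is made of is governed by unitaries normalising the
    algebra and one positive invertible central element [r]. *)
Theorem scheme_rigidity : exists (r v : 'M[C]_n) (u_ : 'I_D -> 'M[C]_n),
  [/\ [/\ psd r, Q r, commutant Q r & r \in unitmx],
      normalises Q v /\ (forall i, normalises Q (u_ i)),
      forall i x, Q x -> t i x = u_ i *m x *m (u_ i)^t*,
      forall y, Q y -> W y = r *m (v *m y *m v^t*) *m r &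
      (forall i z, Q z ->
        G i z = D%:R^-1 *: ((v *m u_ i)^t* *m z *m (v *m u_ i))) /\
      (forall i j y, i != j -> commutant Q y -> ntr (u_ i *m (u_ j)^t* *m y) = 0)].
Proof.
have hp : psd (W 1%:M) by apply/kraus_psd/psd1.
have [r [r_psd r_sqr r_comm]] := psd_sqrt hp.
have rQ : Q r.
  by move=> y hy; symmetry; apply: r_comm; rewrite (hB (usa1 hQ)).
have [v [u_ [nv nu tu Wu]]] := resource_unitary r_psd r_sqr rQ.
exists r, v, u_; split=> //.
- split=> //; last exact: (root_unit r_sqr).
  exact: (root_commutant r_psd r_sqr rQ r_comm nv nu tu Wu (fun _ => erefl) (fun _ => erefl)).
- split.
    exact: (povm_value r_psd r_sqr rQ r_comm nv nu tu Wu (fun _ => erefl) (fun _ => erefl)).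
  exact: (unitaries_orthogonal r_psd r_sqr rQ r_comm nv nu tu Wu (fun _ => erefl) (fun _ => erefl)).
Qed.

End Rigidity.

(** * Matrix units of the commutant *)

Section Blocks.
Variables (C : numClosedFieldType) (n k : nat) (nn mm : 'I_k -> nat).
Variable (V : 'M[C]_(n, \sum_(j < k) nn j * mm j)).
Variable (N : set 'M[C]_n).
Hypothesis hV : block_basis V N.
Local Notation Q := (commutant N).

Let VV : V *m V^t* = 1%:M. Proof. by case: hV. Qed.
Let VV' : V^t* *m V = 1%:M. Proof. by case: hV. Qed.

Local Notation Vb j := (submxrow (q_ := fun j => (nn j * mm j)%N) V j).

(** In block [j] the space is a sum of [mm j] copies of [C^(nn j)], and [coiso b]
    maps onto copy number [b]; the factor 1 in the number of rows is left by the
    row vector that selects the copy. *)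
Definition coiso (j : 'I_k) (b : 'I_(mm j)) : 'M[C]_(nn j * 1, n) :=
  ((1%:M : 'M_(nn j)) *t (delta_mx 0 b : 'rV_(mm j))) *m (Vb j)^t*.

Lemma submxrow_adjM i j : (Vb i)^t* *m Vb j =
  submxblock (p_ := fun j => (nn j * mm j)%N) (q_ := fun j => (nn j * mm j)%N) (1%:M) i j.
Proof.
rewrite -VV'; apply/matrixP=> a b; rewrite !mxE; apply: eq_bigr => l _.
by rewrite !mxE.
Qed.

Lemma block_iso j : (Vb j)^t* *m Vb j = 1%:M.
Proof.
rewrite submxrow_adjM; apply/matrixP=> a b; rewrite !mxE.
by rewrite -val_eqE tagnat.eq_Rank eqxx.
Qed.

Lemma block_orth i j : i != j -> (Vb i)^t* *m Vb j = 0.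
Proof.
move=> ij; rewrite submxrow_adjM; apply/matrixP=> a b; rewrite !mxE.
by rewrite -val_eqE tagnat.eq_Rank (negPf ij).
Qed.

Lemma block_diagE (B : forall j, 'M[C]_(nn j * mm j)) :
  V *m (\mxdiag_j B j) *m V^t* = \sum_j Vb j *m B j *m (Vb j)^t*.
Proof.
rewrite -{1 2}[V](submxrowK (q_ := fun j => (nn j * mm j)%N)) mul_mxrow_mxdiag.
rewrite (_ : (\mxrow_j Vb j)^t* = \mxcol_j (Vb j)^t*) ?mul_mxrow_mxcol //.
by apply/matrixP=> a b; rewrite !mxE.
Qed.

Lemma sum_delta_tens m (j : 'I_k) : \sum_b (delta_mx b b : 'M[C]_m) = 1%:M.
Proof.
apply/matrixP=> a b; rewrite summxE (bigD1 a) //= !mxE eqxx /= big1 ?addr0 // => [|c ca].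
  by rewrite eq_sym.
by rewrite mxE eq_sym (negPf ca).
Qed.

Lemma coiso_adj j b : (coiso b)^t* =
  Vb j *m ((1%:M : 'M_(nn j)) *t (delta_mx b 0 : 'cV_(mm j))).
Proof.
rewrite /coiso adjM trmxCK adj_tens adj1; congr (_ *m (_ *t _)).
by rewrite trmx_delta map_delta_mx.
Qed.

Lemma coisoM j (b c : 'I_(mm j)) : coiso b *m (coiso c)^t* = (b == c)%:R%:M.
Proof.
rewrite coiso_adj /coiso !mulmxA -(mulmxA _ (_^t*)) block_iso mulmx1 tensmx_mul mulmx1.
rewrite mul_delta_mx_cond; case: eqP => _; last by rewrite tensmx0 raddf0.
rewrite mulr1n (_ : delta_mx 0 0 = 1%:M) ?tens11 //.
by apply/matrixP=> i l; rewrite !mxE !ord1.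
Qed.

Lemma coisoM_neq i j (b : 'I_(mm i)) (c : 'I_(mm j)) : i != j ->
  coiso b *m (coiso c)^t* = 0.
Proof.
move=> ij; rewrite coiso_adj /coiso !mulmxA -(mulmxA _ (_^t*)) block_orth //.
by rewrite mulmx0 mul0mx.
Qed.

(** The matrix units of the commutant. *)
Definition munit (j : 'I_k) (b c : 'I_(mm j)) : 'M[C]_n := (coiso b)^t* *m coiso c.

Lemma munitE j (b c : 'I_(mm j)) :
  munit b c = Vb j *m ((1%:M : 'M_(nn j)) *t delta_mx b c) *m (Vb j)^t*.
Proof.
rewrite /munit coiso_adj /coiso !mulmxA -(mulmxA (Vb j)) tensmx_mul mulmx1.
by rewrite mul_delta_mx.
Qed.

Lemma munit_adj j (b c : 'I_(mm j)) : (munit b c)^t* = munit c b.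
Proof. by rewrite /munit adjM trmxCK. Qed.

Lemma coiso_munit j (a b c : 'I_(mm j)) :
  coiso a *m munit b c = (a == b)%:R *: coiso c.
Proof. by rewrite /munit mulmxA coisoM mul_scalar_mx. Qed.

Lemma coiso_munit_neq i j (a : 'I_(mm i)) (b c : 'I_(mm j)) : i != j ->
  coiso a *m munit b c = 0.
Proof. by move=> ij; rewrite /munit mulmxA coisoM_neq // mul0mx. Qed.

Lemma munitM j (a b c d : 'I_(mm j)) :
  munit a b *m munit c d = (b == c)%:R *: munit a d.
Proof. by rewrite {1}/munit -mulmxA coiso_munit -scalemxAr. Qed.

Lemma munitM_neq i j (a b : 'I_(mm i)) (c d : 'I_(mm j)) : i != j ->
  munit a b *m munit c d = 0.
Proof. by move=> ij; rewrite {1}/munit -mulmxA coiso_munit_neq // mulmx0. Qed.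

Lemma munit_sum : \sum_j \sum_b @munit j b b = 1%:M.
Proof.
transitivity (V *m (\mxdiag_j (1%:M : 'M[C]_(nn j * mm j))) *m V^t*); last first.
  by rewrite mxdiagZ mulmx1 VV.
rewrite block_diagE; apply: eq_bigr => j _.
under eq_bigr do rewrite munitE.
rewrite -mulmx_suml -mulmx_sumr -tens_sumr; congr (_ *m _ *m _).
by rewrite (sum_delta_tens _ j) tens11.
Qed.

Lemma ntr_munit j (b c : 'I_(mm j)) : ntr (munit b c) = (b == c)%:R * ((nn j)%:R / n%:R).
Proof.
rewrite /ntr /munit mxtrace_mulC coisoM mulrA; congr (_ / _).
by rewrite mxtrace_scalar muln1 eq_sym mulr_natr.
Qed.

Lemma commutant_blockP x : Q x <->
  exists X : forall j, 'M[C]_(mm j), x = \sum_j \sum_b \sum_c X j b c *: munit b c.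
Proof.
have E (X : forall j, 'M[C]_(mm j)) :
    V *m (\mxdiag_(j < k) ((1%:M : 'M[C]_(nn j)) *t X j)) *m V^t* =
    \sum_j \sum_b \sum_c X j b c *: munit b c.
  rewrite block_diagE; apply: eq_bigr => j _.
  rewrite {1}(matrix_sum_delta (X j)) tens_sumr mulmx_sumr mulmx_suml.
  apply: eq_bigr => b _; rewrite tens_sumr mulmx_sumr mulmx_suml.
  by apply: eq_bigr => c _; rewrite munitE tensZr -scalemxAr -scalemxAl.
case: hV => _ _ _ _ ->; split=> [[X _ <-]|[X ->]]; exists X => //.
Qed.

Let L : finType := {j : 'I_k & ('I_(mm j) * 'I_(mm j))%type}.

Lemma munit_in j (b c : 'I_(mm j)) : Q (munit b c).
Proof.
pose T j' (bc : 'I_(mm j') * 'I_(mm j')) : L := Tagged (fun j => ('I_(mm j) * 'I_(mm j))%type) bc.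
apply/commutant_blockP; exists (fun i => \matrix_(b', c') (T i (b', c') == T j (b, c))%:R).
rewrite (bigD1 j) //= (bigD1 b) //= (bigD1 c) //= mxE eqxx scale1r.
rewrite !big1 ?addr0 // => [i ij|b' bb'|c' cc'].
- rewrite big1 // => b' _; rewrite big1 // => c' _; rewrite mxE.
  case: eqP => [e|_]; last by rewrite scale0r.
  by have := congr1 tag e; rewrite /= => e'; rewrite e' eqxx in ij.
- rewrite big1 // => c' _; rewrite mxE /T eq_Tagged /= xpair_eqE (negPf bb').
  by rewrite scale0r.
- by rewrite mxE /T eq_Tagged /= xpair_eqE (negPf cc') andbF scale0r.
Qed.

Definition munitL (l : L) : 'M[C]_n := munit (tagged l).1 (tagged l).2.

Lemma munitL_orth l l' : ntr ((munitL l)^t* *m munitL l') =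
  (l == l')%:R * ((nn (tag l))%:R / n%:R).
Proof.
case: l l' => j [b c] [j' [b' c']]; rewrite /munitL /= munit_adj.
have [e|ne] := eqVneq j j'.
  case: _ / e in b' c' *; rewrite munitM ntrZ ntr_munit (mulrA (b == b')%:R) -natrM mulnb.
  by rewrite eq_Tagged /= xpair_eqE.
rewrite munitM_neq // ntr0 (_ : (_ == _) = false) ?mul0r //.
by apply/negP => /eqP/(congr1 tag)/eqP; rewrite (negPf ne).
Qed.

Lemma munitL_span x : Q x -> exists a : L -> C, x = \sum_l a l *: munitL l.
Proof.
move/commutant_blockP => [X ->]; exists (fun l => X (tag l) (tagged l).1 (tagged l).2).
rewrite (eq_bigr (fun j => \sum_(bc : 'I_(mm j) * 'I_(mm j)) X j bc.1 bc.2 *: munit bc.1 bc.2)).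
  by rewrite sig_big_dep.
by move=> j _; rewrite pair_bigA.
Qed.

Lemma munitL_in l : Q (munitL l).
Proof. exact: munit_in. Qed.

(** Such an element acts in the same way on all copies in a block, so its
    compression to the first copy determines it. *)
Lemma bicommutant_block x : (forall j (b c : 'I_(mm j)), x *m munit b c = munit b c *m x) ->
  N x.
Proof.
move=> hx; have hm j : (0 < mm j)%N by case: hV => _ _ /(_ j)/andP[].
pose b0 j := Ordinal (hm j); pose Y j := coiso (b0 j) *m x *m (coiso (b0 j))^t*.
pose X j : 'M[C]_(nn j) := castmx (muln1 _, muln1 _) (Y j).
have eX j : X j *t (1%:M : 'M_1) = Y j.
  rewrite tens_mx_scalar scale1r /X; apply/matrixP=> a b.
  by rewrite !castmxE /= !cast_ord_comp !cast_ord_id.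
case: hV => _ _ _ -> _; exists X => //; rewrite block_diagE.
transitivity (\sum_j \sum_b (coiso b)^t* *m Y j *m (coiso b : 'M_(nn j * 1, n))).
  apply: eq_bigr => j _; rewrite -{1}(sum_delta_tens (mm j) j) tens_sumr.
  rewrite mulmx_sumr mulmx_suml; apply: eq_bigr => b _.
  have <- : (1%:M *t delta_mx b 0) *m (X j *t (1%:M : 'M_1)) *m (1%:M *t delta_mx 0 b)
      = X j *t delta_mx b b :> 'M[C]_(nn j * mm j).
    by rewrite !tensmx_mul mul1mx !mulmx1 mul_delta_mx.
  by rewrite coiso_adj /coiso -eX !mulmxA.
rewrite -[RHS]mul1mx -munit_sum mulmx_suml; apply: eq_bigr => j _.
rewrite mulmx_suml; apply: eq_bigr => b _.
transitivity (munit b (b0 j) *m x *m munit (b0 j) b); first by rewrite /munit /Y !mulmxA.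
by rewrite -mulmxA hx mulmxA munitM eqxx scale1r.
Qed.

End Blocks.

(** * Transposition and the GNS map *)

Section Transposition.
Variables (C : numClosedFieldType) (n p : nat) (V : 'M[C]_(n, p)).
Hypotheses (n0 : (0 < n)%N) (VV : V *m V^t* = 1%:M) (VV' : V^t* *m V = 1%:M).

Lemma adj_trmx_comm m q (A : 'M[C]_(m, q)) : (A^T)^t* = (A^t*)^T.
Proof. by rewrite map_trmx. Qed.

(** Transposition in an orthonormal basis is the plain transposition followed
    by conjugation with a symmetric unitary. *)
Lemma trV_unitary : exists S : 'M[C]_n,
  [/\ S *m S^t* = 1%:M, S^t* *m S = 1%:M, S^T = S &
      forall x, trV V x = S *m x^T *m S^t*].
Proof.
have VVt : V^T *m (V^t*)^T = 1%:M by rewrite -trmx_mul VV' trmx1.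
exists (V *m V^T); split.
- by rewrite adjM adj_trmx_comm mulmxA -(mulmxA V) VVt mulmx1.
- rewrite adjM adj_trmx_comm mulmxA -(mulmxA _ _ V) VV' mulmx1.
  by rewrite -trmx_mul VV trmx1.
- by rewrite trmx_mul trmxK.
- by move=> x; rewrite /trV adjM !trmx_mul adj_trmx_comm !mulmxA.
Qed.

Lemma trV1 : trV V 1%:M = 1%:M.
Proof. by have [S [SS _ _ ->]] := trV_unitary; rewrite trmx1 mulmx1. Qed.

Lemma trVM x y : trV V (x *m y) = trV V y *m trV V x.
Proof.
have [S [_ SS _ E]] := trV_unitary.
by rewrite !E trmx_mul !mulmxA -(mulmxA _ (S^t*) S) SS mulmx1.
Qed.

Lemma trV_sum (I : Type) (r : seq I) (P : pred I) (F : I -> 'M[C]_n) :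
  trV V (\sum_(i <- r | P i) F i) = \sum_(i <- r | P i) trV V (F i).
Proof.
have [S [_ _ _ E]] := trV_unitary.
rewrite E linear_sum mulmx_sumr mulmx_suml.
by apply: eq_bigr => i _; rewrite E.
Qed.

Lemma trVK x : trV V (trV V x) = x.
Proof.
have [S [SS _ St E]] := trV_unitary.
have SS1 : S^T *m S^t* = 1%:M by rewrite {1}St.
rewrite !E !trmx_mul trmxK -adj_trmx_comm (congr1 (fun X => X^t*) St).
by rewrite !mulmxA SS mul1mx -mulmxA SS1 mulmx1.
Qed.

Lemma trV_adj x : trV V (x^t*) = (trV V x)^t*.
Proof.
have [S [_ _ _ E]] := trV_unitary.
by rewrite !E !adjM trmxCK adj_trmx_comm mulmxA.
Qed.

Lemma ntr_trV x : ntr (trV V x) = ntr x.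
Proof.
have [S [_ SS _ E]] := trV_unitary.
by rewrite E ntrC mulmxA SS mul1mx /ntr mxtrace_tr.
Qed.

Local Notation Psi := (psi V).

Lemma tens_row_col (x : 'M[C]_n) (u v : 'cV[C]_n) :
  (x *t 1%:M) *m (u *t v : 'cV[C]_(n * n)) = (x *m u) *t v :> 'cV[C]_(n * n).
Proof. by rewrite (tensmx_mul x 1%:M u v) mul1mx. Qed.

Lemma tens_row_col2 (x : 'M[C]_n) (u v : 'cV[C]_n) :
  (1%:M *t x) *m (u *t v : 'cV[C]_(n * n)) = u *t (x *m v) :> 'cV[C]_(n * n).
Proof. by rewrite (tensmx_mul 1%:M x u v) mul1mx. Qed.

Lemma tens_col_form (u v u' v' : 'cV[C]_n) :
  (u *t v : 'cV[C]_(n * n))^t* *m (u' *t v' : 'cV[C]_(n * n)) =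
  ((u^t* *m u') 0 0 * (v^t* *m v') 0 0)%:M.
Proof.
transitivity ((u^t* *t v^t*) *m (u' *t v') : 'M[C]_1).
  exact: (congr1 (fun M => M *m _) (adj_tens u v)).
rewrite (tensmx_mul (u^t*) (v^t*) u' v'); apply/matrixP=> i j.
by rewrite !ord1 !mxE /= mulr1n; congr (_ * _); apply: eq_bigr => l _; rewrite !mxE !ord1.
Qed.

Lemma adj_col_col (a b : 'I_p) : (col a V)^t* *m col b V = (a == b)%:R%:M.
Proof.
apply/matrixP=> i j; rewrite !ord1; move/matrixP: VV' => /(_ a b); rewrite !mxE => <-.
by apply: eq_bigr => l _; rewrite !mxE.
Qed.

Lemma sum_col_adj : \sum_l col l V *m (col l V)^t* = 1%:M.
Proof.
rewrite -VV; apply/matrixP=> i j; rewrite summxE !mxE; apply: eq_bigr => l _.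
by rewrite mxE big_ord1 !mxE.
Qed.

Lemma trV_form x a b :
  ((col a V)^t* *m trV V x *m col b V) = ((col b V)^t* *m x *m col a V).
Proof.
have e (l : 'I_p) : V^t* *m col l V = delta_mx l 0 by rewrite !colE mulmxA VV' mul1mx.
have e' (l : 'I_p) : (col l V)^t* *m V = (delta_mx l 0)^t*.
  by rewrite -(e l) adjM trmxCK.
apply/matrixP=> i j; rewrite !ord1 /trV !mulmxA e' -(mulmxA _ (V^t*)) e.
rewrite !colE adjM -!mulmxA (mulmxA x) (mulmxA (V^t*)) !mulmxA -(mulmxA _ (V^t*)).
by rewrite -(mulmxA _ (V^t* *m x)) !form_delta mxE.
Qed.

Lemma psi_expand (x : 'M[C]_n) : Lam V x =
  (sqrtC n%:R)^-1 *: \sum_l ((x *m col l V) *t col l V : 'cV[C]_(n * n)).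
Proof.
rewrite /Lam /psi -scalemxAr mulmx_sumr; congr (_ *: _).
by apply: eq_bigr => l _; rewrite tens_row_col.
Qed.

Lemma col_mul11 m (u : 'cV[C]_m) (M : 'M[C]_1) : u *m M = M 0 0 *: u.
Proof. by rewrite {1}[M]mx11_scalar mul_mx_scalar. Qed.

(** The canonical vector intertwines an operator on the second leg with its
    transpose on the first. *)
Lemma psi_trV x : (1%:M *t x) *m Psi = (trV V x *t 1%:M) *m Psi.
Proof.
rewrite /psi -!scalemxAr !mulmx_sumr; congr (_ *: _).
transitivity (\sum_a \sum_b ((col b V)^t* *m x *m col a V) 0 0 *:
    (col a V *t col b V : 'cV[C]_(n * n))).
  apply: eq_bigr => a _; rewrite tens_row_col2.
  rewrite -{1}[x *m _]mul1mx -sum_col_adj mulmx_suml tens_sumr.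
  apply: eq_bigr => b _; apply: (etrans _ (tensZr _ (col a V) (col b V))); congr (_ *t _).
  by rewrite -(mulmxA (col b V)) col_mul11 !mulmxA.
rewrite exchange_big /=; apply: eq_bigr => b _; rewrite tens_row_col.
rewrite -[trV V x *m _]mul1mx -sum_col_adj mulmx_suml tens_suml.
apply: eq_bigr => a _; apply: esym; apply: (etrans _ (tensZl _ (col a V) (col b V))); congr (_ *t _).
by rewrite -(mulmxA (col a V)) (mulmxA ((col a V)^t*)) trV_form col_mul11.
Qed.

Lemma psi_form x : Psi^t* *m (x *t 1%:M) *m Psi = (ntr x)%:M.
Proof.
rewrite -mulmxA -/(Lam V x) psi_expand /psi adjZ -scalemxAl -scalemxAr scalerA.
rewrite adj_sum mulmx_suml.
have -> : \sum_i (col i V *t col i V : 'cV_(n * n))^t* *m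
    \sum_l ((x *m col l V) *t col l V : 'cV[C]_(n * n)) = (\tr x)%:M.
  under eq_bigr => i _ do rewrite mulmx_sumr.
  transitivity (\sum_(i < p) ((col i V)^t* *m x *m col i V)).
    apply: eq_bigr => i _; rewrite (bigD1 i) //= big1 ?addr0 => [|l li].
      by rewrite tens_col_form adj_col_col [X in _ * X]mxE !eqxx !mulr1n mulr1 mulmxA -mx11_scalar.
    by rewrite tens_col_form adj_col_col eq_sym (negPf li) [X in _ * X]mxE mul0rn mulr0 raddf0.
  apply/matrixP=> a b; rewrite !ord1 summxE mxE eqxx mulr1n.
  rewrite -[x in RHS]mul1mx -sum_col_adj mulmx_suml raddf_sum; apply: eq_bigr => i _ /=.
  by rewrite -[in RHS]mulmxA [RHS]mxtrace_mulC trace_mx11.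
have n0' : 0 <= (sqrtC n%:R : C)^-1 by rewrite invr_ge0 sqrtC_ge0 ler0n.
rewrite conj_Creal ?ger0_real // -invfM -expr2 sqrtCK /ntr mulrC.
by rewrite scale_scalar_mx.
Qed.

Lemma Lam_surj (w : 'cV[C]_(n * n)) : exists x, w = Lam V x.
Proof.
pose ab a b : 'cV[C]_(n * n) := col a V *t col b V.
pose x := sqrtC n%:R *: \sum_b \sum_a
  (((ab a b)^t* *m w) 0 0 *: (col a V *m (col b V)^t*)).
exists x; rewrite psi_expand.
have sn : sqrtC n%:R != 0 :> C by rewrite sqrtC_eq0 pnatr_eq0 -lt0n.
have ex l : x *m col l V = sqrtC n%:R *: \sum_a ((ab a l)^t* *m w) 0 0 *: col a V.
  rewrite /x -scalemxAl; congr (_ *: _); rewrite mulmx_suml (bigD1 l) //= [X in _ + X]big1 ?addr0.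
    rewrite mulmx_suml; apply: eq_bigr => a _.
    by rewrite -scalemxAl -mulmxA adj_col_col eqxx mulmx1.
  move=> b bl; rewrite mulmx_suml big1 // => a _.
  by rewrite -scalemxAl -mulmxA adj_col_col (negPf bl) raddf0 mulmx0 scaler0.
transitivity (\sum_l \sum_a ((ab a l)^t* *m w) 0 0 *: ab a l); last first.
  rewrite scaler_sumr; apply: eq_bigr => l _; rewrite ex.
  rewrite (tensZl _ _ (col l V)) scalerA mulVf // scale1r (tens_suml _ _ _ (col l V)).
  by apply: eq_bigr => a _; rewrite (tensZl _ (col a V) (col l V)).
have e a b : ab a b *m (ab a b)^t* = (col a V *m (col a V)^t*) *t (col b V *m (col b V)^t*).
  transitivity ((col a V *t col b V) *m ((col a V)^t* *t (col b V)^t*) : 'M[C]_(n * n)).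
    exact: (congr1 (fun M => _ *m M) (adj_tens (col a V) (col b V))).
  exact: (tensmx_mul (col a V) (col b V) ((col a V)^t*) ((col b V)^t*)).
transitivity (\sum_l \sum_a (ab a l *m (ab a l)^t*) *m w).
  under eq_bigr => l _ do rewrite -mulmx_suml.
  rewrite -mulmx_suml (_ : \sum_l _ = 1%:M) ?mul1mx //.
  transitivity (\sum_l (1%:M : 'M[C]_n) *t (col l V *m (col l V)^t*)).
    apply: eq_bigr => l _; rewrite -sum_col_adj tens_suml.
    by apply: eq_bigr => a _; rewrite e.
  by rewrite -tens_sumr sum_col_adj tens11.
apply: eq_bigr => l _; apply: eq_bigr => a _.
by rewrite -mulmxA col_mul11.
Qed.

Lemma LamM x y : (x *t 1%:M) *m Lam V y = Lam V (x *m y).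
Proof. by rewrite /Lam mulmxA (tensmx_mul x 1%:M y 1%:M) mulmx1. Qed.

Lemma Lam1 : Lam V 1%:M = Psi.
Proof. by rewrite /Lam tens11 mul1mx. Qed.

Lemma LamMr x y : (1%:M *t x) *m Lam V y = Lam V (y *m trV V x).
Proof.
rewrite /Lam mulmxA -tensmx_decl tensmx_decr -mulmxA psi_trV mulmxA.
by rewrite (tensmx_mul y 1%:M (trV V x) 1%:M) mulmx1.
Qed.

Lemma Lam_tens a b x : (a *t b) *m Lam V x = Lam V (a *m x *m trV V b).
Proof. by rewrite (tensmx_decr a b) -(mulmxA _ _ (Lam V x)) LamMr LamM mulmxA. Qed.

Lemma Lam_form x y : (Lam V x)^t* *m Lam V y = (ntr (x^t* *m y))%:M.
Proof.
rewrite /Lam adjM adj_tens adj1 -mulmxA (mulmxA (_ *t _)).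
by rewrite (tensmx_mul _ 1%:M y 1%:M) mulmx1 mulmxA psi_form.
Qed.

Lemma Lam_sum (I : Type) (r : seq I) (P : pred I) (F : I -> 'M[C]_n) :
  Lam V (\sum_(i <- r | P i) F i) = \sum_(i <- r | P i) Lam V (F i).
Proof. by rewrite /Lam tens_suml mulmx_suml. Qed.

Lemma LamZ c x : Lam V (c *: x) = c *: Lam V x.
Proof. by rewrite /Lam tensZl -scalemxAl. Qed.

Lemma Lam_ext (X Y : 'M[C]_(n * n)) :
  (forall x, X *m Lam V x = Y *m Lam V x) -> X = Y.
Proof.
move=> h; apply/matrixP=> i j.
have [x e] := Lam_surj (delta_mx j 0); have := h x; rewrite -e -!colE.
by move/matrixP/(_ i 0); rewrite !mxE.
Qed.

End Transposition.

(** * Automorphisms of the commutant are spatial *)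

Section Isometry.
Variable C : numClosedFieldType.

(** A projection of trace [r] is the range projection of [r] orthonormal
    vectors; only its acting as the identity on them is recorded. *)
Lemma proj_isometry n r (p : 'M[C]_n) : p^t* = p -> p *m p = p -> \tr p = r%:R ->
  exists W : 'M[C]_(n, r), p *m W = W /\ W^t* *m W = 1%:M.
Proof.
move=> pA pp tp; have [U [d [hU ep]]] := herm_spectral pA.
have UU := unitary_adjl hU; have UU' := unitary_adjr hU.
have dd i : d 0 i = (d 0 i == 1)%:R.
  have : diag_mx d *m diag_mx d = diag_mx d.
    have : U *m (p *m p) *m U^t* = U *m p *m U^t* by rewrite pp.
    rewrite {1 2}ep [in RHS]ep !mulmxA UU' !mul1mx -!(mulmxA _ U) UU' !mulmx1.
    by [].
  move/matrixP/(_ i i); rewrite mul_diag_mx !mxE eqxx !mulr1n => e.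
  have /eqP : d 0 i * (d 0 i - 1) = 0 by rewrite mulrBr mulr1 e subrr.
  rewrite mulf_eq0 subr_eq0.
  by case/orP => /eqP ->; rewrite ?eqxx // eq_sym oner_eq0.
pose P := [pred i | d 0 i == 1].
have cT : r = #|P|.
  apply/eqP; rewrite -(eqr_nat C) -tp ep mxtrace_mulC mulmxA UU' mul1mx mxtrace_diag.
  have -> : #|P| = (\sum_i ((d 0 i == 1)%R : nat))%N by rewrite -sum1_card big_mkcond.
  by rewrite natr_sum; apply/eqP; apply: eq_bigr => i _; exact: dd.
subst r; pose S : 'M[C]_(n, #|P|) := \matrix_(i, a) (i == enum_val a)%:R.
exists (U^t* *m S); split.
  rewrite ep !mulmxA -(mulmxA _ U) UU' mulmx1 -mulmxA; congr (_ *m _).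
  apply/matrixP=> i a; rewrite mul_diag_mx !mxE.
  have [->|_] := eqVneq; last by rewrite mulr0.
  by have := enum_valP a; rewrite inE => /eqP ->; rewrite mulr1.
rewrite adjM trmxCK !mulmxA -(mulmxA _ U) UU' mulmx1.
apply/matrixP=> a b; rewrite !mxE (bigD1 (enum_val b)) //= big1 ?addr0 => [|i ib].
  by rewrite !mxE eqxx mulr1 rmorph_nat (inj_eq enum_val_inj) eq_sym.
by rewrite !mxE (negPf ib) mulr0.
Qed.
End Isometry.

Section Blocks.
Variables (C : numClosedFieldType) (n k : nat) (nn mm : 'I_k -> nat).
Variable (V : 'M[C]_(n, \sum_(j < k) nn j * mm j)).
Variable (N : set 'M[C]_n).
Hypotheses (n0 : (0 < n)%N) (hV : block_basis V N) (hN : unital_star_alg N).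
Local Notation Q := (commutant N).

Let hQ : unital_star_alg Q.
Proof. by apply: commutant_usa => x; exact: (usa_adj hN). Qed.

Let VV : V *m V^t* = 1%:M. Proof. by case: hV. Qed.
Let VV' : V^t* *m V = 1%:M. Proof. by case: hV. Qed.

Lemma commutant_trV x : Q x -> Q (trV V x).
Proof.
case: hV => _ _ _ _ -> [X _ <-]; exists (fun j => (X j)^T) => //.
rewrite /trV !mulmxA VV' mul1mx -(mulmxA _ (V^t*)) VV' mulmx1 tr_mxdiag.
congr (_ *m _ *m _); apply/eq_mxdiag => j.
by rewrite trmx_tens trmx1.
Qed.

Notation munit := (munit (nn := nn) (mm := mm) V).
Notation coiso := (coiso (nn := nn) (mm := mm) V).

(** An automorphism of the commutant that preserves the trace is unitarily
    implemented: it carries minimal projections to projections of the same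
    rank, and the partial isometries between them extend along matrix units. *)
Lemma star_auto_spatial t : star_auto Q t ->
  (forall x, Q x -> ntr (t x) = ntr x) ->
  exists2 u, u \is unitarymx & forall x, Q x -> t x = u *m x *m u^t*.
Proof.
move=> [tl tQ tM ta _] tt.
have mQ j (b c : 'I_(mm j)) : Q (munit b c) by exact: munit_in.
have hm j : (0 < mm j)%N by case: hV => _ _ /(_ j)/andP[].
pose b0 j := Ordinal (hm j).
have tr_n (x : 'M[C]_n) : \tr x = n%:R * ntr x.
  by rewrite /ntr mulrC divfK // pnatr_eq0 -lt0n.
have hW j : exists W : 'M[C]_(n, nn j * 1),
    t (munit (b0 j) (b0 j)) *m W = W /\ W^t* *m W = 1%:M.
  apply: proj_isometry.
  - by rewrite -ta // munit_adj.
  - by rewrite -tM // (munitM hV) eqxx scale1r.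
  - rewrite tr_n tt // (ntr_munit hV) eqxx mul1r mulrC divfK ?muln1 //.
    by rewrite pnatr_eq0 -lt0n.
have [W {}hW] := fin_all_exists hW.
have t0 : t 0 = 0. exact: (linear_on0 hQ tl).
pose X j b := t (munit b (b0 j)) *m W j.
have XX j b c : (X j b)^t* *m X j c = (b == c)%:R%:M.
  rewrite /X adjM mulmxA -(mulmxA _ _ (t _)) -ta // munit_adj -tM // (munitM hV).
  have [_|_] := eqVneq b c; last by rewrite scale0r t0 mulmx0 mul0mx raddf0.
  by rewrite scale1r -mulmxA; case: (hW j) => -> ->.
have XX0 i j b c : i != j -> (X i b)^t* *m X j c = 0.
  move=> ij; rewrite /X adjM mulmxA -(mulmxA _ _ (t _)) -ta // munit_adj -tM //.
  by rewrite (munitM_neq hV) // t0 mulmx0 mul0mx.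
pose u := \sum_j \sum_b X j b *m coiso b.
have uu : u^t* *m u = 1%:M.
  have uX j b : u^t* *m X j b = (coiso b)^t*.
    rewrite /u adj_sum mulmx_suml (bigD1 j) //= [X in _ + X]big1 ?addr0 => [|i ij].
      rewrite adj_sum mulmx_suml (bigD1 b) //= [X in _ + X]big1 ?addr0 => [|c cb].
        by rewrite adjM -mulmxA XX eqxx mulmx1.
      by rewrite adjM -mulmxA XX (negPf cb) raddf0 mulmx0.
    rewrite adj_sum mulmx_suml big1 // => c _.
    by rewrite adjM -mulmxA XX0 // mulmx0.
  rewrite -(munit_sum hV) /u mulmx_sumr; apply: eq_bigr => j _.
  rewrite mulmx_sumr; apply: eq_bigr => b _.
  by rewrite mulmxA uX.
have uunit j b c : u *m munit b c = X j b *m coiso c.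
  rewrite /u mulmx_suml (bigD1 j) //= [X in _ + X]big1 ?addr0 => [|i ij].
    rewrite mulmx_suml (bigD1 b) //= [X in _ + X]big1 ?addr0 => [|a ab].
      by rewrite -mulmxA (coiso_munit hV) eqxx scale1r.
    by rewrite -mulmxA (coiso_munit hV) (negPf ab) scale0r mulmx0.
  rewrite mulmx_suml big1 // => a _.
  by rewrite -mulmxA (coiso_munit_neq hV) // mulmx0.
have unitu j b c : t (munit b c) *m u = X j b *m coiso c.
  rewrite /u mulmx_sumr (bigD1 j) //= [X in _ + X]big1 ?addr0 => [|i ij].
    rewrite mulmx_sumr (bigD1 c) //= [X in _ + X]big1 ?addr0 => [|a ac].
      by rewrite !mulmxA -tM // (munitM hV) eqxx scale1r.
    by rewrite !mulmxA -tM // (munitM hV) eq_sym (negPf ac) scale0r t0 !mul0mx.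
  rewrite mulmx_sumr big1 // => a _.
  by rewrite !mulmxA -tM // (munitM_neq hV) 1?eq_sym // t0 !mul0mx.
have hu := unitaryP uu; exists u => // x hx.
suff e : t x *m u = u *m x by rewrite -e -mulmxA unitary_adjr // mulmx1.
have [a ->] := munitL_span hV hx.
rewrite (linear_on_sum hQ a tl (munitL_in hV)) mulmx_suml mulmx_sumr.
apply: eq_bigr => l _; rewrite -scalemxAl -scalemxAr; congr (_ *: _).
by rewrite /munitL unitu uunit.
Qed.

End Blocks.

(** * Jones projections and the Markov condition *)

Section Generated.
Variables (C : numClosedFieldType) (m : nat) (S : set 'M[C]_m).

Lemma gen_sub x : S x -> star_alg_gen S x.
Proof. by move=> hx A [_]; apply. Qed.

Lemma gen_min (A : set 'M[C]_m) x :
  star_alg A -> (forall y, S y -> A y) -> star_alg_gen S x -> A x.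
Proof. by move=> hA hS; apply. Qed.

Lemma gen_star_alg : star_alg (star_alg_gen S).
Proof.
split=> [A [hA _]|x y hx hy A hAS|a x hx A hAS|x y hx hy A hAS|x hx A hAS].
- by case: hA.
- by have [[_ h _ _ _] _] := hAS; apply: h; [exact: hx | exact: hy].
- by have [[_ _ h _ _] _] := hAS; apply: h; exact: hx.
- by have [[_ _ _ h _] _] := hAS; apply: h; [exact: hx | exact: hy].
- by have [[_ _ _ _ h] _] := hAS; apply: h; exact: hx.
Qed.

Lemma ortho_proj_unique (T : set 'cV[C]_m) P P' :
  ortho_proj T P -> ortho_proj T P' -> P = P'.
Proof.
move=> [h1 h2 h3] [k1 k2 k3].
have key (A B : 'M[C]_m) : A *m A = A ->
    (forall v, exists w, B *m v = A *m w :> 'cV[C]_m) -> A *m B = B.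
  move=> hA hB; apply/matrixP=> i j; have [w e] := hB (delta_mx j 0).
  have : A *m B *m delta_mx j 0 = B *m delta_mx j 0 :> 'cV[C]_m.
    by rewrite -mulmxA e mulmxA hA.
  by rewrite -!colE => /matrixP/(_ i 0); rewrite !mxE.
have e1 : P *m P' = P'.
  apply: key => // v; have : T (P' *m v) by rewrite -k3; exists v.
  by rewrite -h3 => -[w _ <-]; exists w.
have e2 : P' *m P = P.
  apply: key => // v; have : T (P *m v) by rewrite -h3; exists v.
  by rewrite -k3 => -[w _ <-]; exists w.
by rewrite -e2 -{1}h1 -{1}k1 -adjM e1.
Qed.

End Generated.

Section JonesProjection.
Variables (C : numClosedFieldType) (n p : nat) (V : 'M[C]_(n, p)).
Hypotheses (n0 : (0 < n)%N) (VV : V *m V^t* = 1%:M) (VV' : V^t* *m V = 1%:M).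

(** The vectors [Lam V x] exhaust the space, so a projection may be tested on
    them. *)
Lemma jones_projP (A : set 'M[C]_n) (e : 'M[C]_(n * n)) : e^t* = e ->
  (forall x, A x -> e *m Lam V x = Lam V x) ->
  (forall x, exists2 y, A y & e *m Lam V x = Lam V y) -> jones_proj V A e.
Proof.
move=> eA h1 h2; split=> //.
  apply: (Lam_ext n0 VV VV') => x; have [y hy ey] := h2 x.
  by rewrite -mulmxA ey h1.
apply/seteqP; split=> w /=.
  by move=> [v _ <-]; have [x ->] := Lam_surj n0 VV VV' v; have [y hy ->] := h2 x; exists y.
by move=> [y hy <-]; exists (Lam V y) => //; exact: h1.
Qed.

Lemma jones_scalars : jones_proj V [set c%:M | c in [set: C]] (psi V *m (psi V)^t*).
Proof.
have e x : psi V *m (psi V)^t* *m Lam V x = Lam V (ntr x)%:M.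
  rewrite -mulmxA -Lam1 (Lam_form VV VV') adj1 mul1mx mul_mx_scalar -LamZ.
  by rewrite scalemx1.
apply: jones_projP.
- by rewrite adjM trmxCK.
- by move=> x [c _ <-]; rewrite e (_ : ntr c%:M = c) // -scalemx1 ntrZ ntr1 // mulr1.
- by move=> x; exists (ntr x)%:M; rewrite ?e //; exists (ntr x).
Qed.

(** On the GNS space this sum acts as averaging over the basis, which is the
    conditional expectation onto [N]. *)
Lemma jones_commutant D (Q N : set 'M[C]_n) (g : 'I_D -> 'M[C]_n) eN :
  markov_basis Q g -> commutant Q = N -> jones_proj V N eN ->
  eN = D%:R^-1 *: \sum_l g l *t trV V ((g l)^t*).
Proof.
move=> hg hN heN; apply: (ortho_proj_unique heN).
set e := _ *: _.
have eL x : e *m Lam V x = Lam V (avg g x).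
  rewrite /e /avg LamZ Lam_sum -scalemxAl mulmx_suml; congr (_ *: _).
  by apply: eq_bigr => l _; rewrite (Lam_tens VV VV') (trVK VV VV').
have eL' x : e^t* *m Lam V x = Lam V (avg g x).
  rewrite (avg_sym hg) /e adjZ fmorphV rmorph_nat adj_sum LamZ Lam_sum -scalemxAl mulmx_suml.
  congr (_ *: _); apply: eq_bigr => l _.
  by rewrite adj_tens -(trV_adj VV VV') trmxCK (Lam_tens VV VV') (trVK VV VV').
apply: jones_projP.
- by apply: (Lam_ext n0 VV VV') => x; rewrite eL eL'.
- by move=> x; rewrite -hN => hx; rewrite eL (avg_commutant n0 hg).
- by move=> x; exists (avg g x) => //; rewrite -hN; exact: (avg_comm hg).
Qed.

End JonesProjection.

Section Markov.
Variables (C : numClosedFieldType) (n k : nat) (nn mm : 'I_k -> nat).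
Variable (V : 'M[C]_(n, \sum_(j < k) nn j * mm j)).
Variable (N : set 'M[C]_n).
Hypotheses (n0 : (0 < n)%N) (hV : block_basis V N) (hN : unital_star_alg N).
Local Notation Q := (commutant N).

Let VV : V *m V^t* = 1%:M. Proof. by case: hV. Qed.
Let VV' : V^t* *m V = 1%:M. Proof. by case: hV. Qed.
Let hQ : unital_star_alg Q.
Proof. by apply: commutant_usa => x; exact: (usa_adj hN). Qed.

Definition unit_index : finType := {j : 'I_k & ('I_(mm j) * 'I_(mm j))%type}.
Local Notation L := unit_index.
Local Notation f := (@munitL _ _ _ nn mm V).

Local Notation pairL j bc := (@Tagged _ j (fun j => ('I_(mm j) * 'I_(mm j))%type) bc).

Lemma sum_unit_index (U : nmodType) (F : L -> U) :
  \sum_l F l = \sum_j \sum_(b < mm j) \sum_(c < mm j)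
    F (pairL j (b, c)).
Proof.
rewrite (eq_bigr (fun j => \sum_(bc : 'I_(mm j) * 'I_(mm j))
  F (pairL j bc))).
  by rewrite sig_big_dep; apply: eq_bigr => -[j bc].
by move=> j _; rewrite pair_bigA; apply: eq_bigr => -[].
Qed.

Lemma bicommutant : commutant Q = N.
Proof.
apply/seteqP; split=> x hx.
  by apply: (bicommutant_block hV) => j b c; rewrite (hx _ (munit_in hV b c)).
by move=> y hy; rewrite hy.
Qed.

Let nj_neq0 j : (nn j)%:R != 0 :> C.
Proof. by case: hV => _ _ /(_ j)/andP[h _] _ _; rewrite pnatr_eq0 -lt0n. Qed.
Let mj_neq0 j : (mm j)%:R != 0 :> C.
Proof. by case: hV => _ _ /(_ j)/andP[_ h] _ _; rewrite pnatr_eq0 -lt0n. Qed.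
Let n_neq0 : n%:R != 0 :> C. Proof. by rewrite pnatr_eq0 -lt0n. Qed.

Let w (l : L) : C := n%:R / (nn (tag l))%:R.

Lemma unit_expand x : Q x -> x = \sum_l (w l * ntr ((f l)^t* *m x)) *: f l.
Proof.
move=> hx; have [a ex] := munitL_span hV hx; rewrite {1}ex; apply: eq_bigr => l _.
congr (_ *: _); rewrite ex mulmx_sumr ntr_sum (bigD1 l) //= big1 ?addr0.
  rewrite -scalemxAr ntrZ (munitL_orth hV) eqxx mul1r /w.
  by field; rewrite n_neq0 nj_neq0.
by move=> i il; rewrite -scalemxAr ntrZ (munitL_orth hV) eq_sym (negPf il) mul0r mulr0.
Qed.

Let eC := psi V *m (psi V)^t*.
Let eQ := \sum_l w l *: ((f l *t 1%:M) *m eC *m ((f l)^t* *t 1%:M)).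

(** The image of the rank-one projection onto the canonical vector under the
    matrix units, weighted to make them orthonormal. *)
Lemma jones_block : jones_proj V Q eQ.
Proof.
have e x : eQ *m Lam V x = Lam V (\sum_l (w l * ntr ((f l)^t* *m x)) *: f l).
  rewrite /eQ mulmx_suml Lam_sum; apply: eq_bigr => l _.
  rewrite -scalemxAl -!mulmxA LamM /eC -Lam1 (Lam_form VV VV') adj1 mul1mx.
  by rewrite mul_mx_scalar -scalemxAr LamM mulmx1 scalerA LamZ.
apply: (jones_projP n0 VV VV').
- rewrite /eQ adj_sum; apply: eq_bigr => l _.
  move: (f l) => z; rewrite adjZ /eC !adjM !adj_tens !adj1 !trmxCK !mulmxA /w.
  by rewrite fmorph_div !rmorph_nat.
- by move=> x hx; rewrite e -unit_expand.
- move=> x; eexists; last exact: e.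
  by apply: (usa_sum hQ) => l _; apply/(usaZ hQ)/(munitL_in hV).
Qed.

(** In the basic construction of the scalars in the commutant, a minimal
    projection of block [j] has trace [mm j] and the unit has trace the dimension
    of the commutant; the Markov property says that their ratio is the normalised
    trace [nn j / n]. *)
Lemma markov_dims j :
  markov_trace V [set c%:M | c in [set: C]] Q ->
  (mm j)%:R * n%:R = #|{: L}|%:R * (nn j)%:R :> C.
Proof.
move=> [eP [eQ' [tr1]]] /= [hP hQ' [tl _ _] tx tm].
have eC' : eP = eC by exact: (ortho_proj_unique hP (jones_scalars n0 VV VV')).
have eQE : eQ' = eQ by exact: (ortho_proj_unique hQ' jones_block).
subst eP eQ'; move: tl tx tm; set Q1 := star_alg_gen _ => tl tx tm.
have Q1alg : star_alg Q1 by exact: gen_star_alg.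
have hQfix x : Q x -> eQ *m Lam V x = Lam V x.
  move=> hx; case: jones_block => _ ee im.
  have : (Lam V @` Q) (Lam V x) by exists x.
  by rewrite -im => -[w' _ <-]; rewrite mulmxA ee.
have eQA : eQ^t* = eQ by case: jones_block.
have hin x y : Q x -> Q y -> Q1 ((x *t 1%:M) *m eC *m (y *t 1%:M)).
  move=> hx hy.
  have -> : (x *t 1%:M) *m eC *m (y *t 1%:M) =
      ((x *t 1%:M) *m eQ) *m eC *m ((y *t 1%:M) *m eQ).
    have e1 : eQ *m psi V = psi V by rewrite -Lam1 hQfix //; exact: (usa1 hQ).
    have e2 : (psi V)^t* *m (y *t 1%:M) *m eQ = (psi V)^t* *m (y *t 1%:M).
      have e3 : (eQ *m Lam V (y^t*))^t* = (Lam V (y^t*))^t*.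
        by rewrite hQfix //; exact: (usa_adj hQ).
      have e4 : (Lam V (y^t*))^t* = (psi V)^t* *m (y *t 1%:M).
        by rewrite /Lam adjM adj_tens adj1 trmxCK.
      by move: e3; rewrite adjM eQA e4.
    rewrite /eC !mulmxA -(mulmxA _ eQ) e1 -!mulmxA; congr (_ *m (_ *m _)).
    by rewrite mulmxA e2.
  case: Q1alg => [_ _ _ hM _]; apply: (hM); first apply: (hM).
  - by apply: gen_sub; left; exists x.
  - by apply: gen_sub; right.
  - by apply: gen_sub; left; exists y.
have tr1_sum (I : finType) (a : I -> C) (X : I -> 'M[C]_(n * n)) :
    (forall i, Q1 (X i)) -> tr1 (\sum_i a i *: X i) = \sum_i a i * tr1 (X i).
  case: Q1alg => [q0 qD qZ _ _] hX.
  have t0 : tr1 0 = 0.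
    by have := tl (-1) 0 0 q0 q0; rewrite scaler0 addr0 mulN1r addNr.
  suff [_ ->] : Q1 (\sum_i a i *: X i) /\ tr1 (\sum_i a i *: X i) = \sum_i a i * tr1 (X i) by [].
  apply: (big_rec2 (fun y z => Q1 y /\ tr1 y = z)) => [|i z y _ [hy <-]]; first by [].
  by split; [apply: qD => //; exact: qZ | rewrite tl].
have val x : Q x -> tr1 ((x *t 1%:M) *m eQ) = \sum_l w l * ntr (x *m f l *m (f l)^t*).
  move=> hx; rewrite /eQ mulmx_sumr.
  rewrite (eq_bigr (fun l => w l *: (((x *m f l) *t 1%:M) *m eC *m ((f l)^t* *t 1%:M)))).
    rewrite tr1_sum => [|l].
      apply: eq_bigr => l _; rewrite tx //; first by apply: (usaM hQ) => //; exact: (munitL_in hV).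
      by apply: (usa_adj hQ); exact: (munitL_in hV).
    apply: hin; first by apply: (usaM hQ) => //; exact: (munitL_in hV).
    by apply: (usa_adj hQ); exact: (munitL_in hV).
  move=> l _; move: (f l) => z; rewrite -scalemxAr; congr (_ *: _).
  have <- : (x *t 1%:M) *m (z *t 1%:M) = (x *m z) *t (1%:M : 'M_n).
    by rewrite (tensmx_mul x 1%:M z 1%:M) mulmx1.
  by rewrite !mulmxA.
have hm : (0 < mm j)%N by case: hV => _ _ /(_ j)/andP[].
pose b0 : 'I_(mm j) := Ordinal hm.
have tr_block x i : Q x -> \sum_(b < mm i) \sum_(c < mm i)
    w (pairL i (b, c)) * ntr (x *m f (pairL i (b, c)) *m (f (pairL i (b, c)))^t*) =
    (mm i)%:R * (n%:R / (nn i)%:R * \sum_(b < mm i) ntr (x *m munit V b b)).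
  move=> hx; rewrite !mulr_sumr; apply: eq_bigr => b _.
  rewrite (eq_bigr (fun => n%:R / (nn i)%:R * ntr (x *m munit V b b))) => [|c _].
    by rewrite sumr_const card_ord [RHS]mulr_natl.
  by rewrite /munitL /= munit_adj -mulmxA (munitM hV) eqxx scale1r.
have cL : #|{: L}|%:R = \sum_i (mm i)%:R * (mm i)%:R :> C.
  rewrite -sum1_card natr_sum sum_unit_index; apply: eq_bigr => i _.
  by rewrite !sumr_const !card_ord mulr1n -mulrnA -natrM.
have v1 : tr1 eQ = #|{: L}|%:R.
  have := val _ (usa1 hQ); rewrite tens11 mul1mx => ->.
  rewrite cL sum_unit_index; apply: eq_bigr => i _.
  rewrite (tr_block _ _ (usa1 hQ)); congr (_ * _).
  rewrite (eq_bigr (fun => (nn i)%:R / n%:R)) => [|b _].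
    rewrite sumr_const card_ord -mulr_natl.
    by field; rewrite n_neq0 nj_neq0.
  by rewrite mul1mx (ntr_munit hV) eqxx mul1r.
have hb := munit_in hV b0 b0.
have v2 : tr1 ((munit V b0 b0 *t 1%:M) *m eQ) = (mm j)%:R.
  rewrite val // sum_unit_index (bigD1 j) //= [X in _ + X]big1 ?addr0 => [|i ij].
    rewrite tr_block // (bigD1 b0) //= [X in _ + X]big1 ?addr0 => [|b bb].
      rewrite (munitM hV) eqxx scale1r (ntr_munit hV) eqxx mul1r.
      by field; rewrite n_neq0 nj_neq0.
    by rewrite (munitM hV) eq_sym (negPf bb) scale0r ntr0.
  rewrite tr_block // big1 ?mulr0 // => b _.
  by rewrite (munitM_neq hV) ?ntr0 // eq_sym.
have := tm _ hb; rewrite v1 v2 (ntr_munit hV) eqxx mul1r => e.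
have L0 : #|{: L}|%:R != 0 :> C.
  apply/eqP => l0; move: e; rewrite l0 invr0 mul0r => /eqP.
  by rewrite eq_sym mulf_eq0 invr_eq0 (negPf n_neq0) (negPf (nj_neq0 j)).
have -> : (mm j)%:R = #|{: L}|%:R * ((nn j)%:R / n%:R) :> C by rewrite -e mulVKf.
by rewrite -mulrA divfK.
Qed.

Definition unit_basis (i : 'I_#|{: L}|) : 'M[C]_n :=
  let l := enum_val i in sqrtC (#|{: L}|%:R / (mm (tag l))%:R) *: f l.

Lemma sum_enum_val (U : nmodType) (T : finType) (F : T -> U) :
  \sum_(i < #|{: T}|) F (enum_val i) = \sum_x F x.
Proof. by rewrite [RHS](reindex _ (onW_bij _ (@enum_val_bij T))). Qed.

Lemma unit_markov_basis :
  markov_trace V [set c%:M | c in [set: C]] Q -> markov_basis Q unit_basis.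
Proof.
move=> hm; pose D : C := #|{: L}|%:R.
have hd j := markov_dims j hm.
pose s (l : L) : C := sqrtC (D / (mm (tag l))%:R).
have sR l : (s l)^* = s l.
  by rewrite conj_Creal // ger0_real // sqrtC_ge0 divr_ge0 // ler0n.
have ss l : s l * s l = D / (mm (tag l))%:R by rewrite -expr2 sqrtCK.
have D0 (i : 'I_#|{: L}|) : D != 0.
  by rewrite pnatr_eq0 -lt0n; apply: leq_ltn_trans (ltn_ord i).
have nn_eq (i : 'I_#|{: L}|) j : (nn j)%:R = (mm j)%:R * n%:R / D.
  by rewrite hd mulrAC divff ?mul1r // (D0 i).
have gE i : unit_basis i = s (enum_val i) *: f (enum_val i) by [].
split=> //.
- by move=> i; rewrite gE; apply/(usaZ hQ)/(munitL_in hV).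
- move=> i j; rewrite !gE adjZ sR -scalemxAl -scalemxAr !ntrZ (munitL_orth hV).
  rewrite (inj_eq enum_val_inj); have [->|_] := eqVneq i j; last by rewrite !mul0r !mulr0.
  rewrite mul1r mulrA ss (nn_eq j) mulr1n.
  by field; rewrite n_neq0 mj_neq0 (D0 j).
- move=> x hx; rewrite {1}(unit_expand hx) -sum_enum_val; apply: eq_bigr => i _.
  rewrite gE adjZ sR -scalemxAl ntrZ scalerA [in RHS]mulrAC ss /w (nn_eq i); congr (_ *: _).
  by congr (_ * _); field; rewrite n_neq0 mj_neq0 (D0 i).
- transitivity (\sum_l (D / (mm (tag l))%:R) *: ((f l)^t* *m f l)).
    rewrite -[RHS]sum_enum_val; apply: eq_bigr => i _.
    by rewrite gE adjZ sR -scalemxAl -scalemxAr scalerA ss.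
  rewrite sum_unit_index -scalemx1 -(munit_sum hV) scaler_sumr; apply: eq_bigr => j _.
  rewrite exchange_big /= scaler_sumr; apply: eq_bigr => c _.
  rewrite (eq_bigr (fun => (D / (mm j)%:R) *: munit V c c)) => [|b _].
    rewrite sumr_const card_ord -scaler_nat scalerA; congr (_ *: _).
    by rewrite mulrC divfK.
  by rewrite munit_adj (munitM hV) eqxx scale1r.
Qed.

End Markov.

(** * Two-positivity and spans of elementary tensors *)

Section BlockPositivity.
Variables (C : numClosedFieldType) (m k : nat).
Implicit Type X : 'I_k -> 'I_k -> 'M[C]_m.

Lemma mxblock_form X (v : 'I_k -> 'cV[C]_m) :
  psd (\mxblock_(i < k, j < k) X i j) ->
  0 <= (\sum_i \sum_j (v i)^t* *m X i j *m v j) 0 0.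
Proof.
move/(_ (\mxcol_i v i)).
rewrite (_ : (\mxcol_i v i)^t* = \mxrow_i (v i)^t*); last first.
  by apply/matrixP=> a b; rewrite !mxE.
rewrite mul_mxrow_mxblock mul_mxrow_mxcol exchange_big /=.
by under [in X in _ -> X]eq_bigr => j _ do rewrite -mulmx_suml.
Qed.

Lemma mxblock_psd_adj X i j :
  psd (\mxblock_(i < k, j < k) X i j) -> (X i j)^t* = X j i.
Proof.
move/psd_herm.
have -> : (\mxblock_(i < k, j < k) X i j)^t* = \mxblock_(i < k, j < k) (X j i)^t*.
  by apply/matrixP=> a b; rewrite !mxE.
by move/eq_mxblockP/(_ j i).
Qed.

Lemma mxblock_gram_psd (a : 'I_k -> 'M[C]_m) :
  psd (\mxblock_(i < k, j < k) ((a i)^t* *m a j)).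
Proof.
rewrite -mul_mxcol_mxrow (_ : \mxcol_i (a i)^t* = (\mxrow_i a i)^t*).
  exact: psd_adjM.
by apply/matrixP=> i j; rewrite !mxE.
Qed.

End BlockPositivity.

(** The block matrix of the [Phi (a_i^* a_j)] with [a = (x, 1)] is positive; its
    form at the vector [(w, - Phi x w)] is the defect of the inequality at [w]. *)
Lemma ucp_kadison_schwarz (C : numClosedFieldType) m (R : set 'M[C]_m) Phi x :
  star_alg R -> R 1%:M -> ucp R Phi -> R x ->
  Phi (x^t*) = (Phi x)^t* /\ psd (Phi (x^t* *m x) - (Phi x)^t* *m Phi x).
Proof.
move=> [_ _ _ hM hA] h1 [[_ _ hcp] P1] hx.
pose a (i : 'I_2) := if i == 0 then x else 1%:M.
have ha i : R (a i) by rewrite /a; case: ifP.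
have hpos : psd (\mxblock_(i < 2, j < 2) Phi ((a i)^t* *m a j)).
  apply: hcp; last exact: mxblock_gram_psd.
  by move=> i j; apply: hM; [exact: hA | exact: ha].
have e10 : Phi (x^t*) = (Phi x)^t*.
  have := mxblock_psd_adj (X := fun i j => Phi ((a i)^t* *m a j)) 1 0 hpos.
  by rewrite /a /= adj1 mul1mx mulmx1.
split=> // w; pose v (i : 'I_2) := if i == 0 then w else - (Phi x *m w).
have := mxblock_form v hpos.
rewrite !big_ord_recl !big_ord0 !addr0 /v /a /= adj1 !mul1mx !mulmx1 P1 e10.
rewrite adjN adjM !(mulmxN, mulNmx) opprK !mulmxA mulmx1 addNr addr0.
by rewrite mulmxBr mulmxBl !mulmxA.
Qed.

Section DoubleAnnihilator.
Variables (C : numClosedFieldType) (n : nat) (Q : set 'M[C]_n).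
Hypothesis hQ : unital_star_alg Q.

(** The span of the elementary tensors of an algebra, described as a double
    annihilator for the trace pairing: membership is then tested, and equality
    decided, by expectations of elementary tensors. *)
Definition tens_span : set 'M[C]_(n * n) :=
  [set X | forall Y, (forall a b, Q a -> Q b -> ntr (Y *m (a *t b)) = 0) ->
    ntr (Y *m X) = 0].

Lemma tens_span_tens a b : Q a -> Q b -> tens_span (a *t b).
Proof. by move=> ha hb Y; apply. Qed.

Lemma tens_span_star_alg : star_alg tens_span.
Proof.
have tM (a b c d : 'M[C]_n) : (a *t b) *m (c *t d) = (a *m c) *t (b *m d).
  exact: tensmx_mul.
split=> [Y _|X Y hX hY Z hZ|c X hX Z hZ|X Y hX hY Z hZ|X hX Z hZ].
- by rewrite mulmx0 ntr0.
- by rewrite mulmxDr ntrD hX // hY // addr0.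
- by rewrite -scalemxAr ntrZ hX // mulr0.
- rewrite mulmxA; apply: hY => a b ha hb.
  rewrite -mulmxA ntrC -mulmxA ntrC; apply: hX => c d hc hd.
  by rewrite -mulmxA ntrC -mulmxA tM hZ //; exact: usaM.
- rewrite -[LHS]conjCK -ntr_adj adjM trmxCK ntrC hX ?rmorph0 // => a b ha hb.
  rewrite -[LHS]conjCK -ntr_adj adjM trmxCK adj_tens ntrC hZ ?rmorph0 //; exact: usa_adj.
Qed.

Lemma tens_span_eq X Y : tens_span X -> tens_span Y ->
  (forall a b, Q a -> Q b -> ntr (X *m (a *t b)) = ntr (Y *m (a *t b))) -> X = Y.
Proof.
move=> hX hY h; case: tens_span_star_alg => _ hD hZ _ _.
have hB : tens_span (X - Y) by rewrite -scaleN1r; apply: hD => //; exact: hZ.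
apply/eqP; rewrite -subr_eq0; apply/eqP/ntr_adjM_eq0; apply: hB => a b ha hb.
rewrite -[LHS]conjCK -ntr_adj adjM trmxCK adj_tens ntrC mulmxBl ntrB h ?subrr ?rmorph0 //.
  exact: usa_adj.
exact: usa_adj.
Qed.

(** The slice commutes with [N], because [y b - b y] is annihilated by the trace
    against [Q] when [y] is in [N], and the commutant of [N] is [Q]. *)
Lemma tens_span_slice N X p c : Q = commutant N -> tens_span X ->
  (forall b, ntr (X *m (b *t c)) = ntr (p *m b)) -> Q p.
Proof.
move=> hN hX hp; rewrite hN => y hy; apply/eqP; rewrite -subr_eq0; apply/eqP.
apply: ntr_nondeg => b.
have -> : ntr ((y *m p - p *m y) *m b) = ntr (p *m (b *m y - y *m b)).
  by rewrite mulmxBl mulmxBr !ntrB -!mulmxA ntrC -!mulmxA.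
rewrite -hp ntrC; apply: hX => a d ha hd.
have -> : ((b *m y - y *m b) *t c) *m (a *t d) = ((b *m y - y *m b) *m a) *t (c *m d).
  exact: tensmx_mul.
rewrite ntr_tens mulmxBl ntrB -!mulmxA [X in _ - X]ntrC.
by move: ha; rewrite hN => /(_ y hy) e; rewrite -!mulmxA e subrr mul0r.
Qed.

End DoubleAnnihilator.

(** * The legs of the triple tensor product *)

Section Cast.
Variables (C : numClosedFieldType) (m m' : nat) (e : m = m').
Local Notation cst := (castmx (e, e)).

Lemma cast_sqM (X Y : 'M[C]_m) : cst (X *m Y) = cst X *m cst Y.
Proof. by case: m' / e; rewrite !castmx_id. Qed.
Lemma cast_sqD (X Y : 'M[C]_m) : cst (X + Y) = cst X + cst Y.
Proof. by case: m' / e; rewrite !castmx_id. Qed.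
Lemma cast_sqZ c (X : 'M[C]_m) : cst (c *: X) = c *: cst X.
Proof. by case: m' / e; rewrite !castmx_id. Qed.
Lemma cast_sq_adj (X : 'M[C]_m) : cst (X^t*) = (cst X)^t*.
Proof. by case: m' / e; rewrite !castmx_id. Qed.
Lemma cast_sq_ntr (X : 'M[C]_m) : ntr (cst X) = ntr X.
Proof. by case: m' / e; rewrite castmx_id. Qed.
Lemma cast_sq_psd (X : 'M[C]_m) : psd (cst X) -> psd X.
Proof. by case: m' / e; rewrite castmx_id. Qed.
End Cast.

Section Legs.
Variables (C : numClosedFieldType) (n : nat) (n0 : (0 < n)%N).

Lemma tens_psd_l m q (X : 'M[C]_m) : (0 < q)%N -> psd (X *t (1%:M : 'M_q)) -> psd X.
Proof.
move=> q0 h v; pose e : 'cV[C]_q := delta_mx (Ordinal q0) 0.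
have ee : e^t* *m e = 1%:M.
  by rewrite trmx_delta map_delta_mx mul_delta_mx; apply/matrixP=> i j; rewrite !mxE !ord1.
have := h (v *t e : 'cV_(m * q)).
have -> : (v *t e : 'cV_(m * q))^t* *m (X *t 1%:M) *m (v *t e : 'cV_(m * q)) =
   (v^t* *m X *m v) *t (1%:M : 'M_1).
  transitivity ((v^t* *t e^t*) *m (X *t 1%:M) *m (v *t e) : 'M[C]_1).
    exact: (congr1 (fun M => M *m _ *m _) (adj_tens v e)).
  by rewrite (tensmx_mul (v^t*) (e^t*) X 1%:M) mulmx1 (tensmx_mul _ (e^t*) v e) ee.
by rewrite !mxE !ord1 /= mulr1.
Qed.

Lemma tens_psd_r m q (X : 'M[C]_m) : (0 < q)%N -> psd ((1%:M : 'M_q) *t X) -> psd X.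
Proof.
move=> q0 h v; pose e : 'cV[C]_q := delta_mx (Ordinal q0) 0.
have ee : e^t* *m e = 1%:M.
  by rewrite trmx_delta map_delta_mx mul_delta_mx; apply/matrixP=> i j; rewrite !mxE !ord1.
have := h (e *t v : 'cV_(q * m)).
have -> : (e *t v : 'cV_(q * m))^t* *m (1%:M *t X) *m (e *t v : 'cV_(q * m)) =
   (1%:M : 'M_1) *t (v^t* *m X *m v).
  transitivity ((e^t* *t v^t*) *m (1%:M *t X) *m (e *t v) : 'M[C]_1).
    exact: (congr1 (fun M => M *m _ *m _) (adj_tens e v)).
  by rewrite (tensmx_mul (e^t*) (v^t*) 1%:M X) mulmx1 (tensmx_mul (e^t*) _ e v) ee.
by rewrite !mxE !ord1 /= mul1r.
Qed.

Implicit Types (x y a b : 'M[C]_n) (X Y : 'M[C]_(n * n)).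

Lemma in12M X Y : in12 (X *m Y) = in12 X *m in12 Y.
Proof. by rewrite /in12 (tensmx_mul X 1%:M Y 1%:M) mulmx1. Qed.
Lemma in12D X Y : in12 (X + Y) = in12 X + in12 Y.
Proof. exact: tensDl. Qed.
Lemma in12Z c X : in12 (c *: X) = c *: in12 X.
Proof. exact: tensZl. Qed.
Lemma in12_adj X : in12 (X^t*) = (in12 X)^t*.
Proof. by rewrite /in12 adj_tens adj1. Qed.
Lemma in12_1 : in12 1%:M = 1%:M :> 'M[C]_(n * n * n).
Proof. exact: tens11. Qed.
Lemma in12_sum (I : Type) (r : seq I) (P : pred I) (F : I -> 'M[C]_(n * n)) :
  in12 (\sum_(i <- r | P i) F i) = \sum_(i <- r | P i) in12 (F i).
Proof. exact: tens_suml. Qed.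
Lemma in12_psd X : psd (in12 X) -> psd X.
Proof. exact: tens_psd_l. Qed.
Lemma ntr_in12 X : ntr (in12 X) = ntr X.
Proof. by rewrite ntr_tens ntr1 // mulr1. Qed.

Lemma in12_inj : injective (@in12 C n).
Proof.
move=> X Y h; apply/matrixP=> i j; pose c := Ordinal n0.
move/matrixP: h => /(_ (mxtens_index (i, c)) (mxtens_index (j, c))).
by rewrite /in12 !tensmxE !mxE eqxx !mulr1.
Qed.

Lemma in23M X Y : in23 (X *m Y) = in23 X *m in23 Y.
Proof. by rewrite /in23 -cast_sqM (tensmx_mul 1%:M X 1%:M Y) mulmx1. Qed.
Lemma in23D X Y : in23 (X + Y) = in23 X + in23 Y.
Proof. by rewrite /in23 tensDr cast_sqD. Qed.
Lemma in23Z c X : in23 (c *: X) = c *: in23 X.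
Proof. by rewrite /in23 tensZr cast_sqZ. Qed.
Lemma in23_adj X : in23 (X^t*) = (in23 X)^t*.
Proof. by rewrite /in23 -cast_sq_adj adj_tens adj1. Qed.
Lemma in23_psd X : psd (in23 X) -> psd X.
Proof. by move/cast_sq_psd; exact: tens_psd_r. Qed.
Lemma ntr_in23 X : ntr (in23 X) = ntr X.
Proof. by rewrite cast_sq_ntr ntr_tens ntr1 // mul1r. Qed.

Lemma in1E x : in1 x = in12 (x *t 1%:M). Proof. by []. Qed.
Lemma in2E x : in2 x = in12 (1%:M *t x). Proof. by []. Qed.
Lemma in2E' x : in2 x = in23 (x *t 1%:M). Proof. by rewrite in23_tens. Qed.
Lemma in3E x : in3 x = in23 (1%:M *t x). Proof. by rewrite in23_tens. Qed.

Lemma in1M x y : in1 (x *m y) = in1 x *m in1 y.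
Proof. by rewrite !in1E -in12M (tensmx_mul x 1%:M y 1%:M) mulmx1. Qed.
Lemma in1_1 : in1 1%:M = 1%:M :> 'M[C]_(n * n * n).
Proof. by rewrite in1E tens11 in12_1. Qed.
Lemma in1D x y : in1 (x + y) = in1 x + in1 y.
Proof. by rewrite !in1E tensDl in12D. Qed.
Lemma in1Z c x : in1 (c *: x) = c *: in1 x.
Proof. by rewrite !in1E tensZl in12Z. Qed.
Lemma in1_adj x : in1 (x^t*) = (in1 x)^t*.
Proof. by rewrite !in1E -in12_adj adj_tens adj1. Qed.
Lemma ntr_in1 x : ntr (in1 x) = ntr x.
Proof. by rewrite in1E ntr_in12 ntr_tens ntr1 // mulr1. Qed.

Lemma in3M x y : in3 (x *m y) = in3 x *m in3 y.
Proof. by rewrite /in3 !tens11 (tensmx_mul 1%:M x 1%:M y) mulmx1. Qed.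
Lemma in3_1 : in3 1%:M = 1%:M :> 'M[C]_(n * n * n).
Proof. by rewrite /in3 !tens11. Qed.
Lemma in3D x y : in3 (x + y) = in3 x + in3 y.
Proof. by rewrite /in3 tensDr. Qed.
Lemma in3Z c x : in3 (c *: x) = c *: in3 x.
Proof. by rewrite /in3 tensZr. Qed.
Lemma in3B x y : in3 (x - y) = in3 x - in3 y.
Proof. by rewrite in3D -scaleN1r in3Z scaleN1r. Qed.
Lemma in3_adj x : in3 (x^t*) = (in3 x)^t*.
Proof. by rewrite /in3 adj_tens tens11 adj1. Qed.
Lemma in3_psd x : psd (in3 x) -> psd x.
Proof. by rewrite /in3 tens11; apply: tens_psd_r; rewrite muln_gt0 n0. Qed.

Lemma in3_inj : injective (@in3 C n).
Proof.
move=> x y h; apply/matrixP=> i j; pose c := Ordinal n0.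
move/matrixP: h; rewrite /in3 tens11.
move=> /(_ (mxtens_index (mxtens_index (c, c), i)) (mxtens_index (mxtens_index (c, c), j))).
by rewrite !tensmxE !mxE eqxx !mul1r.
Qed.

Lemma tens_assoc x y z :
  castmx (mulnA n n n, mulnA n n n) (x *t (y *t z)) = x *t y *t z.
Proof.
apply/matrixP=> i j; rewrite castmxE {1}/tensmx !mxE mulrA /=.
rewrite ?divnMA; congr (x _ _ * y _ _ * z _ _); apply: val_inj => /=;
  by rewrite ?divnMA ?modn_divl ?modn_dvdm ?dvdn_mull.
Qed.

Lemma in1_cast x : in1 x = castmx (mulnA n n n, mulnA n n n) (x *t 1%:M).
Proof. by rewrite -(tens11 C n n) tens_assoc. Qed.

Lemma in1_in23 x Y : in1 x *m in23 Y = castmx (mulnA n n n, mulnA n n n) (x *t Y).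
Proof. by rewrite in1_cast /in23 -cast_sqM (tensmx_mul x 1%:M 1%:M Y) mulmx1 mul1mx. Qed.

Lemma in1_in23C x Y : in1 x *m in23 Y = in23 Y *m in1 x.
Proof.
by rewrite in1_in23 in1_cast /in23 -cast_sqM (tensmx_mul 1%:M Y x 1%:M) mulmx1 mul1mx.
Qed.

Lemma ntr_in1_in23 x Y : ntr (in1 x *m in23 Y) = ntr x * ntr Y.
Proof. by rewrite in1_in23 cast_sq_ntr ntr_tens. Qed.

Lemma tens_ind (P : 'M[C]_(n * n) -> Prop) : P 0 ->
  (forall X Y, P X -> P Y -> P (X + Y)) -> (forall c X, P X -> P (c *: X)) ->
  (forall x y, P (x *t y)) -> forall X, P X.
Proof.
move=> P0 PD PZ Pt X; rewrite [X]matrix_sum_delta.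
apply: big_ind => // i _; apply: big_ind => // j _; apply: PZ.
rewrite (_ : delta_mx i j = delta_mx (mxtens_unindex i).1 (mxtens_unindex j).1
  *t delta_mx (mxtens_unindex i).2 (mxtens_unindex j).2) //.
apply/matrixP=> a b; rewrite !mxE -natrM mulnb; congr (_%:R).
rewrite -(can_eq (@mxtens_unindexK n n) a) -(can_eq (@mxtens_unindexK n n) b).
by rewrite -!pair_eqE /pair_eq /= andbACA.
Qed.

(** Only the slice of [Y] over its third leg matters when it is paired with an
    operator of the first two legs. *)
Lemma ntr_in12_in23 X Y p : (forall z, ntr (Y *m (z *t 1%:M)) = ntr (z *m p)) ->
  ntr (in12 X *m in23 Y) = ntr (X *m (1%:M *t p)).
Proof.
move=> hp; elim/tens_ind: X => [|X X' e e'|c X e|x y].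
- by rewrite /in12 tens0mx !mul0mx !ntr0.
- by rewrite in12D !mulmxDl !ntrD e e'.
- by rewrite in12Z -!scalemxAl !ntrZ e.
have -> : in12 (x *t y) = in1 x *m in2 y.
  by rewrite in1E in2E -in12M (tensmx_mul x 1%:M 1%:M y) mulmx1 mul1mx.
rewrite in2E' -mulmxA -in23M ntr_in1_in23 (tensmx_mul x y 1%:M p) mulmx1 ntr_tens.
by rewrite ntrC hp.
Qed.

End Legs.

Section KrausOfPositive.
Variables (C : numClosedFieldType) (n p : nat) (V : 'M[C]_(n, p)).
Hypotheses (n0 : (0 < n)%N) (VV : V *m V^t* = 1%:M) (VV' : V^t* *m V = 1%:M).

(** [X] is the Choi matrix of the map: each vector in a decomposition of [X] into
    rank-one terms is [Lam V K] for some [K], and gives one Kraus operator. *)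
Lemma psd_kraus (X : 'M[C]_(n * n)) : psd X ->
  exists A : 'I_(n * n) -> 'M[C]_n,
    forall b z, ntr (X *m (b *t trV V z)) = ntr (kraus A z *m b).
Proof.
move=> /psd_sum_rank1[xi ->].
have [K hK] := boolp.choice (fun r => Lam_surj n0 VV VV' (xi r)).
exists (fun r => n%:R^-1 *: (K r)^t*) => b z.
rewrite /kraus !mulmx_suml !ntr_sum; apply: eq_bigr => r _.
have n1 : n%:R != 0 :> C by rewrite pnatr_eq0 -lt0n.
have -> : ntr (xi r *m (xi r)^t* *m (b *t trV V z)) =
    n%:R^-1 * n%:R^-1 * ntr ((K r)^t* *m (b *m K r *m z)).
  have cyc (x : 'cV[C]_(n * n)) B : \tr (x *m x^t* *m B) = \tr (x^t* *m (B *m x)).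
    by rewrite -mulmxA mxtrace_mulC mulmxA.
  rewrite {1}/ntr cyc hK (Lam_tens VV VV') (trVK VV VV').
  by rewrite (Lam_form VV VV') mxtrace_scalar mulr1n natrM invfM mulrC.
rewrite adjZ trmxCK fmorphV rmorph_nat -!scalemxAl -!scalemxAr -!scalemxAl !ntrZ mulrA.
by congr (_ * _); rewrite ntrC -!mulmxA ntrC -!mulmxA.
Qed.

End KrausOfPositive.

Section Dimension.
Variables (C : numClosedFieldType) (n D : nat) (n0 : (0 < n)%N).
Variables (Q : set 'M[C]_n) (g : 'I_D -> 'M[C]_n).

Lemma markov_basis_dim d : markov_basis Q g -> has_dim (@in1 _ n @` Q) d -> d = D.
Proof.
move=> hg [W hW <-].
pose X := [tuple in1 (g l) | l < D].
have XE (l : 'I_D) : X`_l = in1 (g l) by rewrite (nth_map l) ?size_enum_ord // nth_ord_enum.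
have in1_sum (a : 'I_D -> C) : \sum_l a l *: X`_l = in1 (\sum_l a l *: g l).
  apply: (big_rec2 (fun y z => y = in1 z)) => [|l z y _ ->].
    by rewrite -(scale0r (0 : 'M_n)) in1Z scale0r.
  by rewrite in1D in1Z XE.
have fX : free X.
  apply/freeP => a; rewrite in1_sum => h l.
  have /in12_inj : in12 ((\sum_l a l *: g l) *t 1%:M) = in12 0 :> 'M[C]_(n * n * n).
    by rewrite -in1E h /in12 tens0mx.
  move=> /(_ n0) h0; have : ntr ((g l)^t* *m (\sum_l a l *: g l)) = 0.
    by rewrite -(mulr1 (ntr _)) -[X in _ * X](ntr1 C n0) -ntr_tens -[1%:M]mulmx1
      -(tensmx_mul _ 1%:M _ 1%:M) h0 mulmx0 ntr0.
  rewrite mulmx_sumr ntr_sum (bigD1 l) //= big1 ?addr0 => [|k kl].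
    by rewrite -scalemxAr ntrZ (mb_orth hg) eqxx mulr1.
  by rewrite -scalemxAr ntrZ (mb_orth hg) eq_sym (negPf kl) mulr0.
have -> : W = <<X>>%VS.
  apply/eqP; rewrite eqEsubv; apply/andP; split.
    apply/subvP => x /hW[y hy <-]; rewrite (mb_span hg hy) -in1_sum.
    by apply: memv_suml => l _; apply: memvZ; apply: memv_span; apply: mem_nth; rewrite size_tuple.
  by apply/span_subvP => x /mapP[l _ ->]; apply/hW; exists (g l) => //; exact: (mb_in hg).
by move: fX; rewrite /free size_tuple => /eqP.
Qed.
End Dimension.

Section LegSpan.
Variables (C : numClosedFieldType) (n : nat) (n0 : (0 < n)%N) (Q : set 'M[C]_n).
Hypothesis hQ : unital_star_alg Q.

Lemma vee12_span X : vee (@in1 C n @` Q) (@in2 C n @` Q) X ->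
  exists2 X', tens_span Q X' & X = in12 X'.
Proof.
have [s0 sD sZ sM sA] := tens_span_star_alg hQ; have q1 := usa1 hQ.
pose S : set 'M[C]_(n * n * n) := [set X | exists2 X', tens_span Q X' & X = in12 X'].
apply: (gen_min (A := S)).
  split=> [|_ _ [X1 h1 ->] [X2 h2 ->]|c _ [X1 h1 ->]|_ _ [X1 h1 ->] [X2 h2 ->]|_ [X1 h1 ->]].
  - by exists 0 => //; rewrite /in12 tens0mx.
  - by exists (X1 + X2); [exact: sD | rewrite in12D].
  - by exists (c *: X1); [exact: sZ | rewrite in12Z].
  - by exists (X1 *m X2); [exact: sM | rewrite in12M].
  - by exists (X1^t*); [exact: sA | rewrite in12_adj].
by move=> _ [[x hx <-]|[x hx <-]]; eexists; rewrite ?in1E ?in2E //; exact: tens_span_tens.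
Qed.

Lemma vee23_span X : vee (@in2 C n @` Q) (@in3 C n @` Q) X ->
  exists2 X', tens_span Q X' & X = in23 X'.
Proof.
have [s0 sD sZ sM sA] := tens_span_star_alg hQ; have q1 := usa1 hQ.
pose S : set 'M[C]_(n * n * n) := [set X | exists2 X', tens_span Q X' & X = in23 X'].
apply: (gen_min (A := S)).
  split=> [|_ _ [X1 h1 ->] [X2 h2 ->]|c _ [X1 h1 ->]|_ _ [X1 h1 ->] [X2 h2 ->]|_ [X1 h1 ->]].
  - by exists 0 => //; rewrite -(scale0r (0 : 'M[C]_(n * n))) in23Z scale0r.
  - by exists (X1 + X2); [exact: sD | rewrite in23D].
  - by exists (c *: X1); [exact: sZ | rewrite in23Z].
  - by exists (X1 *m X2); [exact: sM | rewrite in23M].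
  - by exists (X1^t*); [exact: sA | rewrite in23_adj].
by move=> _ [[x hx <-]|[x hx <-]]; eexists; rewrite ?in2E' ?in3E //; exact: tens_span_tens.
Qed.

Local Notation M3 := (tens3 [set: 'M[C]_n] [set: 'M[C]_n] Q).

Lemma tens3_star_alg : star_alg M3. Proof. exact: gen_star_alg. Qed.

Lemma tens3_in1 x : M3 (in1 x).
Proof. by apply: gen_sub; exists x, 1%:M, 1%:M; split=> //; exact: (usa1 hQ). Qed.
Lemma tens3_in2 x : M3 (in2 x).
Proof. by apply: gen_sub; exists 1%:M, x, 1%:M; split=> //; exact: (usa1 hQ). Qed.
Lemma tens3_in3 x : Q x -> M3 (in3 x).
Proof. by move=> hx; apply: gen_sub; exists 1%:M, 1%:M, x; split. Qed.

Lemma vee12_tens3 X : vee (@in1 C n @` Q) (@in2 C n @` Q) X -> M3 X.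
Proof.
apply: gen_min; first exact: tens3_star_alg.
by move=> _ [[x hx <-]|[x hx <-]]; [exact: tens3_in1 | exact: tens3_in2].
Qed.

Lemma vee23_tens3 X : vee (@in2 C n @` Q) (@in3 C n @` Q) X -> M3 X.
Proof.
apply: gen_min; first exact: tens3_star_alg.
by move=> _ [[x hx <-]|[x hx <-]]; [exact: tens3_in2 | exact: tens3_in3].
Qed.

Lemma cond_exp_ntr m (R A : set 'M[C]_m) E X b : cond_exp R A E ->
  star_alg R -> R 1%:M -> A 1%:M -> R X -> A b -> R b ->
  ntr (E X *m b) = ntr (X *m b).
Proof.
move=> [_ bi _ tr] [_ _ _ hM _] r1 a1 rX ab rb.
by rewrite -[E X]mul1mx -bi // tr ?mul1mx //; apply: hM.
Qed.

End LegSpan.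

Section JonesPairing.
Variables (C : numClosedFieldType) (n p D : nat) (V : 'M[C]_(n, p)).
Hypotheses (n0 : (0 < n)%N) (VV : V *m V^t* = 1%:M) (VV' : V^t* *m V = 1%:M).
Variables (Q : set 'M[C]_n) (g : 'I_D -> 'M[C]_n) (eN : 'M[C]_(n * n)).
Hypothesis hg : markov_basis Q g.
Hypothesis Q_trV : forall x, Q x -> Q (trV V x).
Hypothesis eN_def : eN = D%:R^-1 *: \sum_l g l *t trV V ((g l)^t*).
Let hQ := mb_alg hg.
Implicit Types x y a b : 'M[C]_n.

Lemma jones_pair a b : Q b -> ntr (eN *m (a *t trV V b)) = D%:R^-1 * ntr (b *m a).
Proof.
move=> hb; rewrite eN_def -scalemxAl ntrZ; congr (_ * _).
rewrite mulmx_suml ntr_sum {2}(mb_span hg hb) mulmx_suml ntr_sum.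
apply: eq_bigr => l _; rewrite (tensmx_mul (g l) (trV V ((g l)^t*)) a (trV V b)).
rewrite ntr_tens -(trVM VV VV') (ntr_trV VV VV') -scalemxAl ntrZ mulrC.
by rewrite ntrC.
Qed.

Lemma jones_pair_l x y a b : Q b ->
  ntr ((x *t 1%:M) *m eN *m (y *t 1%:M) *m (a *t trV V b)) =
  D%:R^-1 * ntr (b *m (y *m a *m x)).
Proof.
move=> hb; rewrite -jones_pair // -!mulmxA [LHS]ntrC -!mulmxA; congr (ntr (_ *m _)).
rewrite (tensmx_mul a (trV V b) x 1%:M) (tensmx_mul y 1%:M (a *m x) (trV V b *m 1%:M)).
by rewrite mulmx1 mul1mx.
Qed.

Lemma jones_pair_r x y a b : Q (y *m b *m x) ->
  ntr ((1%:M *t x) *m eN *m (1%:M *t y) *m (a *t b)) =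
  D%:R^-1 * ntr (a *m trV V (y *m b *m x)).
Proof.
move=> hb; rewrite [in RHS]ntrC -jones_pair; last exact: Q_trV.
rewrite (trVK VV VV') -!mulmxA [LHS]ntrC -!mulmxA; congr (ntr (_ *m _)).
rewrite (tensmx_mul a b 1%:M x) (tensmx_mul 1%:M y (a *m 1%:M) (b *m x)).
by rewrite mulmx1 mul1mx.
Qed.

Lemma jones_span_l x y : (forall z, Q z -> Q (x *m z *m y)) ->
  tens_span Q ((x *t 1%:M) *m eN *m (y *t 1%:M)).
Proof.
move=> h; have [s0 sD sZ sM sA] := tens_span_star_alg hQ.
rewrite eN_def -scalemxAr -scalemxAl mulmx_sumr mulmx_suml; apply: sZ.
apply: big_ind => // l _.
rewrite (tensmx_mul x 1%:M (g l)) (tensmx_mul _ _ y 1%:M) mul1mx mulmx1.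
apply: tens_span_tens; first by apply/h/(mb_in hg).
by apply/Q_trV/(usa_adj hQ)/(mb_in hg).
Qed.

Lemma jones_span_r x y : (forall z, Q z -> Q (x *m z *m y)) ->
  tens_span Q ((1%:M *t x) *m eN *m (1%:M *t y)).
Proof.
move=> h; have [s0 sD sZ sM sA] := tens_span_star_alg hQ.
rewrite eN_def -scalemxAr -scalemxAl mulmx_sumr mulmx_suml; apply: sZ.
apply: big_ind => // l _.
rewrite (tensmx_mul 1%:M x (g l)) (tensmx_mul _ _ 1%:M y) mul1mx mulmx1.
apply: tens_span_tens; first exact: (mb_in hg).
by apply/h/Q_trV/(usa_adj hQ)/(mb_in hg).
Qed.

(** Slicing off the second leg of [eN] leaves the scalar [D^-1]. *)
Lemma pp_basis_index d (l : 'I_d -> 'M[C]_n) : pp_basis eN l ->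
  \sum_i (l i)^t* *m l i = D%:R%:M.
Proof.
move=> hl; apply/eqP; rewrite -subr_eq0; apply/eqP/ntr_nondeg => a.
have D0 : D%:R != 0 :> C := mb_size_neq0 n0 hg.
rewrite mulmxBl ntrB mul_scalar_mx ntrZ.
have : ntr ((\sum_i ((l i)^t* *t 1%:M) *m eN *m (l i *t 1%:M)) *m (a *t trV V 1%:M)) = ntr a.
  by rewrite hl mul1mx (trV1 VV VV') ntr_tens ntr1 // mulr1.
rewrite mulmx_suml ntr_sum => <-; rewrite mulmx_suml ntr_sum mulr_sumr.
apply/eqP; rewrite subr_eq0; apply/eqP/eq_bigr => i _.
rewrite jones_pair_l; last exact: (usa1 hQ).
by rewrite mulVKf // mul1mx ntrC mulmxA ntrC mulmxA.
Qed.

End JonesPairing.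

(** * From a scheme to maps of the algebra *)

Section SchemeData.
Variables (C : numClosedFieldType) (n p D : nat) (V : 'M[C]_(n, p)).
Hypotheses (n0 : (0 < n)%N) (VV : V *m V^t* = 1%:M) (VV' : V^t* *m V = 1%:M).
Variables (N : set 'M[C]_n).
Local Notation Q := (commutant N).
Hypothesis hQ : unital_star_alg Q.
Hypothesis Q_trV : forall x, Q x -> Q (trV V x).

Local Notation M3 := (tens3 [set: 'M[C]_n] [set: 'M[C]_n] Q).
Local Notation A := (@in12 C n @` [set: 'M[C]_(n * n)]).
Local Notation B := (@in3 C n @` Q).
Local Notation A0 := (@in1 C n @` Q).
Local Notation A1 := (@in2 C n @` Q).

Variables (gamma0 gamma1 E : 'M[C]_(n * n * n) -> 'M[C]_(n * n * n)).
Hypothesis hgamma0 : forall x, Q x -> gamma0 (in1 x) = in2 (trV V x).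
Hypothesis hgamma1 : forall x, Q x -> gamma1 (in2 x) = in3 (trV V x).
Hypothesis hE : cond_exp M3 A0 E.

Variables (omega : 'M[C]_(n * n * n)) (F : 'I_D -> 'M[C]_(n * n * n))
  (T : 'I_D -> 'M[C]_(n * n * n) -> 'M[C]_(n * n * n)).
Hypothesis hs : teleportation_scheme M3 A B A0 (gamma1 \o gamma0) E omega F T.
Hypothesis hmin : minimal_scheme B A0 A1 omega F.
Hypothesis hfaith : faithful_scheme A0 omega F.

(** A channel preserves the third leg, and inherits the Kadison--Schwarz
    inequality there. *)
Lemma scheme_channels : exists t : 'I_D -> 'M[C]_n -> 'M[C]_n,
  (forall i, ks_map Q (t i)) /\ forall i x, Q x -> T i (in3 x) = in3 (t i x).
Proof.
have [t ht] : exists t : 'I_D * 'M[C]_n -> 'M[C]_n, forall ix, Q ix.2 ->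
    Q (t ix) /\ T ix.1 (in3 ix.2) = in3 (t ix).
  have H ix : exists y, Q ix.2 -> Q y /\ T ix.1 (in3 ix.2) = in3 y.
    have [hx|hx] := pselect (Q ix.2); last by exists 0.
    have [|y hy e] := ts_preserve hs ix.1 (b := in3 ix.2); first by exists ix.2.
    by exists y.
  by have [t ht] := boolp.choice H; exists t.
pose R := vee A B.
have hR : star_alg R by exact: gen_star_alg.
have inR x : Q x -> R (in3 x) by move=> hx; apply: gen_sub; right; exists x.
have R1 : R 1%:M by rewrite -in3_1; apply: inR; exact: (usa1 hQ).
have tE i x : Q x -> T i (in3 x) = in3 (t (i, x)) by move=> /(ht (i, x))[].
have tQ i x : Q x -> Q (t (i, x)) by move=> /(ht (i, x))[].
exists (fun i x => t (i, x)); split=> // i.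
have hu := ts_ucp hs i; have [[_ hl _] T1] := hu.
have ks x (hx : Q x) := ucp_kadison_schwarz hR R1 hu (inR _ hx).
split=> [a x y hx hy|x hx||x hx|x hx].
- apply: (in3_inj n0); rewrite -tE; last by apply: (usaD hQ) => //; exact: (usaZ hQ).
  by rewrite !in3D !in3Z hl ?tE //; exact: inR.
- exact: tQ.
- by apply: (in3_inj n0); rewrite -tE ?in3_1 //; exact: (usa1 hQ).
- apply: (in3_inj n0); rewrite -tE; last exact: (usa_adj hQ).
  by rewrite in3_adj (ks x hx).1 tE // in3_adj.
- apply: (in3_psd n0); rewrite in3B -tE; last by apply: (usaM hQ) => //; exact: (usa_adj hQ).
  by rewrite !in3M !in3_adj -tE //; exact: (ks x hx).2.
Qed.

(** The second leg carries the transposed copy of the algebra, hence the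
    transposes around the Kraus operators. *)
Lemma scheme_resource : exists (omega' : 'M[C]_(n * n)) (B' : 'I_(n * n) -> 'M[C]_n),
  [/\ omega = in23 omega', tens_span Q omega',
      forall z y, ntr (omega' *m (z *t y)) = ntr (z *m trV V (kraus B' y)) &
      forall y, Q y -> Q (kraus B' y)].
Proof.
have [omega' span_o eo] := vee23_span hQ (hmin.1).
have po : psd omega' by apply: (in23_psd n0); rewrite -eo; case: (ts_density hs).
have [K hK] := psd_kraus n0 VV VV' po.
pose B' r := trV V ((K r)^t*).
have eB y : trV V (kraus B' y) = kraus K (trV V y).
  rewrite /kraus (trV_sum VV VV'); apply: eq_bigr => r _.
  by rewrite /B' !(trVM VV VV') -(trV_adj VV VV') trmxCK !(trVK VV VV') mulmxA.
have pairing z y : ntr (omega' *m (z *t y)) = ntr (z *m trV V (kraus B' y)).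
  by rewrite eB -[in LHS](trVK VV VV' y) hK ntrC.
exists omega', B'; split=> // y hy.
rewrite -[kraus _ _](trVK VV VV'); apply: Q_trV.
apply: (tens_span_slice (c := y) erefl span_o) => b.
by rewrite pairing ntrC.
Qed.

Lemma scheme_measurement : exists (F' : 'I_D -> 'M[C]_(n * n))
    (A' : 'I_D -> 'I_(n * n) -> 'M[C]_n),
  [/\ forall i, F i = in12 (F' i), forall i, tens_span Q (F' i),
      forall i b z, ntr (F' i *m (b *t trV V z)) = ntr (kraus (A' i) z *m b),
      forall i z, Q z -> Q (kraus (A' i) z) &
      forall z, Q z -> \sum_i kraus (A' i) z = (ntr z)%:M].
Proof.
have H i : exists F', tens_span Q F' /\ F i = in12 F'.
  by have [F' h1 h2] := vee12_span hQ (hmin.2 i); exists F'.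
have [F' hF] := boolp.choice H.
have pF i : psd (F' i) by apply: (in12_psd n0); rewrite -(hF i).2; exact: (ts_povm_psd hs).
have [A' hA] := boolp.choice (fun i => psd_kraus n0 VV VV' (pF i)).
have sF : \sum_i F' i = 1%:M.
  apply: (in12_inj n0); rewrite in12_sum in12_1 -(ts_povm_sum hs).
  by apply: eq_bigr => i _; rewrite (hF i).2.
exists F', A'; split=> //.
- by move=> i; exact: (hF i).2.
- by move=> i; exact: (hF i).1.
- move=> i z hz; apply: (tens_span_slice (c := trV V z) erefl (hF i).1) => b.
  exact: hA.
- move=> z hz; apply/eqP; rewrite -subr_eq0; apply/eqP/ntr_nondeg => b.
  rewrite mulmxBl ntrB mulmx_suml ntr_sum.
  under eq_bigr => i _ do rewrite -hA.
  rewrite -ntr_sum -mulmx_suml sF mul1mx ntr_tens (ntr_trV VV VV').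
  by rewrite mul_scalar_mx ntrZ mulrC subrr.
Qed.

(** The resource is sliced along its third leg first; what remains is paired with
    the measurement on the first two. *)
Lemma leg_pairing (F' omega' : 'M[C]_(n * n)) (G W : 'M[C]_n -> 'M[C]_n) y b :
  (forall b z, ntr (F' *m (b *t trV V z)) = ntr (G z *m b)) ->
  (forall z y, ntr (omega' *m (z *t y)) = ntr (z *m trV V (W y))) ->
  ntr (in12 F' *m in3 y *m in23 omega' *m in1 b) = ntr (G (W y) *m b).
Proof.
move=> hF hW.
have -> : in12 F' *m in3 y *m in23 omega' *m in1 b =
    in12 (F' *m (b *t 1%:M)) *m in23 ((1%:M *t y) *m omega').
  rewrite in12M in23M -in1E -in3E -!mulmxA; congr (_ *m _).
  by rewrite -in1_in23C !mulmxA !in3E in1_in23C.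
rewrite (ntr_in12_in23 _ (p := trV V (W y))) => [|z].
  rewrite -mulmxA (tensmx_mul b 1%:M 1%:M (trV V (W y))).
  by rewrite mulmx1 mul1mx hF.
rewrite -hW -mulmxA [LHS]ntrC -mulmxA (tensmx_mul z 1%:M 1%:M y).
by rewrite mulmx1 mul1mx.
Qed.

Lemma psd_in1 (rho : 'M[C]_n) : psd rho -> psd (in1 rho).
Proof.
move=> h; have [S [hS <- _]] := psd_sqrt h.
by rewrite -{1}(psd_herm hS) in1M in1_adj; exact: psd_adjM.
Qed.

(** Testing the teleportation identity against the algebra in the first leg turns
    it into an identity of maps; faithfulness only concerns the values of these
    maps at the unit. *)
Lemma scheme_maps : exists (t : 'I_D -> 'M[C]_n -> 'M[C]_n)
    (omega' : 'M[C]_(n * n)) (F' : 'I_D -> 'M[C]_(n * n))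
    (K : 'I_D -> 'I_(n * n) -> 'M[C]_n) (L : 'I_(n * n) -> 'M[C]_n),
  [/\ [/\ forall i, ks_map Q (t i), forall i x, Q x -> T i (in3 x) = in3 (t i x),
         omega = in23 omega' /\ tens_span Q omega' &
         forall i, F i = in12 (F' i) /\ tens_span Q (F' i)],
      (forall z y, ntr (omega' *m (z *t y)) = ntr (z *m trV V (kraus L y))) /\
      (forall i b z, ntr (F' i *m (b *t trV V z)) = ntr (kraus (K i) z *m b)),
      (forall y, Q y -> Q (kraus L y)) /\ (forall i z, Q z -> Q (kraus (K i) z)),
      (forall x, Q x -> \sum_i kraus (K i) (kraus L (t i x)) = x) /\
      (forall z, Q z -> \sum_i kraus (K i) z = (ntr z)%:M) &
      ntr (kraus L 1%:M) = 1 /\ (forall i rho, density Q rho ->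
        0 < ntr (kraus (K i) (kraus L 1%:M) *m rho))].
Proof.
have [t [tks tE]] := scheme_channels.
have [omega' [L [eo so oL LQ]]] := scheme_resource.
have [F' [K [eF sF FK KQ povm]]] := scheme_measurement.
exists t, omega', F', K, L; split=> //.
- split=> // x hx; apply/eqP; rewrite -subr_eq0; apply/eqP.
  set X := \sum_i _.
  have hX : Q X.
    apply: (usa_sum hQ) => i _; apply: KQ; apply: LQ.
    by case: (tks i) => _ tQ _ _ _; exact: tQ.
  have key b : Q b -> ntr (X *m b) = ntr (x *m b).
    move=> hb; rewrite /X mulmx_suml ntr_sum.
    have := ts_teleport hs (a := in1 x); rewrite /= hgamma0 // hgamma1; last exact: Q_trV.
    rewrite (trVK VV VV') => e.
    have {}e : \sum_i E (F i *m T i (in3 x) *m omega) = in1 x by apply: e; exists x.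
    rewrite -[RHS](ntr_in1 n0) in1M -e mulmx_suml ntr_sum; apply: eq_bigr => i _.
    have [_ _ _ M3M _] := @tens3_star_alg C n Q.
    have txQ : Q (t i x) by case: (tks i) => _ tQ _ _ _; exact: tQ.
    rewrite (cond_exp_ntr hE (@tens3_star_alg C n Q)).
    + by rewrite eF tE // eo (leg_pairing _ _ (FK i) oL).
    + by rewrite -in1_1; exact: tens3_in1.
    + by exists 1%:M; [exact: (usa1 hQ) | exact: in1_1].
    + apply: (M3M); first apply: (M3M).
      * by apply: (vee12_tens3 hQ); exact: (hmin.2 i).
      * by rewrite tE //; exact: tens3_in3.
      * by apply: (vee23_tens3 hQ); exact: hmin.1.
    + by exists b.
    + exact: tens3_in1.
  apply: ntr_adjM_eq0; rewrite ntrC mulmxBl ntrB key ?subrr //.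
  by apply: (usa_adj hQ); exact: (usaB hQ).
- split.
    have := oL 1%:M 1%:M; rewrite tens11 mulmx1 mul1mx (ntr_trV VV VV') => <-.
    by rewrite -(ntr_in23 n0) -eo; case: (ts_density hs).
  move=> i rho [hr pr nr].
  have : density A0 (in1 rho).
    by split; [exists rho | exact: psd_in1 | rewrite (ntr_in1 n0)].
  move/(hfaith i); rewrite eF eo.
  have <- : in12 (F' i) *m in3 1%:M *m in23 omega' *m in1 rho =
            in12 (F' i) *m in1 rho *m in23 omega'.
    by rewrite in3_1 mulmx1 -!mulmxA in1_in23C.
  by rewrite (leg_pairing _ _ (FK i) oL).
Qed.

End SchemeData.

(** * The form of the resource, of the measurement and of the channels *)

Section Conclusion.
Variables (C : numClosedFieldType) (n p D : nat) (V : 'M[C]_(n, p)).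
Hypotheses (n0 : (0 < n)%N) (VV : V *m V^t* = 1%:M) (VV' : V^t* *m V = 1%:M).
Variables (N : set 'M[C]_n) (g : 'I_D -> 'M[C]_n) (eN : 'M[C]_(n * n)).
Local Notation Q := (commutant N).
Hypotheses (hN : unital_star_alg N) (hNQ : commutant Q = N) (hg : markov_basis Q g).
Hypothesis Q_trV : forall x, Q x -> Q (trV V x).
Hypothesis eN_def : eN = D%:R^-1 *: \sum_l g l *t trV V ((g l)^t*).

Let hQ := mb_alg hg.
Let D0 : D%:R != 0 :> C := mb_size_neq0 n0 hg.

Lemma normalises_normaliser u : normalises Q u -> normaliser N u.
Proof.
move=> nu; split; first by case: nu.
have [uu _ _] := nu.
apply/seteqP; split=> x /=.
  move=> [y hy <-]; rewrite -hNQ -{2}(trmxCK u).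
  by apply: (commutant_conj (normalises_adj nu)); rewrite hNQ.
move=> hx; exists (u *m x *m u^t*); last exact: unitary_conjK.
by rewrite -hNQ; apply: commutant_conj => //; rewrite hNQ.
Qed.

Section Unitaries.
Variables (r v : 'M[C]_n) (u_ : 'I_D -> 'M[C]_n).
Hypotheses (r_psd : psd r) (rQ : Q r) (rC : commutant Q r) (r_unit : r \in unitmx).
Hypotheses (nv : normalises Q v) (nu : forall i, normalises Q (u_ i)).

Let vu : v \is unitarymx. Proof. by case: nv. Qed.
Let uu i : u_ i \is unitarymx. Proof. by case: (nu i). Qed.

Lemma root_center : [/\ N (v^t* *m (r *m r) *m v), Q (v^t* *m (r *m r) *m v),
   psd (v^t* *m (r *m r) *m v) & v^t* *m (r *m r) *m v \in unitmx].
Proof.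
split.
- rewrite -hNQ -{2}(trmxCK v); apply: (commutant_conj (normalises_adj nv)).
  exact: commutantM.
- by case: nv => _ _; apply; exact: (usaM hQ).
- apply: psd_conj; rewrite -{1}(psd_herm r_psd); exact: psd_adjM.
- by rewrite !unitmx_mul r_unit !unitarymx_unit // trmxC_unitary.
Qed.

Lemma root_sqr : psd (v^t* *m r *m v) /\
  (v^t* *m r *m v) *m (v^t* *m r *m v) = v^t* *m (r *m r) *m v.
Proof.
split; first exact: psd_conj.
by rewrite !mulmxA -(mulmxA _ v) unitary_adjr // mulmx1.
Qed.

Lemma resource_form (omega' : 'M[C]_(n * n)) (W : 'M[C]_n -> 'M[C]_n) :
  tens_span Q omega' ->
  (forall y, Q y -> Q (W y)) ->
  (forall z y, ntr (omega' *m (z *t y)) = ntr (z *m trV V (W y))) ->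
  (forall y, Q y -> W y = r *m (v *m y *m v^t*) *m r) ->
  omega' = D%:R *: ((1%:M *t (v^t* *m r *m v *m v^t*)) *m eN
                    *m (1%:M *t (v *m (v^t* *m r *m v)))).
Proof.
move=> so hWQ hW We.
have e1 : v^t* *m r *m v *m v^t* = v^t* *m r by rewrite -mulmxA unitary_adjr // mulmx1.
have e2 : v *m (v^t* *m r *m v) = r *m v by rewrite !mulmxA unitary_adjr // mul1mx.
have [s0 sD sZ _ _] := tens_span_star_alg hQ.
have eW y : Q y -> r *m v *m y *m (v^t* *m r) = W y.
  by move=> hy; rewrite We // !mulmxA.
rewrite e1 e2; apply: (tens_span_eq hQ) => //.
  apply: sZ; apply: (jones_span_r hg Q_trV eN_def) => z hz.
  have -> : v^t* *m r *m z *m (r *m v) = v^t* *m (r *m z *m r) *m v by rewrite !mulmxA.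
  by case: nv => _ _; apply; apply: (usaM hQ) => //; exact: (usaM hQ).
move=> a b ha hb; rewrite -scalemxAl ntrZ (jones_pair_r VV VV' hg Q_trV eN_def).
  by rewrite mulVKf // eW.
by rewrite eW //; exact: hWQ.
Qed.

Lemma measurement_form i (F' : 'M[C]_(n * n)) (G : 'M[C]_n -> 'M[C]_n) :
  tens_span Q F' ->
  (forall b z, ntr (F' *m (b *t trV V z)) = ntr (G z *m b)) ->
  (forall z, Q z -> G z = D%:R^-1 *: ((v *m u_ i)^t* *m z *m (v *m u_ i))) ->
  F' = (((u_ i)^t* *m v^t*) *t 1%:M) *m eN *m ((v *m u_ i) *t 1%:M).
Proof.
move=> sF hF hG; have nvu : normalises Q (v *m u_ i) by exact: normalises_mul.
apply: (tens_span_eq hQ) => //.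
  apply: (jones_span_l hg Q_trV eN_def) => z hz.
  by rewrite -adjM; case: nvu => _ _; apply.
move=> a b ha hb; rewrite -[b](trVK VV VV').
have hb' := Q_trV hb; rewrite hF hG // (jones_pair_l VV VV' hg eN_def) //.
rewrite -scalemxAl ntrZ adjM; congr (_ * _).
by move: (trV V b) (_^t* *m _) (v *m _) => c x y; rewrite -!mulmxA [LHS]ntrC -!mulmxA.
Qed.

Lemma unitaries_pp_basis (G : 'I_D -> 'M[C]_n -> 'M[C]_n) :
  (forall z, Q z -> \sum_i G i z = (ntr z)%:M) ->
  (forall i z, Q z -> G i z = D%:R^-1 *: ((v *m u_ i)^t* *m z *m (v *m u_ i))) ->
  pp_basis eN u_.
Proof.
move=> povm hG; have [s0 sD sZ _ _] := tens_span_star_alg hQ.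
apply: (tens_span_eq hQ).
- apply: big_ind => // i _; apply: (jones_span_l hg Q_trV eN_def) => z hz.
  by case: (nu i) => _ _; apply.
- by rewrite -tens11; apply: tens_span_tens; exact: (usa1 hQ).
move=> a b ha hb; rewrite -[b](trVK VV VV'); have := Q_trV hb.
move: (trV V b) => c hc; rewrite mul1mx ntr_tens (ntr_trV VV VV').
have hz : Q (v *m c *m v^t*) by case: nv => _ h _; exact: h.
have := povm _ hz; rewrite ntr_conj // => e.
have -> : ntr a * ntr c = ntr ((\sum_i G i (v *m c *m v^t*)) *m a).
  by rewrite e mul_scalar_mx ntrZ mulrC.
rewrite !mulmx_suml !ntr_sum; apply: eq_bigr => i _.
rewrite (jones_pair_l VV VV' hg eN_def) // hG // -scalemxAl ntrZ; congr (_ * _).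
have -> : (v *m u_ i)^t* *m (v *m c *m v^t*) *m (v *m u_ i) = (u_ i)^t* *m c *m u_ i.
  rewrite adjM -!mulmxA (mulmxA (v^t*) v) (mulmxA (v^t*) v) unitary_adjl // !mul1mx.
  by [].
by rewrite -!mulmxA [RHS]ntrC -!mulmxA.
Qed.

Lemma unitaries_orthonormal (EN : 'M[C]_n -> 'M[C]_n) :
  cond_exp [set: 'M[C]_n] N EN -> pp_basis eN u_ ->
  (forall i j y, i != j -> commutant Q y -> ntr (u_ i *m (u_ j)^t* *m y) = 0) ->
  orthonormal_basis eN EN u_.
Proof.
move=> hEN hpp ho; split=> // i j.
have [[_ ENin ENid] _ _ _] := hEN.
have [->|ij] := eqVneq i j.
  by rewrite unitary_adjr // ENid //; exact: (usa1 hN).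
rewrite raddf0; apply: ntr_adjM_eq0; rewrite ntrC.
have hy : N ((EN (u_ i *m (u_ j)^t*))^t*) by apply: (usa_adj hN); exact: ENin.
rewrite (cond_exp_ntr hEN) //.
- by rewrite ho // hNQ.
- exact: (usa1 hN).
Qed.

Lemma basis_index : pp_basis eN u_ -> is_index eN D%:R.
Proof.
move=> hpp; split; first by exists D, u_.
by move=> d l; exact: (pp_basis_index n0 VV VV' hg eN_def).
Qed.

End Unitaries.
End Conclusion.

Theorem theorem4p1 (R : realType) (n : nat) (hn : (0 < n)%N)
  (N : set 'M[cplx R]_n) (hN : unital_star_alg N)
  (k : nat) (nn mm : 'I_k -> nat)
  (V : 'M[cplx R]_(n, \sum_(j < k) nn j * mm j)) (hV : block_basis V N)
  (eN : 'M[cplx R]_(n * n)) (heN : jones_proj V N eN)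
  (EN : 'M[cplx R]_n -> 'M[cplx R]_n) (hEN : cond_exp [set: 'M[cplx R]_n] N EN)
  (hmarkov : markov_trace V [set c%:M | c in [set: cplx R]] (commutant N))
  (gamma0 gamma1 : 'M[cplx R]_(n * n * n) -> 'M[cplx R]_(n * n * n))
  (hgamma0 : forall x, commutant N x -> gamma0 (in1 x) = in2 (trV V x))
  (hgamma1 : forall x, commutant N x -> gamma1 (in2 x) = in3 (trV V x))
  (E : 'M[cplx R]_(n * n * n) -> 'M[cplx R]_(n * n * n))
  (hE : cond_exp (tens3 [set: 'M[cplx R]_n] [set: 'M[cplx R]_n] (commutant N))
          (@in1 _ n @` commutant N) E)
  (d : nat) (omega : 'M[cplx R]_(n * n * n))
  (F : 'I_d -> 'M[cplx R]_(n * n * n))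
  (T : 'I_d -> 'M[cplx R]_(n * n * n) -> 'M[cplx R]_(n * n * n))
  (hscheme : teleportation_scheme
     (tens3 [set: 'M[cplx R]_n] [set: 'M[cplx R]_n] (commutant N))
     (@in12 _ n @` [set: 'M[cplx R]_(n * n)])
     (@in3 _ n @` commutant N)
     (@in1 _ n @` commutant N)
     (gamma1 \o gamma0) E omega F T)
  (htight : tight_scheme (@in1 _ n @` commutant N) d)
  (hminimal : minimal_scheme (@in3 _ n @` commutant N)
     (@in1 _ n @` commutant N) (@in2 _ n @` commutant N) omega F)
  (hfaithful : faithful_scheme (@in1 _ n @` commutant N) omega F) :
  exists (u_ : 'I_d -> 'M[cplx R]_n) (u z sqrtz : 'M[cplx R]_n) (index : cplx R),
    [/\ orthonormal_basis eN EN u_ /\ (forall i, normaliser N (u_ i)),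
        normaliser N u,
        [/\ N z, commutant N z, psd z & z \in unitmx],
        psd sqrtz /\ sqrtz *m sqrtz = z &
        [/\ is_index eN index,
            omega = index *: in23 ((1%:M *t (sqrtz *m u)) *m eN
                                   *m (1%:M *t (u^t* *m sqrtz))),
            forall i, F i = in12 ((((u_ i)^t* *m u) *t 1%:M) *m eN
                                  *m ((u^t* *m u_ i) *t 1%:M)) &
            forall i x, commutant N x ->
              T i (in3 x) = in3 (u_ i *m x *m (u_ i)^t*)]].
Proof.
have hg := unit_markov_basis hn hV hN hmarkov.
have eD := markov_basis_dim hn hg htight; subst d.
have [VV VV' _ _ _] := hV.
have hQ := mb_alg hg; have Q_trV := commutant_trV hV; have hNQ := bicommutant hV.
have eN_def := jones_commutant hn VV VV' hg hNQ heN.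
have spatial t (ht : star_auto (commutant N) t) :=
  star_auto_spatial hn hV hN ht (fun x hx => star_auto_ntr hn hg ht hx).
have [t [om [F' [K [L [[tks tE [eo so] eF] [oL FK] [LQ KQ] [tele povm] [L1 hf]]]]]]] :=
  scheme_maps hn VV VV' hQ Q_trV hgamma0 hgamma1 hE hscheme hminimal hfaithful.
have [r [v [u_ [[r_psd rQ rC r_unit] [nv nu] tu Lu [Ku ortho]]]]] :=
  scheme_rigidity hn hg spatial tks KQ LQ tele povm L1 hf.
have pp := unitaries_pp_basis VV VV' hg Q_trV eN_def nv nu povm Ku.
have adjv : (v^t*)^t* = v := trmxCK v.
(* [v^* r v] sits on the other side of [u = v^*] from [r]. *)
exists u_, (v^t*), (v^t* *m (r *m r) *m v), (v^t* *m r *m v), #|{: unit_index mm}|%:R.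
split.
- split; first exact: (unitaries_orthonormal hN hNQ nu hEN pp ortho).
  by move=> i; exact: (normalises_normaliser hNQ (nu i)).
- by apply: (normalises_normaliser hNQ); exact: normalises_adj.
- exact: (root_center hNQ hg r_psd rQ rC r_unit nv).
- exact: (root_sqr r_psd nv).
- split.
  + exact: (basis_index hn VV VV' hg eN_def pp).
  + rewrite eo -in23Z adjv; congr in23.
    exact: (resource_form hn VV VV' hg Q_trV eN_def rQ nv so LQ oL Lu).
  + move=> i; rewrite (eF i).1 adjv; congr in12.
    exact: (measurement_form VV VV' hg Q_trV eN_def nv nu (eF i).2 (FK i) (Ku i)).
  + by move=> i x hx; rewrite tE // tu.
Qed.
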